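(* Let $d$ be a cardinal with $2\le d\le\omega$. There is a tree $T_d$ on $d^d$ with suitable levels such that for every non self-dual Wadge class of Borel sets $\Gamma$: (1) there is a set $\mathbb{S}^d_\Gamma\in\Gamma([T_d])$ which is not separable from $[T_d]\setminus\mathbb{S}^d_\Gamma$ by a $\mathrm{pot}(\check\Gamma)$ set; (2) if moreover $\Gamma$ does not have the separation property, and either $\Gamma=\Sigma^0_\xi$ for some $1\le\xi<\omega_1$ or $\Delta(\Gamma)$ is a Wadge class, then there are disjoint sets $\mathbb{S}^0_\Gamma,\mathbb{S}^1_\Gamma\in\Gamma([T_d])$ which are not separable by a $\mathrm{pot}(\Delta(\Gamma))$ set.
   Context: $d$ is identified with $\{0,\dots,d-1\}$ (or $\omega$) with the discrete topology. For $l\le\omega$, $(d^d)^l$ is identified with $(d^l)^d$ via $\vec\alpha=(\alpha_i)_{i\in d}\mapsto((\alpha_i(j))_{i\in d})_{j\in l}$. A tree $T$ on $d^d$ is a subset of $(d^d)^{<\omega}$ closed under initial segments; its body $[T]$ is the (closed) set of $\vec\alpha\in(d^d)^\omega\cong(d^\omega)^d$ all of whose finite initial segments lie in $T$; $\Gamma([T])$ denotes the subsets of the space $[T]$ belonging to $\Gamma$. For a set $\mathcal X$ and $\mathcal T\subseteq\mathcal X^d$, $G^{\mathcal T}$ is the graph with vertex set $\mathcal T$ and edges $\{\vec x,\vec y\}$ with $\vec x\neq\vec y$ and $x_i=y_i$ for some $i\in d$. $\mathcal T$ is one-sided if any two distinct elements of $\mathcal T$ have at most one coordinate in common; $\mathcal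 T$ is almost acyclic if for every $G^{\mathcal T}$-cycle $(\vec x^n)_{n\le L}$ there are $i\in d$ and $k<m<n<L$ with $x^k_i=x^m_i=x^n_i$. A tree $T$ on $d^d$ has suitable levels if for each $l\in\omega$ the level $T\cap(d^d)^l\subseteq(d^l)^d$ is finite, one-sided and almost acyclic. A Wadge class of Borel sets is a class $\Gamma$ of subsets of 0-dimensional Polish spaces for which there is a Borel $A_0\subseteq\omega^\omega$ such that for every 0-dimensional Polish $X$ and $A\subseteq X$, $A\in\Gamma$ iff $A=f^{-1}(A_0)$ for some continuous $f:X\to\omega^\omega$. $\check\Gamma$ is the class of complements of members of $\Gamma$; $\Gamma$ is self-dual if $\Gamma=\check\Gamma$; $\Delta(\Gamma)=\Gamma\cap\check\Gamma$. $\Gamma$ has the separation property if any two disjoint sets in $\Gamma(\omega^\omega)$ can be separated by a set in $\Delta(\Gamma)(\omega^\omega)$. For a class $\Lambda$ and Polish spaces $(X_i)_{i\in d}$, a Borel $B\subseteq\prod X_i$ is $\mathrm{pot}(\Lambda)$ if there are finer 0-dimensional Polish topologies $\tau_i$ on $X_i$ with $B\in\Lambda(\prod(X_i,\tau_i))$; ''$A$ is separable from $B$ by a $\mathrm{pot}(\Lambda)$ set'' means some $\mathrm{pot}(\Lambda)$ set $P$ satisfies $A\subseteq P$, $P\cap B=\emptyset$; ''$A,B$ are separable by a $\mathrm{pot}(\Lambda)$ set'' means the same. *)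

(* Defs.v *)
From HB Require Import structures.
From Stdlib Require Import Rdefinitions.
From mathcomp Require Import all_boot all_order all_algebra.
From mathcomp Require Import all_classical all_reals all_analysis.
From mathcomp Require Import Rstruct.

Set Implicit Arguments.
Unset Strict Implicit.
Unset Printing Implicit Defensive.

Import Order.TTheory GRing.Theory Num.Theory.

Local Open Scope classical_set_scope.

Inductive cardinal_le_omega := Fin of nat | Omega.

Definition idx (d : cardinal_le_omega) : choiceType :=
  match d with Fin n => 'I_n | Omega => nat end.

Definition two_le (d : cardinal_le_omega) : Prop :=
  match d with Fin n => (2 <= n)%N | Omega => True end.

Section Graphs.
Context {I V : Type} (TT : set (I -> V)).

Definition Gedge (x y : I -> V) : Prop :=
  [/\ TT x, TT y, x <> y & exists i, x i = y i].

(** A cycle [x 0, ..., x L] of the graph is a closed walk, [x L = x 0], of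
    length [L >= 3] whose first [L] vertices are pairwise distinct; the values
    of [x] beyond [L] are irrelevant. *)
Definition Gcycle (L : nat) (x : nat -> I -> V) : Prop :=
  [/\ (3 <= L)%N, x L = x 0%N,
      forall m n, (m < L)%N -> (n < L)%N -> x m = x n -> m = n &
      forall n, (n < L)%N -> Gedge (x n) (x n.+1)].

Definition one_sided : Prop :=
  forall x y, TT x -> TT y -> x <> y ->
  forall i j, x i = y i -> x j = y j -> i = j.

Definition almost_acyclic : Prop :=
  forall L x, Gcycle L x ->
  exists i k m n, [/\ (k < m)%N, (m < n)%N, (n < L)%N,
    x k i = x m i & x m i = x n i].

End Graphs.

Section Trees.
Context {d : cardinal_le_omega}.

Definition is_tree (T : set (seq (idx d -> idx d))) : Prop :=
  forall s t, T (s ++ t) -> T s.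

(** [T `&` (d^d)^l] read in [(d^l)^d]: the [j]-th entry of the sequence is
    [(x i j)_i]. *)
Definition level (T : set (seq (idx d -> idx d))) (l : nat) :
    set (idx d -> ('I_l -> idx d)) :=
  [set x | T [seq (fun i => x i j) | j <- enum 'I_l]].
Arguments level : clear implicits.

Definition suitable_levels (T : set (seq (idx d -> idx d))) : Prop :=
  forall l, [/\ finite_set (level T l), one_sided (level T l) &
                almost_acyclic (level T l)].

End Trees.
Arguments level {d} T l _.

Definition dseq (d : cardinal_le_omega) : topologicalType :=
  prod_topology (fun _ : nat => discrete_topology (idx d)).

Definition dspace (d : cardinal_le_omega) : topologicalType :=
  prod_topology (fun _ : idx d => dseq d).

Definition body (d : cardinal_le_omega) (T : set (seq (idx d -> idx d))) :
    set (dspace d) :=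
  [set alpha | forall l, T (mkseq (fun j i => alpha i j) l)].

Definition baire : topologicalType :=
  prod_topology (fun _ : nat => discrete_topology nat).

Section Polish.
Local Open Scope ring_scope.

Definition is_metric (X : Type) (dist : X -> X -> R) : Prop :=
  [/\ forall x y, 0 <= dist x y,
      forall x y, dist x y = 0 <-> x = y,
      forall x y, dist x y = dist y x &
      forall x y z, dist x z <= dist x y + dist y z].

Definition completely_metrizable (X : topologicalType) : Prop :=
  exists dist : X -> X -> R,
  [/\ is_metric dist,
      forall (x : X) (A : set X), nbhs x A <->
        exists2 e : R, 0 < e & [set y | dist x y < e] `<=` A &
      forall u : nat -> X,
        (forall e : R, 0 < e -> exists N, forall m n,
           (N <= m)%N -> (N <= n)%N -> dist (u m) (u n) < e) ->
        exists x : X, u @ \oo --> x].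

Definition separable_space (X : topologicalType) : Prop :=
  exists2 D : set X, countable D & dense D.

(** The library's [zero_dimensional] (clopen sets separate points) is strictly
    weaker, even for Polish spaces. *)
Definition clopen_basis (X : topologicalType) : Prop :=
  forall (x : X) (U : set X), nbhs x U ->
  exists V : set X, [/\ clopen V, V x & V `<=` U].

Definition zd_polish (X : topologicalType) : Prop :=
  [/\ separable_space X, completely_metrizable X & clopen_basis X].

End Polish.

Definition borel (X : topologicalType) (A : set X) : Prop :=
  <<s [set U : set X | open U] >> A.

(** A class of subsets of zero-dimensional Polish spaces is a [G : pointclass]
    with [zd_polish X] whenever [G X A]; [wadge_class] and [Sigma0_class] impose
    this, so that [class_eq] compares classes exactly. *)
Definition pointclass : Type := forall X : topologicalType, set (set X).

Definition class_eq (G L : pointclass) : Prop :=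
  forall (X : topologicalType) (A : set X), G X A <-> L X A.

Definition dual (G : pointclass) : pointclass := fun X A => G X (~` A).

Definition Delta (G : pointclass) : pointclass :=
  fun X A => G X A /\ dual G A.

Definition self_dual (G : pointclass) : Prop := class_eq G (dual G).

Definition wadge_class (G : pointclass) : Prop :=
  exists A0 : set baire, borel A0 /\
  forall (X : topologicalType) (A : set X),
    G X A <-> zd_polish X /\
              exists f : X -> baire, continuous f /\ A = f @^-1` A0.

Definition separable_by (X : Type) (C : set (set X)) (A B : set X) : Prop :=
  exists P : set X, [/\ C P, A `<=` P & P `&` B = set0].

Definition separation_property (G : pointclass) : Prop :=
  forall A B : set baire, G baire A -> G baire B -> A `&` B = set0 ->
  separable_by (@Delta G baire) A B.

(** The members of [G(C)], for a subspace [C] of [X], as subsets of [X] *)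
Definition class_on (G : pointclass) (X : topologicalType) (C : set X) :
    set (set X) :=
  [set S | S `<=` C /\ G (set_type C) (set_val @^-1` S)].

Definition well_order (W : Type) (lt : W -> W -> Prop) : Prop :=
  [/\ well_founded lt,
      forall u v w, lt u v -> lt v w -> lt u w &
      forall u v, [\/ lt u v, u = v | lt v u]].

(** A point [w] of a countable well-order stands for the ordinal
    [xi = 1 + rank w], so that the least point stands for [1]; all
    [1 <= xi < omega_1] are obtained in this way. *)
Inductive Sigma0 (W : Type) (lt : W -> W -> Prop) (X : topologicalType) :
    W -> set X -> Prop :=
| Sigma0_open w U : (forall v, ~ lt v w) -> open U -> Sigma0 lt w U
| Sigma0_bigcup w (v : nat -> W) (F : nat -> set X) :
    (forall n, lt (v n) w) -> (forall n, Sigma0 lt (v n) (~` F n)) ->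
    Sigma0 lt w (\bigcup_n F n).

Definition Sigma0_class (W : Type) (lt : W -> W -> Prop) (w : W) : pointclass :=
  fun X A => zd_polish X /\ Sigma0 lt w A.

Definition is_Sigma0_class (G : pointclass) : Prop :=
  exists (W : Type) (lt : W -> W -> Prop) (w : W),
  [/\ countable [set: W], well_order lt & class_eq G (Sigma0_class lt w)].

Record topology (X : Type) := Topology {
  topen : set (set X);
  topenT : topen setT;
  topenI : setI_closed topen;
  topen_bigU : forall (I : Type) (f : I -> set X),
    (forall i, topen (f i)) -> topen (\bigcup_i f i) }.

Definition retop (X : choiceType) (t : topology X) : Type := X.

HB.instance Definition _ (X : choiceType) (t : topology X) :=
  Choice.copy (retop t) X.
HB.instance Definition _ (X : choiceType) (t : topology X) :=
  isOpenTopological.Build (retop t)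
    (topenT t) (@topenI _ t) (@topen_bigU _ t).

Definition finer (X : topologicalType) (t : topology X) : Prop :=
  forall U : set X, open U -> topen t U.

Definition pot (I : Type) (X : I -> topologicalType) (L : pointclass) :
    set (set (prod_topology X)) :=
  [set B : set (prod_topology X) | borel B /\
    exists t : forall i, topology (X i),
      (forall i, finer (t i) /\ zd_polish (retop (t i))) /\
      L (prod_topology (fun i => retop (t i)) : topologicalType) B].

(* Main.v *)
(** Every column of a node of the tree at level [l] is either constant, with value
    below [l + 2], or the identity of [d]; the identity is only allowed above one
    prescribed node of level [l], and carries a label. The prescribed nodes are dense
    and realize every label. One identity column joins otherwise disjoint copies of
    the previous level, which makes the levels acyclic. Reading [0] at a constant
    column and [c + 1] at an identity column labelled [c] turns a branch into a play
    of the second player in a Wadge game, [0] being a pass.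

    If [A] and [B] cannot be separated by a continuous preimage of [D], then Borel
    determinacy (by Martin's unraveling) provides a winning strategy [h] of the first
    player in the game where he builds [x], the second player builds [y] with passes,
    and the second player wants [x] in [A] to imply [y] in [D], and [x] in [B] to
    imply [y] not in [D]. The branches whose code is sent by [h] into [A], respectively
    [B], are the sets that are looked for. Indeed, a single coordinate of a branch
    hides, from some level on, where the identity columns are, so every sequence of
    labels is realized by branches with all coordinates generic for given finer Polish
    topologies, and on generic points these topologies agree with the usual one. A
    potential separating set would thus give a continuous map [g] that proposes [y]
    from the code, and a code decoding to its own image by [g], which exists thanks to
    the passes, defeats [h].

    For Sigma^0_xi the two sets are given by the value [0] or [1] of the first label
    (xi = 1), by the parity of the number of labels, required to be finite (xi = 2),
    and by an inseparable pair itself, since the decoding map has a domain of class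
    Pi^0_2 (xi >= 3). *)

Require Import Defs.
From mathcomp Require Import all_boot all_order all_algebra.
From mathcomp Require Import all_classical all_reals all_analysis.
From mathcomp Require Import zify lra Rstruct.

Set Implicit Arguments.
Unset Strict Implicit.
Unset Printing Implicit Defensive.

Import Order.TTheory GRing.Theory Num.Theory.

Local Open Scope classical_set_scope.

(** * Games and strategies *)

(** Constant columns are the neutral material. Such a column writes the same letter in every
    coordinate, so any dense requirement on one coordinate can be met by constants, which commit to
    nothing; and in coordinate [i] the identity writes the letter that the constant [i] also writes.
    Requirements on single coordinates and the sequence of labels are therefore independent. The
    bound on the constants keeps the levels finite for infinite [d], and grows with the level so
    that each letter is eventually available.

    The game compares with one fixed set of which all members of the separating class are preimages.
    For Delta(Sigma^0_xi) with xi at least 2 there is no such set, hence the separate treatment of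
    these classes: a separating set is pulled back along the transversal map itself, and the two
    sets only have to be insensitive to the passes that this map inserts. *)

Record game := Game {
  pos : Type;
  par : pos -> pos;
  len : pos -> nat;
  root : pos;
  len_root : len root = 0;
  len0_root : forall p, len p = 0 -> p = root;
  len_par : forall p, len (par p) = (len p).-1;
  succ_ex : forall p, exists q, par q = p /\ len q = (len p).+1 }.

Section GameBasics.
Context {G : game}.
Implicit Types (p q r : pos G) (x y : nat -> pos G) (s : pos G -> pos G).

Definition succ p q := par q = p /\ len q = (len p).+1.

Definition anc n p := iter (len p - n) (@par G) p.

Definition play x := (forall n, len (x n) = n) /\ forall n, par (x n.+1) = x n.

Definition is_strat s := forall p, succ p (s p).

(** Player I, who moves at positions of even length, is [b = false]. *)
Definition follows (b : bool) s x n0 :=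
  forall n, n0 <= n -> odd n = b -> x n.+1 = s (x n).

Lemma len_iter_par k p : len (iter k (@par G) p) = len p - k.
Proof. by elim: k => [|k IH] /=; rewrite ?subn0 // len_par IH; lia. Qed.

Lemma len_anc n p : n <= len p -> len (anc n p) = n.
Proof. by move=> h; rewrite /anc len_iter_par; lia. Qed.

Lemma anc_id n p : len p <= n -> anc n p = p.
Proof. by rewrite /anc -subn_eq0 => /eqP ->. Qed.

Lemma anc_len p : anc (len p) p = p.
Proof. exact: anc_id. Qed.

Lemma anc_par n p : n < len p -> anc n (par p) = anc n p.
Proof.
move=> h; rewrite /anc len_par -iterSr.
by have -> : ((len p).-1 - n).+1 = len p - n by lia.
Qed.

Lemma anc_succ n p q : succ p q -> n <= len p -> anc n q = anc n p.
Proof. by move=> [<- e] h; rewrite anc_par // e ltnS. Qed.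

Lemma par_anc n p : n < len p -> par (anc n.+1 p) = anc n p.
Proof.
move=> h; rewrite /anc -iterS.
by have -> : (len p - n.+1).+1 = len p - n by lia.
Qed.

Lemma play_anc x m n : play x -> m <= n -> anc m (x n) = x m.
Proof.
move=> [l e]; elim: n => [|n IH].
  by rewrite leqn0 => /eqP ->; rewrite anc_id ?l.
rewrite leq_eqVlt => /orP[/eqP ->|h]; first by rewrite anc_id ?l.
by rewrite -anc_par ?l // e IH.
Qed.

Lemma play_anc_min x m n : play x -> anc m (x n) = x (minn m n).
Proof.
move=> px; case: (leqP m n) => h; first by rewrite play_anc.
by rewrite anc_id // px.1 ltnW.
Qed.

Lemma play_succ x n : play x -> succ (x n) (x n.+1).
Proof. by move=> [l e]; split; rewrite ?e // !l. Qed.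

Lemma strat_ex : exists s, is_strat s.
Proof. by have [s hs] := choice (@succ_ex G); exists s. Qed.

Definition clopenG (X : (nat -> pos G) -> Prop) := forall x, play x ->
  exists n, forall y, play y -> y n = x n -> (X y <-> X x).

End GameBasics.

Definition some_succ (G : game) : pos G -> pos G := projT1 (cid (@strat_ex G)).

Lemma some_succP (G : game) : is_strat (@some_succ G).
Proof. by rewrite /some_succ; case: cid. Qed.

(** Such an index is unique when it exists, so a total function can be chosen; it is arbitrary at
    positions without a suitable ancestor. *)
Lemma firstat_ex (G : game) (P : pos G -> Prop) M : exists first : pos G -> nat,
  forall r k, M <= k <= len r -> P (anc k r) ->
  (forall j, M <= j < k -> ~ P (anc j r)) -> first r = k.
Proof.
suff /choice[first h] : forall r, exists m, forall k, M <= k <= len r ->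
    P (anc k r) -> (forall j, M <= j < k -> ~ P (anc j r)) -> m = k by exists first.
move=> r; case: (pselect (exists k, [/\ M <= k <= len r, P (anc k r) &
    (forall j, M <= j < k -> ~ P (anc j r))])).
  move=> [k [h1 h3 h4]]; exists k => k' h1' h3' h4'.
  by case: (ltngtP k k') => // h; [case: (h4' k) | case: (h4 k')] => //; lia.
by move=> h; exists 0 => k h1 h3 h4; case: h; exists k.
Qed.

Definition firstat (G : game) P M : pos G -> nat := projT1 (cid (firstat_ex P M)).

Lemma firstat_play (G : game) (P : pos G -> Prop) M x m n : play x ->
  M <= m <= n -> P (x m) -> (forall k, M <= k < m -> ~ P (x k)) ->
  firstat P M (x n) = m.
Proof.
move=> px /andP[Mm mn] Pm nP; rewrite /firstat; case: cid => f /=; apply.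
- by rewrite px.1 Mm.
- by rewrite play_anc.
by move=> j /andP[h1 h2]; rewrite play_anc //; [apply: nP; rewrite h1|lia].
Qed.

(** A quasi-strategy of player [b], given as a set of positions without a prescribed root. *)
Definition arena (G : game) b (A : pos G -> Prop) :=
  (forall r q, A r -> odd (len r) = ~~ b -> succ r q -> A q) /\
  (forall r, A r -> odd (len r) = b -> exists q, succ r q /\ A q).

Definition stays (G : game) b (A : pos G -> Prop) s :=
  forall r, A r -> odd (len r) = b -> A (s r).

Section Win.
Context {G : game} (b : bool) (A S : pos G -> Prop) (arA : arena b A).
Implicit Types (p q r : pos G) (x y : nat -> pos G) (s : pos G -> pos G).

Definition Win p := exists s, [/\ is_strat s, stays b A s &
  forall x, play x -> x (len p) = p -> follows b s x (len p) ->
  exists n, len p <= n /\ S (x n)].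

Lemma arena_strat : exists s, is_strat s /\ stays b A s.
Proof.
suff /choice[s hs] : forall r, exists q,
    succ r q /\ (A r -> odd (len r) = b -> A q).
  by exists s; split=> [r|r]; case: (hs r).
move=> r; case: (pselect (A r /\ odd (len r) = b)) => [[Ar e]|h].
  by have [q [h1 h2]] := arA.2 _ Ar e; exists q.
by have [q h1] := succ_ex r; exists q; split => // Ar e; case: h.
Qed.

Lemma Win_target p : S p -> Win p.
Proof.
move=> Sp; have [s [h1 h2]] := arena_strat.
by exists s; split=> // x _ e _; exists (len p); rewrite e.
Qed.

Lemma Win_move p q : odd (len p) = b -> succ p q -> A q -> Win q -> Win p.
Proof.
move=> ep pq Aq [s [hs st hw]].
pose s2 r := if pselect (r = p) then q else s r.
exists s2; split.
- by move=> r; rewrite /s2; case: pselect => //= ->.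
- by move=> r Ar e; rewrite /s2; case: pselect => //= _; apply: st.
move=> x px xp fx; case: pq => qp lq.
have xq : x (len q) = q.
  by rewrite lq fx // xp /s2; case: pselect.
have [n [h Sn]] : exists n, len q <= n /\ S (x n).
  apply: hw => // n hn e; rewrite fx //; last by lia.
  rewrite /s2; case: pselect => //= exp.
  by move: (px.1 n); rewrite exp; lia.
by exists n; split=> //; lia.
Qed.

Lemma Win_opp p : odd (len p) = ~~ b -> (forall q, succ p q -> Win q) -> Win p.
Proof.
move=> ep hq.
have [s0 [hs0 st0]] := arena_strat.
have /choice[f hf] : forall q, exists s, [/\ is_strat s, stays b A s &
    succ p q -> forall x, play x -> x (len q) = q -> follows b s x (len q) ->
      exists n, len q <= n /\ S (x n)].
  move=> q; case: (pselect (succ p q)) => [/hq[s [h1 h2 h3]]|h].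
    by exists s.
  by exists s0.
pose s r := f (anc (len p).+1 r) r.
exists s; split.
- by move=> r; rewrite /s; case: (hf (anc (len p).+1 r)).
- by move=> r Ar e; rewrite /s; case: (hf (anc (len p).+1 r)) => _ h _; apply: h.
move=> x px xp fx.
have pq : succ p (x (len p).+1) by rewrite -{1}xp; exact: play_succ.
have [_ _ h] := hf (x (len p).+1).
have [n [hn Sn]] : exists n, len (x (len p).+1) <= n /\ S (x n).
  apply: h => //; first by rewrite px.1.
  rewrite px.1 => n hn e; rewrite fx ?(ltnW hn) // /s.
  by rewrite play_anc.
by rewrite px.1 in hn; exists n; split=> //; apply: ltnW.
Qed.

(** A winning strategy depends on the position where [Win] is entered. That position is recovered
    from any later one as its first ancestor in [Win] of length at least [M], so a single strategy
    serves all entries. *)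
Lemma pursuit_ex M : exists s, [/\ is_strat s, stays b A s &
  forall x m, play x -> M <= m -> Win (x m) ->
  (forall k, M <= k < m -> ~ Win (x k)) -> follows b s x m ->
  exists n, m <= n /\ S (x n)].
Proof.
have [s0 [hs0 st0]] := arena_strat.
have /choice[f hf] : forall p, exists s, [/\ is_strat s, stays b A s &
    Win p -> forall x, play x -> x (len p) = p -> follows b s x (len p) ->
      exists n, len p <= n /\ S (x n)].
  move=> q; case: (pselect (Win q)) => [[s [h1 h2 h3]]|h].
    by exists s.
  by exists s0.
pose s r := f (anc (firstat Win M r) r) r.
exists s; split.
- by move=> r; rewrite /s; case: (hf (anc (firstat Win M r) r)).
- by move=> r Ar e; rewrite /s; case: (hf (anc (firstat Win M r) r)) => _ h _; apply: h.
move=> x m px Mm Wm nW fx.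
have [_ _ h] := hf (x m); rewrite px.1 in h.
apply: h => // n mn e; rewrite fx // /s.
by rewrite (firstat_play px _ Wm nW) ?Mm // play_anc.
Qed.

End Win.

(** When [A] is not an arena, [pursuit] is an arbitrary strategy. *)
Definition pursuit (G : game) b (A S : pos G -> Prop) M : pos G -> pos G :=
  if pselect (arena b A) is left h then projT1 (cid (pursuit_ex S h M))
  else @some_succ G.

Lemma pursuit_strat (G : game) b (A S : pos G -> Prop) M : is_strat (pursuit b A S M).
Proof.
rewrite /pursuit; case: pselect => h; last exact: some_succP.
by case: cid => s [].
Qed.

Lemma pursuit_stays (G : game) b (A S : pos G -> Prop) M :
  arena b A -> stays b A (pursuit b A S M).
Proof. by move=> h; rewrite /pursuit; case: pselect => // h'; case: cid => s []. Qed.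

Lemma pursuitP (G : game) b (A S : pos G -> Prop) M x m : arena b A ->
  play x -> M <= m -> Win b A S (x m) ->
  (forall k, M <= k < m -> ~ Win b A S (x k)) -> follows b (pursuit b A S M) x m ->
  exists n, m <= n /\ S (x n).
Proof.
move=> h; rewrite /pursuit; case: pselect => // h'; case: cid => s [? ? hs].
exact: hs.
Qed.

Lemma arenaT (G : game) b : arena b (fun _ : pos G => True).
Proof. by split=> // r _ _; have [q hq] := succ_ex r; exists q. Qed.

Definition determined (G : game) (X : (nat -> pos G) -> Prop) :=
  (exists s, is_strat s /\ forall x, play x -> follows false s x 0 -> X x) \/
  (exists s, is_strat s /\ forall x, play x -> follows true s x 0 -> ~ X x).

Lemma clopen_determined (G : game) (X : (nat -> pos G) -> Prop) :
  clopenG X -> determined X.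
Proof.
move=> cX.
pose S (p : pos G) := forall x, play x -> x (len p) = p -> X x.
pose W := Win false (fun _ => True) S.
case: (pselect (W (root G))) => [[s [hs _ hw]]|nW].
  left; exists s; split=> // x px fx.
  have x0 : x 0 = root G by apply: len0_root; rewrite px.1.
  have [||n [_ Sn]] := hw x px; rewrite ?len_root //.
  by apply: (Sn x px); rewrite px.1.
right.
have /choice[s hs] : forall p : pos G, exists q, succ p q /\
    (~ W p -> odd (len p) -> ~ W q).
  move=> p; case: (pselect (exists q, succ p q /\ ~ W q)) => [[q [h1 h2]]|h].
    by exists q.
  have [q hq] := succ_ex p; exists q; split => // nWp e; exfalso; apply: nWp.
  apply: Win_opp; [exact: arenaT|by rewrite e|].
  by move=> r pr; apply: contrapT => nr; apply: h; exists r.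
exists s; split=> [p|x px fx Xx]; first by case: (hs p).
have nWx n : ~ W (x n).
  elim: n => [|n IH].
    by rewrite (_ : x 0 = root G) //; apply: len0_root; rewrite px.1.
  case: (boolP (odd n)) => e.
    rewrite fx //; case: (hs (x n)) => _; apply => //; by rewrite px.1.
  move=> W1; apply: IH; apply: (Win_move (arenaT _ _) (q := x n.+1)) => //.
    by rewrite px.1; apply: negbTE.
  exact: play_succ.
have [n hn] := cX x px.
apply: (nWx n); apply: Win_target; first exact: arenaT.
by move=> y py; rewrite px.1 => /(hn _ py) ->.
Qed.

(** * Coverings and unraveling *)

Definition morph (G' G : game) (f : pos G' -> pos G) :=
  (forall p, len (f p) = len p) /\ forall p, par (f p) = f (par p).

Lemma morph_play (G' G : game) (f : pos G' -> pos G) x :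
  morph f -> play x -> play (f \o x).
Proof. by move=> [h1 h2] [l e]; split=> n /=; rewrite ?h1 ?h2 ?e. Qed.

Lemma morph_succ (G' G : game) (f : pos G' -> pos G) p q :
  morph f -> succ p q -> succ (f p) (f q).
Proof. by move=> [h1 h2] [e l]; split; rewrite ?h2 ?e // !h1. Qed.

Lemma morph_comp (G1 G2 G3 : game) (f : pos G1 -> pos G2) (g : pos G2 -> pos G3) :
  morph f -> morph g -> morph (g \o f).
Proof. by move=> [h1 h2] [h3 h4]; split=> p /=; rewrite ?h3 ?h1 ?h4 ?h2. Qed.

Lemma clopenG_morph (G' G : game) (f : pos G' -> pos G) X :
  morph f -> clopenG X -> clopenG (fun x => X (f \o x)).
Proof.
move=> mf cX x px; have [n hn] := cX _ (morph_play mf px).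
exists n => y py e; apply: hn; first exact: morph_play.
by rewrite /= e.
Qed.

(** A covering pulls plays of [G] that follow a transferred strategy back to
    [G']; locality of the transfer is what survives inverse limits. *)
Record is_cover N (G' G : game) (f : pos G' -> pos G)
    (phi : bool -> (pos G' -> pos G') -> pos G -> pos G) : Prop := IsCover {
  cov_morph : morph f;
  cov_inj : forall p q, len p <= N -> f p = f q -> p = q;
  cov_surj : forall p, len p <= N -> exists q, f q = p;
  cov_strat : forall b s, is_strat s -> is_strat (phi b s);
  cov_loc : forall b s s' n, is_strat s -> is_strat s' ->
    (forall p, len p <= n -> s p = s' p) ->
    forall p, len p <= n -> phi b s p = phi b s' p;
  cov_low : forall b s p, is_strat s -> len p < N -> phi b s (f p) = f (s p);
  cov_lift : forall b s x, is_strat s -> play x -> follows b (phi b s) x 0 ->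
    exists y, [/\ play y, follows b s y 0 & forall n, f (y n) = x n] }.

Definition unravels N (G : game) (X : (nat -> pos G) -> Prop) :=
  exists (G' : game) (f : pos G' -> pos G) phi,
  @is_cover N G' G f phi /\ clopenG (fun x => X (f \o x)).

(** In a countable union each set has to be unraveled on top of the coverings built for the previous
    ones; the quantifier over morphisms provides this. *)
Definition hunravels (G : game) (X : (nat -> pos G) -> Prop) :=
  forall (G' : game) (f : pos G' -> pos G), morph f ->
  forall N, unravels N (fun x => X (f \o x)).

Lemma cover_le M N (G' G : game) (f : pos G' -> pos G) phi :
  M <= N -> is_cover N f phi -> is_cover M f phi.
Proof.
move=> h [h1 h2 h3 h4 h5 h6 h7]; split=> //.
- by move=> p q l; apply: h2; lia.
- by move=> p l; apply: h3; lia.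
- by move=> b s p hs l; apply: h6 => //; lia.
Qed.

Lemma cover_id N (G : game) : @is_cover N G G id (fun _ s => s).
Proof. by split=> //; [move=> p _; exists p | move=> b s x _ px fx; exists x]. Qed.

Lemma cover_comp N (G1 G2 G3 : game) (f : pos G1 -> pos G2) (g : pos G2 -> pos G3)
    phi psi : is_cover N f phi -> is_cover N g psi ->
  is_cover N (g \o f) (fun b s => psi b (phi b s)).
Proof.
move=> [a1 a2 a3 a4 a5 a6 a7] [b1 b2 b3 b4 b5 b6 b7]; split.
- exact: morph_comp.
- by move=> p q l e; apply: a2 => //; apply: b2 e; rewrite a1.1.
- move=> p l; have [q e] := b3 _ l; have [|r e'] := a3 q.
    by rewrite -b1.1 e.
  by exists r; rewrite /= e'.
- by move=> b s hs; apply: b4; apply: a4.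
- move=> b s s' n hs hs' e p l; apply: (b5 b _ _ n (a4 b _ hs) (a4 b _ hs')) => //.
  by move=> q lq; apply: (a5 b _ _ n hs hs').
- move=> b s p hs l /=; rewrite b6 ?a6 ?a1.1 //; exact: a4.
- move=> b s x hs px fx; have [y [py fy ey]] := b7 b _ _ (a4 b _ hs) px fx.
  have [z [pz fz ez]] := a7 b _ _ hs py fy.
  by exists z; split=> // n /=; rewrite ez ey.
Qed.

Lemma determined_hunravels (G : game) (X : (nat -> pos G) -> Prop) :
  hunravels X -> determined X.
Proof.
move=> hX; have mid : morph (@id (pos G)) by [].
have [G' [f [phi [cf cX]]]] := hX G id mid 0.
case: (clopen_determined cX) => -[s [hs hw]]; [left|right].
  exists (phi false s); split; first exact: (cov_strat cf).
  move=> x px fx; have [y [py fy ey]] := cov_lift cf hs px fx.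
  by rewrite (_ : x = f \o y); [exact: hw|apply/funext => n /=; rewrite ey].
exists (phi true s); split; first exact: (cov_strat cf).
move=> x px fx; have [y [py fy ey]] := cov_lift cf hs px fx.
by rewrite (_ : x = f \o y); [exact: hw|apply/funext => n /=; rewrite ey].
Qed.

(** * Inverse limits of coverings *)

(** The projections force the components below [i], dependent choice supplies those above. The
    stages are arbitrary types because the lemma serves for threads of positions and for threads of
    whole plays. *)
Lemma thread_ex (Q : nat -> Type) (q : forall i, Q i.+1 -> Q i)
    (L : forall i, Q i -> Prop) i (p : Q i) : L i p ->
  (forall j (a : Q j), i <= j -> L j a -> exists a', q j a' = a /\ L j.+1 a') ->
  exists t : forall j, Q j, [/\ forall j, q j (t j.+1) = t j,
    t i = p & forall j, i <= j -> L j (t j)].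
Proof.
elim: i Q q L p => [|i IH] Q q L p Lp hL.
  pose F := nat_rect (fun j => {a : Q j | L j a}) (exist _ p Lp)
    (fun j a => let h := cid (hL j (sval a) (leq0n j) (svalP a)) in
       exist _ (projT1 h) (projT2 h).2).
  exists (fun j => sval (F j)); split=> // j; last by move=> _; exact: svalP.
  by rewrite /=; case: cid => a' [].
have [j a ij La|t [ht ti Lt]] := IH (Q \o S) (fun j => q j.+1) (fun j => L j.+1) p Lp.
  exact: hL.
exists (fun j => if j is j'.+1 return Q j then t j' else q 0 (t 0)).
split=> [[|j]||[|j]] //=; first exact: (ht j).
exact: (Lt j).
Qed.

Section InverseLimit.
Variables (T : nat -> game) (f : forall i, pos (T i.+1) -> pos (T i)).
Variable phi : forall i, bool -> (pos (T i.+1) -> pos (T i.+1)) -> pos (T i) -> pos (T i).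
Variables (N : nat) (cov : forall i, is_cover (N + i) (@f i) (@phi i)).

Definition thread := {t : forall i, pos (T i) | forall i, f (t i.+1) = t i}.

Lemma thread_len (t : thread) i : len (sval t i) = len (sval t 0).
Proof.
elim: i => // i <-; rewrite -(svalP t i).
by rewrite (cov_morph (cov i)).1.
Qed.

Lemma thread_eq (t t' : thread) i : len (sval t 0) <= N + i ->
  sval t i = sval t' i -> t = t'.
Proof.
move=> l e; suff h : sval t = sval t' by case: t t' h {l e} => t ht [t' ht'] /= h;
  apply: eq_exist.
have down j : j <= i -> sval t j = sval t' j.
  elim: i e {l} => [|i IH] e; first by case: j.
  rewrite leq_eqVlt => /orP[/eqP ->//|h]; apply: IH => //.
  by rewrite -(svalP t i) -(svalP t' i) e.
apply: functional_extensionality_dep => j; case: (leqP j i) => h; first exact: down.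
elim: j h => // j IH h; apply: (cov_inj (cov j)).
  by rewrite thread_len; lia.
rewrite (svalP t j) (svalP t' j); case: (leqP j i) => h2; last exact: IH.
exact: down.
Qed.

Lemma thread_through i (p : pos (T i)) : len p <= N + i ->
  exists t : thread, sval t i = p.
Proof.
move=> l; have [||t [ht e Lt]] := thread_ex (q := f) (L := fun j a => len a = len p) (p := p).
- by [].
- move=> j a ij e; have [|a' e'] := cov_surj (cov j) (p := a); first by lia.
  by exists a'; rewrite e' -e -e' (cov_morph (cov j)).1.
by exists (exist _ t ht).
Qed.

Definition thread_root : thread.
Proof.
exists (fun i => root (T i)) => i; apply: len0_root.
by rewrite (cov_morph (cov i)).1 len_root.
Defined.

Definition thread_par (t : thread) : thread.
Proof.
exists (fun i => par (sval t i)) => i.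
by rewrite -(cov_morph (cov i)).2 (svalP t i).
Defined.

Lemma thread_succ (t : thread) : exists t', thread_par t' = t /\
  len (sval t' 0) = (len (sval t 0)).+1.
Proof.
set n := len (sval t 0).
have [q [e l]] := succ_ex (sval t n.+1).
rewrite thread_len -/n in l.
have [|t' e'] := thread_through (p := q); first by rewrite l; lia.
have lt' : len (sval t' 0) = n.+1 by rewrite -(thread_len _ n.+1) e'.
exists t'; split=> //; apply: (@thread_eq _ _ n.+1) => /=.
  by rewrite len_par lt'; lia.
by rewrite e' e.
Qed.

Definition limit_game : game.
Proof.
refine (@Game thread thread_par (fun t => len (sval t 0)) thread_root _ _ _ thread_succ).
- exact: len_root.
- move=> p l; apply: (@thread_eq _ _ 0); first by rewrite l.
  exact: len0_root.
- by move=> p; rewrite /= len_par.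
Defined.

Lemma limit_morph i : morph (fun t : pos limit_game => sval t i : pos (T i)).
Proof. by split=> // t; rewrite thread_len. Qed.

Definition thread_of i (p : pos (T i)) : thread :=
  if pselect (exists t : thread, sval t i = p) is left h then projT1 (cid h)
  else thread_root.

Lemma thread_ofK i (p : pos (T i)) : len p <= N + i -> sval (thread_of p) i = p.
Proof.
move=> /thread_through h; rewrite /thread_of; case: pselect => // h'.
by case: cid.
Qed.

Lemma thread_of_sval i (t : thread) : len (sval t 0) <= N + i ->
  thread_of (sval t i) = t.
Proof.
move=> h; apply: (@thread_eq _ _ i); last by rewrite thread_ofK // thread_len.
by rewrite -(thread_len _ i) thread_ofK // thread_len.
Qed.

(** Stage [i] represents the limit faithfully only up to length [N + i]. Beyond, the value is a
    placeholder, overwritten by what is pushed down from later stages. *)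
Definition level_strats (s : thread -> thread) i (p : pos (T i)) : pos (T i) :=
  if len p < N + i then sval (s (thread_of p)) i else some_succ p.

Arguments level_strats : clear implicits.

Definition push b (s : forall i, pos (T i) -> pos (T i)) i := phi b (s i.+1).
Arguments push : clear implicits.

Section Strategy.
Variables (b : bool).

Lemma level_strats_strat (s : pos limit_game -> pos limit_game) i :
  is_strat s -> is_strat (level_strats s i).
Proof.
move=> hs p; rewrite /level_strats; case: ifP => l; last exact: some_succP.
have := morph_succ (limit_morph i) (hs (thread_of p)).
by rewrite thread_ofK // ltnW.
Qed.

Lemma push_strat m s : (forall i, is_strat (s i)) -> forall i, is_strat (iter m (push b) s i).
Proof. by move=> hs; elim: m => //= m IH i; apply: (cov_strat (cov i)). Qed.

Lemma push_loc m s s' n : (forall i, is_strat (s i)) -> (forall i, is_strat (s' i)) ->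
  forall i, (forall p, len p <= n -> s (i + m) p = s' (i + m) p) ->
  forall p, len p <= n -> iter m (push b) s i p = iter m (push b) s' i p.
Proof.
move=> hs hs'; elim: m => [|m IH] i e p l /=; first by rewrite addn0 in e; exact: e.
apply: (cov_loc (cov i) _ _ _ _ l); try exact: push_strat.
by move=> q lq; apply: IH => //; rewrite addSnnS; exact: e.
Qed.

Lemma push_level_strats (s : pos limit_game -> pos limit_game) i p :
  is_strat s -> len p < N + i ->
  push b (level_strats s) i p = level_strats s i p.
Proof.
move=> hs l; rewrite /push.
have [q e] : exists q, f q = p by apply: (cov_surj (cov i)); exact: ltnW.
have lq : len q = len p by rewrite -e (cov_morph (cov i)).1.
rewrite -e (cov_low (cov i)) ?lq //; last exact: level_strats_strat.
rewrite e /level_strats l lq ifT; last by lia.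
rewrite (svalP (s _) i); congr (sval (s _) i).
have lt : len (sval (thread_of q) 0) = len p.
  by rewrite -(thread_len _ i.+1) thread_ofK; lia.
apply: (@thread_eq _ _ i); first by rewrite lt; lia.
by rewrite -(svalP (thread_of q) i) !thread_ofK //; lia.
Qed.

Lemma iter_push_level_strats (s : pos limit_game -> pos limit_game) m i p :
  is_strat s -> len p < N + i ->
  iter m (push b) (level_strats s) i p = level_strats s i p.
Proof.
move=> hs; elim: m i p => // m IH i p l.
rewrite iterS -[RHS](push_level_strats hs l).
apply: (@cov_loc _ _ _ _ _ (cov i) b _ _ (len p)) => //.
- by apply: push_strat => j; exact: level_strats_strat.
- exact: level_strats_strat.
by move=> q lq; apply: IH; lia.
Qed.

(** Coverings do not alter the low levels, so the iterates of [push] stabilize. *)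
Lemma iter_push_stable (s : pos limit_game -> pos limit_game) k m i p :
  is_strat s -> len p < m -> m <= k ->
  iter k (push b) (level_strats s) i p = iter m (push b) (level_strats s) i p.
Proof.
move=> hs l mk; rewrite -(subnKC mk) iterD.
apply: (push_loc (n := len p)) => //.
- by move=> j; apply: push_strat => j'; exact: level_strats_strat.
- by move=> j; exact: level_strats_strat.
by move=> q lq; apply: iter_push_level_strats => //; lia.
Qed.

(** After [(len p).+1] pushes the strategies come from a stage at which positions as short as [p]
    are no longer placeholders. The resulting family is a fixed point of [push], which is what lets
    a play be lifted from stage to stage. *)
Definition limit_strats (s : thread -> thread) i (p : pos (T i)) : pos (T i) :=
  iter (len p).+1 (push b) (level_strats s) i p.

Arguments limit_strats : clear implicits.

Lemma limit_strats_strat (s : pos limit_game -> pos limit_game) i :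
  is_strat s -> is_strat (limit_strats s i).
Proof.
move=> hs p; by apply: push_strat => j; exact: level_strats_strat.
Qed.

Lemma push_limit_strats (s : pos limit_game -> pos limit_game) i p :
  is_strat s -> push b (limit_strats s) i p = limit_strats s i p.
Proof.
move=> hs; rewrite /limit_strats -(@iter_push_stable s (len p).+2) //.
rewrite iterS; apply: (@cov_loc _ _ _ _ _ (cov i) b _ _ (len p)) => //.
- exact: limit_strats_strat.
- by apply: push_strat => j; exact: level_strats_strat.
by move=> q lq; apply/esym/iter_push_stable.
Qed.

Lemma limit_strats_low (s : pos limit_game -> pos limit_game) i p :
  is_strat s -> len p < N + i -> limit_strats s i p = sval (s (thread_of p)) i.
Proof.
by move=> hs l; rewrite /limit_strats iter_push_level_strats // /level_strats l.
Qed.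

End Strategy.
Arguments limit_strats : clear implicits.


Lemma limit_cover :
  @is_cover N limit_game (T 0) (fun t => sval t 0) (fun b s => limit_strats b s 0).
Proof.
split.
- exact: (limit_morph 0).
- by move=> p q l; apply: thread_eq; rewrite addn0.
- by move=> p l; apply: thread_through; rewrite addn0.
- by move=> b s hs; apply: limit_strats_strat.
- move=> b s s' n hs hs' e p l; rewrite /limit_strats.
  apply: (@push_loc b _ _ _ n) => //; [by move=> j; exact: level_strats_strat..|].
  move=> q lq; rewrite /level_strats; case: ifP => // lq'; rewrite e //=.
  by rewrite -(thread_len _ (0 + (len p).+1)) thread_ofK // ltnW.
- move=> b s p hs l; rewrite limit_strats_low ?addn0 //.
    by rewrite thread_of_sval // addn0 ltnW.
- move=> b s x hs px fx.
  pose P i (x : nat -> pos (T i)) := play x /\ follows b (limit_strats b s i) x 0.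
  have [||t [ht e Lt]] := thread_ex (Q := fun i => nat -> pos (T i))
     (q := fun i x n => f (x n)) (L := P) (i := 0) (p := x).
  + by [].
  + move=> j a _ [pa fa].
    have [n _ o|y [py fy ey]] := cov_lift (cov j) (b := b)
       (s := limit_strats b s j.+1) (limit_strats_strat b hs) pa.
      by rewrite fa // -push_limit_strats.
    by exists y; split=> //; apply/funext.
  pose y n : thread := exist (fun t : forall i, pos (T i) => forall i, f (t i.+1) = t i)
    (fun i => t i n) (fun i => congr1 (fun g => g n) (ht i)).
  have yl n : len (sval (y n) 0) = n by rewrite /= (Lt 0 _).1.1.
  exists y; split=> [|n _ o|n]; last by rewrite /= e.
    split=> // n; apply: (@thread_eq _ _ n.+1) => [|/=].
      by rewrite /= len_par (Lt 0 _).1.1 //; lia.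
    by rewrite (Lt n.+1 _).1.2.
  (* Move [n] is examined at stage [n.+1], where positions of length [n] are low enough for
     [limit_strats] to coincide with [s]. *)
  apply: (@thread_eq _ _ n.+1); first by rewrite yl; lia.
  rewrite /= (Lt n.+1 _).2 // limit_strats_low ?(Lt n.+1 _).1.1 //; last by lia.
  suff -> : thread_of (t n.+1 n) = y n by [].
  by apply: (@thread_of_sval n.+1 (y n)); rewrite yl; lia.
Qed.

End InverseLimit.

(** * Unraveling closed sets *)

Section ClosedSet.
Variables (G : game) (N : nat) (evN : odd N = false) (C : pos G -> Prop).
Hypothesis Cpar : forall r, C r -> C (par r).
Implicit Types (r q u : pos G) (A B : pos G -> Prop) (x : nat -> pos G).

(** In the auxiliary game player I also commits, with move [N], to an arena
    [A], and player II, with move [N.+1], either to a subarena [inl B] of [A]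
    inside [C], or to a position [inr u] of [A] outside [C] to be reached. *)
Notation c1 := (option (pos G -> Prop)).
Notation c2 := (option ((pos G -> Prop) + pos G)).

Definition validA a A := A a /\ arena false A.

Definition validB q A B := [/\ B q, forall r, B r -> A r /\ C r,
  forall r r', B r -> odd (len r) = false -> succ r r' -> A r' -> B r' &
  forall r, B r -> odd (len r) = true -> exists r', succ r r' /\ B r'].

Definition validU q A u := [/\ N.+2 <= len u, anc N.+2 u = q, ~ C u & A u].

(** Comparability: one of the two positions extends the other. *)
Definition cmp r u := anc (len r) u = anc (len u) r.

Inductive legal r : c1 -> c2 -> Prop :=
| legal0 : len r <= N -> legal r None None
| legal1 A : len r = N.+1 -> validA r A -> legal r (Some A) None
| legalB A B : N.+2 <= len r -> validA (anc N.+1 r) A ->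
    validB (anc N.+2 r) A B -> (forall m, N.+2 <= m <= len r -> B (anc m r)) ->
    legal r (Some A) (Some (inl B))
| legalU A u : N.+2 <= len r -> validA (anc N.+1 r) A ->
    validU (anc N.+2 r) A u -> cmp r u -> legal r (Some A) (Some (inr u)).

Lemma legal_inv r a b : legal r a b ->
  match a, b with
  | None, None => len r <= N
  | Some A, None => len r = N.+1 /\ validA r A
  | Some A, Some (inl B) => [/\ N.+2 <= len r, validA (anc N.+1 r) A,
      validB (anc N.+2 r) A B & forall m, N.+2 <= m <= len r -> B (anc m r)]
  | Some A, Some (inr u) => [/\ N.+2 <= len r, validA (anc N.+1 r) A,
      validU (anc N.+2 r) A u & cmp r u]
  | None, Some _ => False
  end.
Proof. by case. Qed.

Record cpos := CPos { cp : pos G; ca : c1; cb : c2; clegal : legal cp ca cb }.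

Lemma cpos_eq (t t' : cpos) : cp t = cp t' -> ca t = ca t' -> cb t = cb t' -> t = t'.
Proof.
case: t t' => r a b h [r' a' b' h'] /= e1 e2 e3; move: h h'.
by rewrite e1 e2 e3 => h h'; congr CPos; exact: Prop_irrelevance.
Qed.

(** Here [n] is the length of the position whose parent is taken. The commitment made by move [N] is
    carried from length [N.+1] on, so it is lost exactly when [n] is at most [N.+1]; likewise for
    [parB], one move later. *)
Definition parA n (a : c1) : c1 := if n <= N.+1 then None else a.
Definition parB n (b : c2) : c2 := if n <= N.+2 then None else b.

Lemma cmp_par r u : cmp r u -> cmp (par r) u.
Proof.
rewrite /cmp len_par => e; case: (leqP (len r) (len u)) => h.
  rewrite (@anc_id _ (len u) r) // in e.
  rewrite (@anc_id _ (len u) (par r)) ?len_par; last by lia.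
  case: (posnP (len r)) => h0; last by rewrite -par_anc ?prednK ?e //; lia.
  have e0 : par r = r by rewrite (len0_root h0); apply: len0_root; rewrite len_par len_root.
  by rewrite e0 -[RHS]e h0.
rewrite anc_par // -e !anc_id //; lia.
Qed.

Lemma legal_par r a b : legal r a b -> legal (par r) (parA (len r) a) (parB (len r) b).
Proof.
case.
- move=> l; rewrite /parA /parB !ifT; [apply: legal0; rewrite len_par|..]; lia.
- move=> A l vA; rewrite /parA /parB l leqnn leqnSn; apply: legal0.
  by rewrite len_par l.
- move=> A B l vA vB hB; rewrite /parA (leqNgt (len r)) l /parB /=.
  case: leqP => h.
    have e : len r = N.+2 by lia.
    by apply: legal1; rewrite ?len_par ?e // -par_anc ?anc_id in vA *; rewrite ?e.
  apply: legalB; rewrite ?len_par ?anc_par //; try lia.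
  by move=> m hm; rewrite anc_par; [apply: hB|]; lia.
- move=> A u l vA vU hu; rewrite /parA (leqNgt (len r)) l /parB /=.
  case: leqP => h.
    have e : len r = N.+2 by lia.
    by apply: legal1; rewrite ?len_par ?e // -par_anc ?anc_id in vA *; rewrite ?e.
  apply: legalU; rewrite ?len_par ?anc_par //; try lia.
  exact: cmp_par.
Qed.

Definition cpar (t : cpos) : cpos := CPos (legal_par (clegal t)).

Lemma legal_root : legal (root G) None None.
Proof. by apply: legal0; rewrite len_root. Qed.

Definition croot := CPos legal_root.

Lemma legal_succ r a b : legal r a b -> exists q a' b',
  [/\ succ r q, legal q a' b', parA (len q) a' = a & parB (len q) b' = b].
Proof.
case.
- move=> l; have [q [e lq]] := succ_ex r.
  case: (ltnP (len r) N) => h.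
    exists q, None, None; split=> //; first by apply: legal0; lia.
      by rewrite /parA if_same.
    by rewrite /parB if_same.
  exists q, (Some (fun=> True)), None; split=> //.
  - apply: legal1; first by lia.
    by split=> //; exact: arenaT.
  - by rewrite /parA ifT //; lia.
  - by rewrite /parB if_same.
- move=> A l vA; have [q rq] := succ_ex r; have lq : len q = N.+2 by case: rq; lia.
  have ar : anc N.+1 q = r by rewrite -l (anc_succ rq) ?anc_len.
  have aq : anc N.+2 q = q by rewrite -lq anc_len.
  have Aq : A q by apply: (vA.2.1 r) => //; [exact: vA.1 | rewrite l /= evN].
  (* Player II can always commit: if no position of [A] above [q] lies outside [C], all positions of
     [A] above [q] together form a legitimate [B]. *)
  case: (pselect (exists u, validU q A u)) => [[u vu]|nu].
    exists q, (Some A), (Some (inr u)); split=> //.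
    - apply: legalU; rewrite ?lq ?ar ?aq //; case: vu => h1 h2 _ _.
      by rewrite /cmp lq h2 anc_id // lq.
    - by rewrite /parA lq ltnn.
    - by rewrite /parB lq leqnn.
  pose B r' := [/\ A r', N.+2 <= len r' & anc N.+2 r' = q].
  exists q, (Some A), (Some (inl B)); split=> //.
  - apply: legalB; rewrite ?lq ?ar ?aq //.
    + split.
      * by split; rewrite ?lq.
      * move=> r' [h1 h2 h3]; split=> //; apply: contrapT => nC.
        by apply: nu; exists r'.
      * move=> r1 r2 [h1 h2 h3] _ r12 Ar2; split=> //; first by case: r12; lia.
        by rewrite (anc_succ r12).
      * move=> r1 [h1 h2 h3] o; have [r2 r12] := succ_ex r1.
        exists r2; split=> //; split; first by apply: (vA.2.1 r1).
          by case: r12; lia.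
        by rewrite (anc_succ r12).
    + move=> m hm; have -> : m = N.+2 by lia.
      by rewrite aq; split; rewrite ?lq.
  - by rewrite /parA lq ltnn.
  - by rewrite /parB lq leqnn.
- move=> A B l vA vB hB.
  have Br : B r by rewrite -(anc_len r); apply: hB; rewrite l leqnn.
  have [q [rq Bq]] : exists q, succ r q /\ B q.
    case: vB => h1 h2 h3 h4; case e: (odd (len r)); first exact: h4.
    have [q [rq Aq]] := vA.2.2 r (h2 _ Br).1 e.
    by exists q; split=> //; apply: (h3 r).
  have lq : len q = (len r).+1 by case: rq.
  exists q, (Some A), (Some (inl B)); split=> //.
  - apply: legalB; rewrite ?(anc_succ rq) //; try lia.
    move=> m hm; case: (leqP m (len r)) => h.
      by rewrite (anc_succ rq) //; apply: hB; lia.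
    by rewrite anc_id //; lia.
  - by rewrite /parA ifF //; lia.
  - by rewrite /parB ifF //; lia.
- move=> A u l vA vU hu.
  have [q [rq hq]] : exists q, succ r q /\ cmp q u.
    case: (ltnP (len r) (len u)) => h.
      exists (anc (len r).+1 u); split; first split.
      - by rewrite par_anc // hu anc_id // ltnW.
      - by rewrite len_anc.
      - rewrite /cmp len_anc // [RHS]anc_id //; rewrite len_anc //.
    have [q rq] := succ_ex r; exists q; split=> //.
    rewrite /cmp (anc_succ rq) // -hu !anc_id //; case: rq; lia.
  have lq : len q = (len r).+1 by case: rq.
  exists q, (Some A), (Some (inr u)); split=> //.
  - apply: legalU; rewrite ?(anc_succ rq) //; lia.
  - by rewrite /parA ifF //; lia.
  - by rewrite /parB ifF //; lia.
Qed.

Lemma csucc_ex t : exists t', cpar t' = t /\ len (cp t') = (len (cp t)).+1.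
Proof.
have [q [a [b [[e l] h ea eb]]]] := legal_succ (clegal t).
by exists (CPos h); split=> //; apply: cpos_eq.
Qed.

Definition cgame : game.
Proof.
refine (@Game cpos cpar (fun t => len (cp t)) croot (len_root G) _ _ csucc_ex).
- move=> t l; have e : cp t = root G by apply: len0_root.
  apply: cpos_eq => //=; case: t l {e} => r a b [] //= *; lia.
- by move=> t; exact: len_par.
Defined.

Lemma cp_morph : @morph cgame G cp.
Proof. by []. Qed.

Definition clift r a b : pos cgame :=
  if pselect (legal r a b) is left h then CPos h else croot.

Lemma cliftE r a b (h : legal r a b) : clift r a b = CPos h.
Proof. by rewrite /clift; case: pselect => // h'; apply: cpos_eq. Qed.

Lemma len_clift r a b : len (clift r a b) <= len r.
Proof. by rewrite /clift; case: pselect => //= _; rewrite len_root. Qed.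

Lemma legal_low r a b : len r <= N -> legal r a b -> a = None /\ b = None.
Proof. by move=> l [] //; lia. Qed.

Lemma legal_mid r a b : len r = N.+1 -> legal r a b ->
  exists A, [/\ a = Some A, b = None & validA r A].
Proof. by move=> l []; try lia; move=> A _ vA; exists A. Qed.

Lemma clift_cp (t : pos cgame) : len t <= N -> clift (cp t) None None = t.
Proof.
move=> l; have [e1 e2] := legal_low l (clegal t).
by rewrite cliftE; [exact: legal0|move=> h; apply: cpos_eq].
Qed.

Section Lift.
Variables (x : nat -> pos G) (px : play x) (A : pos G -> Prop) (be : (pos G -> Prop) + pos G).
Let a n : c1 := if n <= N then None else Some A.
Let b n : c2 := if n <= N.+1 then None else Some be.
Hypothesis lx : forall n, legal (x n) (a n) (b n).

Definition lift_play n : pos cgame := clift (x n) (a n) (b n).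

Lemma lift_playE n : lift_play n = CPos (lx n).
Proof. exact: cliftE. Qed.

Lemma lift_playP : play lift_play.
Proof.
split=> n; rewrite !lift_playE; first by rewrite /= px.1.
apply: cpos_eq; rewrite /= ?px.2 // px.1.
  by rewrite /parA /a ltnS; case: leqP => // h; case: leqP => //; lia.
by rewrite /parB /b ltnS; case: leqP => // h; case: leqP => //; lia.
Qed.

Lemma lift_follow (s : pos cgame -> pos cgame) n : is_strat s ->
  cp (s (lift_play n)) = x n.+1 ->
  (n = N -> ca (s (lift_play n)) = Some A) ->
  (n = N.+1 -> cb (s (lift_play n)) = Some be) ->
  lift_play n.+1 = s (lift_play n).
Proof.
move=> hs e hA hB; have [e1 e2] := hs (lift_play n).
have l : len (cp (s (lift_play n))) = n.+1 by rewrite e px.1.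
have := clegal (s (lift_play n)) => lg.
rewrite lift_playE; apply: cpos_eq => //=.
  rewrite /a; case: ltnP => h.
    have l' : len (cp (s (lift_play n))) <= N by rewrite l.
    by have [] := legal_low l' lg.
  case: (eqVneq n N) => [en|ne]; first by rewrite hA.
  have : parA _ (ca (s (lift_play n))) = ca (lift_play n) := congr1 (@ca) e1.
  rewrite l [in RHS]lift_playE /parA ifF /= /a; last by lia.
  by rewrite ifF; [move=> ->|lia].
rewrite /b; case: ltnP => h.
  case: (eqVneq n N) => [en|ne]; first by have [A' [_ ->]] := legal_mid (etrans l (congr1 S en)) lg.
  have l' : len (cp (s (lift_play n))) <= N by rewrite l; lia.
  by have [_ ->] := legal_low l' lg.
case: (eqVneq n N.+1) => [en|ne]; first by rewrite hB.
have : parB _ (cb (s (lift_play n))) = cb (lift_play n) := congr1 (@cb) e1.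
rewrite l [in RHS]lift_playE /parB ifF /= /b; last by lia.
by rewrite ifF; [move=> ->|lia].
Qed.

End Lift.

Definition transfer_low (s : pos cgame -> pos cgame) r := cp (s (clift r None None)).

Section TransferI.
Variable s : pos cgame -> pos cgame.

Definition A_of r := odflt (fun=> True) (ca (s (clift (anc N r) None None))).
Definition u_of r := anc (firstat (fun u => ~ C u) N.+2 r) r.
Definition B_of A r := A r /\ ~ Win false A (fun u => ~ C u) r.

(** Player I pretends that player II committed to the positions from which leaving
    [C] cannot be forced; once outside of them he forces a position [u] outside [C],
    and then pretends that player II had committed to [u]. *)
Definition transferI r :=
  if len r <= N then transfer_low s r else
  let A := A_of r in
  if pselect (legal r (Some A) (Some (inr (u_of r)))) is left _
  then cp (s (clift r (Some A) (Some (inr (u_of r)))))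
  else if pselect (legal r (Some A) (Some (inl (B_of A)))) is left _
  then cp (s (clift r (Some A) (Some (inl (B_of A)))))
  else pursuit false A (fun u => ~ C u) N.+2 r.

End TransferI.

Section TransferII.
Variable s : pos cgame -> pos cgame.

Definition witnesses a u A := legal a (Some A) None /\
  cb (s (clift a (Some A) None)) = Some (inr u).
Definition S_of a u := exists A, witnesses a u A.
Definition A_wit a u : pos G -> Prop :=
  if pselect (S_of a u) is left h then projT1 (cid h) else fun=> True.
Definition A_avoid a r := ~ Win true (fun=> True) (S_of a) r.

(** Player II pretends that player I committed to the arena of the positions from
    which [S_of a], the set of all possible commitments [u], can be avoided; once
    outside of it she forces some [u], and then pretends that player I had committed
    to an arena that [s] answers with [u]. *)
Definition transferII r :=
  if len r <= N then transfer_low s r else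
  let a := anc N.+1 r in
  let u := anc (firstat (S_of a) N.+2 r) r in
  if pselect (S_of a u /\ legal r (Some (A_wit a u)) (Some (inr u))) is left _
  then cp (s (clift r (Some (A_wit a u)) (Some (inr u))))
  else let be := if len r <= N.+1 then None
                 else cb (s (clift a (Some (A_avoid a)) None)) in
  if pselect (legal r (Some (A_avoid a)) be) is left _
  then cp (s (clift r (Some (A_avoid a)) be))
  else pursuit true (fun=> True) (S_of a) N.+1 r.

End TransferII.

Definition transfer (b : bool) := if b then transferII else transferI.

Lemma cp_strat s r a b : is_strat s -> legal r a b -> succ r (cp (s (clift r a b))).
Proof.
by move=> hs h; have := morph_succ cp_morph (hs (clift r a b)); rewrite (cliftE h).
Qed.

Lemma cp_strat_len s r a b : is_strat s -> legal r a b ->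
  len (cp (s (clift r a b))) = (len r).+1.
Proof. by move=> hs h; have [] := cp_strat hs h. Qed.

Lemma next_legal s r a b : is_strat s -> legal r a b -> N.+2 <= len r ->
  legal (cp (s (clift r a b))) a b.
Proof.
move=> hs h l; have lq := cp_strat_len hs h.
have [e1 _] := hs (clift r a b); rewrite [in RHS](cliftE h) in e1.
have := clegal (s (clift r a b)).
have : parA (len (cp (s (clift r a b)))) (ca (s (clift r a b))) = a := congr1 (@ca) e1.
have : parB (len (cp (s (clift r a b)))) (cb (s (clift r a b))) = b := congr1 (@cb) e1.
rewrite lq /parA /parB !ifF; [|lia..].
by move=> -> ->.
Qed.

Lemma mid_legal s a A : is_strat s -> len a = N.+1 -> legal a (Some A) None ->
  legal (cp (s (clift a (Some A) None))) (Some A) (cb (s (clift a (Some A) None))).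
Proof.
move=> hs la lA; have lq := cp_strat_len hs lA; rewrite la in lq.
have [e1 _] := hs (clift a (Some A) None); rewrite [in RHS](cliftE lA) in e1.
have := clegal (s (clift a (Some A) None)).
have : parA (len (cp (s (clift a (Some A) None)))) (ca (s (clift a (Some A) None))) = Some A
  := congr1 (@ca) e1.
by rewrite lq /parA ltnn => ->.
Qed.

Lemma transfer_strat b s : is_strat s -> is_strat (transfer b s).
Proof.
move=> hs r; case: b => /=.
  rewrite /transferII; case: ifP => l; first exact: cp_strat (legal0 l).
  case: pselect => [[_ h]|_]; first exact: cp_strat h.
  case: pselect => [h|_]; first exact: cp_strat h.
  exact: pursuit_strat.
rewrite /transferI; case: ifP => l; first exact: cp_strat (legal0 l).
case: pselect => [h|_]; first exact: cp_strat h.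
case: pselect => [h|_]; first exact: cp_strat h.
exact: pursuit_strat.
Qed.

Lemma transfer_loc b s s' n : (forall p, len p <= n -> s p = s' p) ->
  forall r, len r <= n -> transfer b s r = transfer b s' r.
Proof.
move=> e r l.
have E q a' b' : len q <= len r -> s (clift q a' b') = s' (clift q a' b').
  by move=> h; apply: e; apply: leq_trans (len_clift _ _ _) _; lia.
case: b => /=.
  rewrite /transferII /transfer_low E //; case: ifP => // l'.
  have la : len (anc N.+1 r) <= len r by rewrite len_anc; lia.
  have eS : S_of s (anc N.+1 r) = S_of s' (anc N.+1 r).
    apply/funext => u; rewrite /S_of /witnesses; apply/propext.
    by split=> -[A [h1 h2]]; exists A; split=> //; [rewrite -E|rewrite E].
  rewrite /A_avoid eS.
  set u := anc (firstat _ _ _) r; have -> : A_wit s (anc N.+1 r) u = A_wit s' (anc N.+1 r) u.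
    rewrite /A_wit /S_of; have -> // : witnesses s (anc N.+1 r) u = witnesses s' (anc N.+1 r) u.
    by apply/funext => A; rewrite /witnesses E.
  by rewrite !E.
rewrite /transferI /transfer_low E //; case: ifP => // l'.
have -> : A_of s r = A_of s' r by rewrite /A_of E // len_anc; lia.
by rewrite !E.
Qed.

Lemma transfer_lowE b s (p : pos cgame) : len p < N -> transfer b s (cp p) = cp (s p).
Proof.
move=> l; have l' : len (cp p) <= N by exact: ltnW.
have e : transfer_low s (cp p) = cp (s p) by rewrite /transfer_low clift_cp.
by case: b; rewrite /= /transferI /transferII l'.
Qed.

Lemma low_follow x s b A be n : play x -> follows b (transfer b s) x 0 ->
  odd n = b -> n <= N -> cp (s (lift_play x A be n)) = x n.+1.
Proof.
move=> px fx o l; rewrite fx // /lift_play l ifT; last by lia.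
by case: b {fx o}; rewrite /= /transferI /transferII px.1 l.
Qed.

(** Player II's commitment is chosen in hindsight: the first position of [x] outside [C], or
    [B_of A] if there is none. In the latter case [x] never leaves [B_of A], since from the first
    position won by player I on, the pursuit would be in force and would take [x] out of [C]. *)
Lemma transferI_lift s x : is_strat s -> play x -> follows false (transferI s) x 0 ->
  exists y, [/\ play y, follows false s y 0 & forall n, cp (y n) = x n].
Proof.
move=> hs px fx; set A := A_of s (x N).
have eA n : N <= n -> A_of s (x n) = A.
  by move=> h; rewrite /A /A_of !play_anc.
have [vA eca] : validA (x N.+1) A /\ ca (s (clift (x N) None None)) = Some A.
  have l0 : legal (x N) None None by apply: legal0; rewrite px.1.
  have e : cp (s (clift (x N) None None)) = x N.+1.
    by rewrite fx // /transferI px.1 leqnn.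
  have := clegal (s (clift (x N) None None)); rewrite {1}e.
  case/legal_mid; first by rewrite px.1.
  by move=> A' [h1 _ vA']; rewrite /A /A_of play_anc // h1.
pose nohit n := forall m, N.+2 <= m < n -> C (x m).
have noU n : nohit n.+1 -> ~ legal (x n) (Some A) (Some (inr (u_of (x n)))).
  move=> nh /legal_inv[_ _ [h1 _ h2 _] _]; apply: h2.
  rewrite /u_of play_anc_min // px.1 in h1 *; apply: nh; rewrite h1 ltnS; exact: geq_minr.
have move2 n : N.+2 <= n -> odd n = false -> nohit n.+1 ->
    x n.+1 = if pselect (legal (x n) (Some A) (Some (inl (B_of A)))) is left _
      then cp (s (clift (x n) (Some A) (Some (inl (B_of A)))))
      else pursuit false A (fun u => ~ C u) N.+2 (x n).
  move=> h o nh; rewrite fx // /transferI ifF; last by rewrite px.1; lia.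
  rewrite eA; last by lia.
  by case: pselect => // /(noU _ nh).
have inA n : N.+1 <= n -> nohit n -> A (x n).
  elim: n => // n IH; rewrite leq_eqVlt => /orP[/eqP [<-]|h] nh; first by case: vA.
  have An : A (x n) by apply: IH => // m hm; apply: nh; lia.
  case o: (odd n).
    by apply: (vA.2.1 (x n)); rewrite ?px.1 //; exact: play_succ.
  have h' : N.+2 <= n by case: (eqVneq n N.+1) => [en|]; [move: o; rewrite en /= evN|lia].
  rewrite move2 //; case: pselect => [lB|_] /=; last first.
    by apply: pursuit_stays; rewrite ?px.1 //; case: vA.
  have := next_legal hs lB; rewrite px.1 => /(_ h') /legal_inv[_ _ [_ hB _ _]].
  move=> /(_ n.+1); rewrite anc_id ?(cp_strat_len hs lB) ?px.1 //.
  by case; first by lia.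
have legA n : N.+2 <= n -> validA (anc N.+1 (x n)) A by move=> h; rewrite play_anc // ltnW.
have lift be : (forall n, N.+2 <= n -> legal (x n) (Some A) (Some be)) ->
    (forall n, N.+2 <= n -> odd n = false ->
       cp (s (clift (x n) (Some A) (Some be))) = x n.+1) ->
    exists y, [/\ play y, follows false s y 0 & forall n, cp (y n) = x n].
  move=> hl hf.
  have lx n : legal (x n) (if n <= N then None else Some A) (if n <= N.+1 then None else Some be).
    case: leqP => h1; first by rewrite ifT; [apply: legal0; rewrite px.1|lia].
    case: leqP => h2; last exact: hl.
    have -> : n = N.+1 by lia.
    by apply: legal1; rewrite ?px.1.
  exists (lift_play x A be); split=> [|n _ o|n]; last by rewrite (lift_playE lx).
    exact: lift_playP.
  apply: lift_follow => //.
  - case: (leqP n N) => h; first exact: (low_follow _ _ px fx).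
    have h' : N.+2 <= n by case: (eqVneq n N.+1) => [en|]; [move: o; rewrite en /= evN|lia].
    by rewrite /lift_play !ifF ?hf //; lia.
  - by move=> ->; rewrite /lift_play leqnn leqnSn eca.
  - by move=> en; move: o; rewrite en /= evN.
case: (pselect (exists m, N.+2 <= m /\ ~ C (x m))) => [hit|nhit].
  have [m [hm Cm mmin]] : exists m, [/\ N.+2 <= m, ~ C (x m) & nohit m].
    have [|m /andP[h1 /asboolP h2] h3] := @ex_minnP (fun m => (N.+2 <= m) && `[<~ C (x m)>]).
      by case: hit => m [h1 h2]; exists m; rewrite h1; apply/asboolP.
    exists m; split=> // k /andP[h4 h5]; apply: contrapT => nC.
    suff : m <= k by lia.
    by apply: h3; rewrite h4; apply/asboolP.
  have Am : A (x m) by apply: inA => //; lia.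
  have hl n : N.+2 <= n -> legal (x n) (Some A) (Some (inr (x m))).
    move=> h; apply: legalU; rewrite ?px.1 //; first exact: legA.
      by split; rewrite ?px.1 // !play_anc.
    by rewrite /cmp !px.1 !play_anc_min // minnC.
  apply: (lift (inr (x m))) => // n h o.
  (* Until [x m] is reached, comparability leaves [s] only one legal move, the one towards [x m],
     however [transferI] found it. *)
  case: (ltnP n m) => nm.
    have := next_legal hs (hl n h); rewrite px.1 => /(_ h) /legal_inv[_ _ _].
    have lq := cp_strat_len hs (hl n h); rewrite px.1 in lq.
    by rewrite /cmp lq px.1 (play_anc px nm) anc_id // lq.
  rewrite [RHS]fx // /transferI ifF; last by rewrite px.1; lia.
  rewrite eA; last by lia.
  have -> : u_of (x n) = x m.
    rewrite /u_of (firstat_play (m := m) px) ?hm ?nm ?play_anc // => k hk nC.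
    by apply: nC; apply: mmin.
  by case: pselect => // nl; case: nl; exact: hl.
have nh n : nohit n by move=> m /andP[h _]; apply: contrapT => nC; apply: nhit; exists m.
have WB n : N.+2 <= n -> B_of A (x n).
  move=> h; split; first by apply: inA => //; lia.
  move=> Wn.
  have [m [hm Wm mmin]] : exists m, [/\ N.+2 <= m, Win false A (fun u => ~ C u) (x m) &
     forall k, N.+2 <= k < m -> ~ Win false A (fun u => ~ C u) (x k)].
    have [|m /andP[h1 /asboolP h2] h3] :=
        @ex_minnP (fun m => (N.+2 <= m) && `[<Win false A (fun u => ~ C u) (x m)>]).
      by exists n; rewrite h; apply/asboolP.
    exists m; split=> // k /andP[h4 h5] Wk.
    suff : m <= k by lia.
    by apply: h3; rewrite h4; apply/asboolP.
  have [k mk o|k [mk Ck]] := pursuitP vA.2 px hm Wm mmin; last by apply: Ck; apply: (nh k.+1); lia.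
  rewrite move2 //; last by lia.
  case: pselect => // /legal_inv[_ _ _ /(_ m)]; rewrite px.1 play_anc //.
  by case; [lia|].
have vB : validB (x N.+2) A (B_of A).
  split; first exact: WB.
  - move=> r [Ar nW]; split=> //; apply: contrapT => nC; apply: nW.
    by apply: Win_target => //; case: vA.
  - move=> r r' [Ar nW] o rr' Ar'; split=> // W'; apply: nW.
    by apply: (Win_move _ _ rr' Ar' W') => //; case: vA.
  - move=> r [Ar nW] o; apply: contrapT => nex; apply: nW.
    apply: Win_opp => //; first by case: vA.
    move=> q rq; apply: contrapT => nWq; apply: nex; exists q; split=> //; split=> //.
    by apply: (vA.2.1 r).
have hl n : N.+2 <= n -> legal (x n) (Some A) (Some (inl (B_of A))).
  move=> h; apply: legalB; rewrite ?px.1 //; first exact: legA.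
    by rewrite play_anc.
  by move=> m /andP[h1 h2]; rewrite play_anc //; exact: WB.
apply: (lift (inl (B_of A))) => // n h o; rewrite [RHS]move2 //.
by case: pselect => // nl; case: nl; exact: hl.
Qed.

Lemma witnesses_valid s a u A : is_strat s -> len a = N.+1 -> witnesses s a u A ->
  validA a A /\ validU (cp (s (clift a (Some A) None))) A u.
Proof.
move=> hs la [lA eb]; have [_ vA] := legal_inv lA; split=> //.
have lq := cp_strat_len hs lA; rewrite la in lq.
have := mid_legal hs la lA; rewrite eb => /legal_inv[_ _ vU _].
by rewrite anc_id ?lq // in vU.
Qed.

Lemma S_of_len s a u : is_strat s -> len a = N.+1 -> S_of s a u -> N.+2 <= len u.
Proof. by move=> hs la [A /(witnesses_valid hs la)[_ []]]. Qed.

(** Suppose that [x] never meets [S]. Then it stays in [A_avoid], or the pursuit would lead it into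
    [S]. To this arena [s] cannot answer with a position [u], which would be in [S] and hence won at
    once; so it answers with some [B], which moves of player I inside the arena cannot leave. *)
Lemma transferII_lift s x : is_strat s -> play x -> follows true (transferII s) x 0 ->
  exists y, [/\ play y, follows true s y 0 & forall n, cp (y n) = x n].
Proof.
move=> hs px fx; set a := x N.+1; have la : len a = N.+1 by rewrite px.1.
pose S := S_of s a.
have ea n : N.+1 <= n -> anc N.+1 (x n) = a by move=> h; rewrite play_anc.
have oddN n : odd n = true -> N <= n -> N.+1 <= n.
  by move=> o; rewrite leq_eqVlt => /orP[/eqP e|//]; move: o; rewrite -e evN.
have lift A be : validA a A ->
    (forall n, N.+2 <= n -> legal (x n) (Some A) (Some be)) ->
    cp (s (clift a (Some A) None)) = x N.+2 ->
    cb (s (clift a (Some A) None)) = Some be ->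
    (forall n, N.+2 <= n -> odd n = true ->
       cp (s (clift (x n) (Some A) (Some be))) = x n.+1) ->
    exists y, [/\ play y, follows true s y 0 & forall n, cp (y n) = x n].
  move=> vA hl h1 h2 hf.
  have lx n : legal (x n) (if n <= N then None else Some A) (if n <= N.+1 then None else Some be).
    case: leqP => h3; first by rewrite ifT; [apply: legal0; rewrite px.1|lia].
    case: leqP => h4; last exact: hl.
    have -> : n = N.+1 by lia.
    by apply: legal1; rewrite ?px.1.
  exists (lift_play x A be); split=> [|n _ o|n]; last by rewrite (lift_playE lx).
    exact: lift_playP.
  apply: lift_follow => //.
  - case: (leqP n N) => h; first exact: (low_follow _ _ px fx).
    case: (eqVneq n N.+1) => [->|ne]; first by rewrite /lift_play ltnn leqnn.
    by rewrite /lift_play !ifF ?hf //; lia.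
  - by move=> en; move: o; rewrite en /= evN.
  - by move=> ->; rewrite /lift_play ltnn leqnn.
case: (pselect (exists m, N.+2 <= m /\ S (x m))) => [hit|nhit].
  have [m [hm Sm mmin]] : exists m, [/\ N.+2 <= m, S (x m) &
      forall k, N.+2 <= k < m -> ~ S (x k)].
    have [|m /andP[h1 /asboolP h2] h3] := @ex_minnP (fun m => (N.+2 <= m) && `[<S (x m)>]).
      by case: hit => m [h1 h2]; exists m; rewrite h1; apply/asboolP.
    exists m; split=> // k /andP[h4 h5] Sk; suff : m <= k by lia.
    by apply: h3; rewrite h4; apply/asboolP.
  set A := A_wit s a (x m).
  have wA : witnesses s a (x m) A.
    by rewrite /A /A_wit; case: pselect => // h; case: cid.
  have [vA vU] := witnesses_valid hs la wA; have eb := wA.2.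
  (* A position to which [s] commits extends the move that [s] makes along with it, so a play
     through [x m] has made that move. *)
  have e2 : cp (s (clift a (Some A) None)) = x N.+2.
    by case: vU => _ <- _ _; rewrite play_anc.
  rewrite e2 in vU.
  have hl n : N.+2 <= n -> legal (x n) (Some A) (Some (inr (x m))).
    move=> h; apply: legalU; rewrite ?px.1 ?play_anc //; first by lia.
    by rewrite /cmp !px.1 !play_anc_min // minnC.
  apply: (lift A (inr (x m))) => // n h o.
  case: (ltnP n m) => nm.
    have := next_legal hs (hl n h); rewrite px.1 => /(_ h) /legal_inv[_ _ _].
    have lq := cp_strat_len hs (hl n h); rewrite px.1 in lq.
    by rewrite /cmp lq px.1 (play_anc px nm) anc_id // lq.
  rewrite [RHS]fx // /transferII ifF; last by rewrite px.1; lia.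
  rewrite ea; last by lia.
  have -> : anc (firstat (S_of s a) N.+2 (x n)) (x n) = x m.
    by rewrite (firstat_play (m := m) px) ?hm ?nm ?play_anc.
  by case: pselect => // nl; case: nl; split=> //; exact: hl.
have noS n : N.+1 <= n -> ~ S (x n).
  move=> h Sn; have := S_of_len hs la Sn; rewrite px.1 => h'.
  by apply: nhit; exists n.
set A := A_avoid s a.
have move2 n : N.+1 <= n -> odd n = true ->
    x n.+1 = let be := if n <= N.+1 then None else cb (s (clift a (Some A) None)) in
      if pselect (legal (x n) (Some A) be) is left _
      then cp (s (clift (x n) (Some A) be))
      else pursuit true (fun=> True) S N.+1 (x n).
  move=> h o; rewrite fx // /transferII ifF; last by rewrite px.1; lia.
  rewrite ea // px.1; case: pselect => // -[Su _]; exfalso; move: Su.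
  rewrite play_anc_min // => Su.
  have := S_of_len hs la Su; rewrite px.1 => h'.
  by apply: noS Su; lia.
have AW u : A u -> ~ Win true (fun=> True) S u by [].
have inA n : N.+1 <= n -> A (x n).
  move=> h Wn.
  have [m [hm Wm mmin]] : exists m, [/\ N.+1 <= m, Win true (fun=> True) S (x m) &
     forall k, N.+1 <= k < m -> ~ Win true (fun=> True) S (x k)].
    have [|m /andP[h1 /asboolP h2] h3] :=
        @ex_minnP (fun m => (N.+1 <= m) && `[<Win true (fun=> True) S (x m)>]).
      by exists n; rewrite h; apply/asboolP.
    exists m; split=> // k /andP[h4 h5] Wk; suff : m <= k by lia.
    by apply: h3; rewrite h4; apply/asboolP.
  have [k mk o|k [mk Sk]] := pursuitP (arenaT _ _) px hm Wm mmin; last by apply: noS Sk; lia.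
  have hk : N.+1 <= k by lia.
  rewrite move2 //=; case: pselect => // lg; exfalso.
  move: lg; case: leqP => k1.
    move=> /legal_inv[_ [h1 _]]; apply: h1; have -> : k = m by lia.
    exact: Wm.
  case eb: (cb _) => [[B|u]|] /legal_inv; last by rewrite px.1; lia.
    move=> [_ vA [_ hB _ _] /(_ m)]; rewrite px.1 ea // in vA *.
    rewrite play_anc // => h1; case: (eqVneq m N.+1) => [em|ne].
      by case: vA => h2 _; move: Wm; rewrite em.
    by have [|h2 _] := hB (x m); [apply: h1; lia|exact: (h2 Wm)].
  move=> [_ vA [_ _ _ Au] _]; rewrite ea // in vA.
  apply: Au; apply: Win_target; first exact: arenaT.
  by exists A; split=> //; apply: legal1.
have vA : validA a A.
  split; first exact: inA.
  split=> [r q nW o rq Wq|r nW o].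
    by apply: nW; apply: (Win_move _ _ rq _ Wq) => //; exact: arenaT.
  apply: contrapT => nex; apply: nW; apply: Win_opp; [exact: arenaT|by []|].
  by move=> q rq; apply: contrapT => nWq; apply: nex; exists q.
have lA : legal a (Some A) None by exact: legal1.
have eq2 : cp (s (clift a (Some A) None)) = x N.+2.
  rewrite move2 //= ?evN // leqnn; case: pselect => // nl; by case: nl.
have lA2 := mid_legal hs la lA; rewrite {1}eq2 in lA2.
have [B eb] : exists B, cb (s (clift a (Some A) None)) = Some (inl B).
  move: lA2; case eb: (cb _) => [[B|u]|] lg; first by exists B.
    move: lg => /legal_inv[_ _ [_ _ _ Au] _]; case: Au.
    by apply: Win_target; [exact: arenaT|exists A; split].
  by move: lg => /legal_inv[]; rewrite px.1; lia.
have vB : validB (x N.+2) A B /\ B (x N.+2).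
  move: lA2; rewrite eb => /legal_inv[_ _].
  by rewrite anc_id ?px.1 // => vB _; split=> //; case: vB.
have legB n : N.+2 <= n -> (forall m, N.+2 <= m <= n -> B (x m)) ->
    legal (x n) (Some A) (Some (inl B)).
  move=> h hB; apply: legalB; rewrite ?px.1 //.
  - by rewrite ea // ltnW.
  - by rewrite play_anc //; case: vB.
  - by move=> m hm; rewrite play_anc //; [exact: hB|lia].
have inB n : N.+2 <= n -> legal (x n) (Some A) (Some (inl B)).
  move=> h; suff hB m : N.+2 <= m <= n -> B (x m) by exact: legB.
  elim: n h m => // n IH; rewrite leq_eqVlt => /orP[/eqP [<-]|h] m hm.
    have -> : m = N.+2 by lia.
    by case: vB.
  case: (eqVneq m n.+1) => [->|ne]; last by apply: IH => //; lia.
  have Bn : B (x n) by apply: IH => //; lia.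
  have [[_ _ vB3 _] _] := vB.
  case o: (odd n); last first.
    by apply: (vB3 (x n)); rewrite ?px.1 //; [exact: play_succ|apply: inA; lia].
  have lB : legal (x n) (Some A) (Some (inl B)).
    by apply: legB => // k hk; apply: IH => //; lia.
  rewrite move2 //=; last by lia.
  rewrite ifF; last by lia.
  rewrite eb; case: pselect => // {}lB.
  have := next_legal hs lB; rewrite px.1 => /(_ h) /legal_inv[_ _ _].
  move=> /(_ n.+1); rewrite anc_id ?(cp_strat_len hs lB) ?px.1 //; apply; lia.
apply: (lift A (inl B)) => // n h o; rewrite [RHS]move2 //=; last by lia.
rewrite ifF; last by lia.
by rewrite eb; case: pselect => // nl; case: nl; exact: inB.
Qed.

Lemma cgame_cover : @is_cover N cgame G cp transfer.
Proof.
split.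
- exact: cp_morph.
- move=> p q l e; have lq : len (cp q) <= N by rewrite -e.
  by rewrite -(clift_cp l) -(clift_cp lq) e.
- by move=> p l; exists (CPos (legal0 l)).
- exact: transfer_strat.
- by move=> b s s' n _ _; exact: transfer_loc.
- by move=> b s p _; exact: transfer_lowE.
- move=> [] s x hs px fx; first exact: transferII_lift.
  exact: transferI_lift.
Qed.

(** Position [N.+2] decides: a commitment [inl] keeps the play in [C], and a commitment [inr u]
    makes it pass through [u], which is outside [C]. *)
Lemma cgame_clopen : @clopenG cgame (fun z => forall n, C (cp (z n))).
Proof.
move=> x px; exists N.+2 => y py e.
have Cdown (z : nat -> pos cgame) m n : play z -> m <= n -> C (cp (z n)) -> C (cp (z m)).
  move=> pz; elim: n => [|n IH]; first by rewrite leqn0 => /eqP ->.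
  rewrite leq_eqVlt => /orP[/eqP ->//|h] Cn; apply: IH => //.
  rewrite -pz.2 /=; exact: Cpar.
have key (z : nat -> pos cgame) : play z -> match cb (z N.+2) with
    Some (inl _) => forall n, C (cp (z n)) | _ => ~ forall n, C (cp (z n)) end.
  move=> pz; have pzc := morph_play cp_morph pz.
  have cbz n : N.+2 <= n -> cb (z n) = cb (z N.+2).
    elim: n => // n IH; rewrite leq_eqVlt => /orP[/eqP [<-]//|h].
    rewrite -(IH h) -[in RHS]pz.2 /= /parB ifF //.
    by rewrite [len _](pzc.1 n.+1); lia.
  have lz n : len (cp (z n)) = n := pzc.1 n.
  have := fun n => clegal (z n).
  case eb: (cb (z N.+2)) => [[B|u]|] hl.
  - move=> n; apply: (Cdown z n (n + N.+2) pz (leq_addr _ _)).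
    have := legal_inv (hl (n + N.+2)); rewrite cbz ?leq_addl // eb.
    case: (ca _) => // A [_ _ [_ hB _ _] /(_ (n + N.+2))].
    rewrite anc_id ?lz // => h; apply: (hB _ _).2; apply: h; lia.
  - move=> hC; have := legal_inv (hl (len u + N.+2)); rewrite cbz ?leq_addl // eb.
    case: (ca _) => // A [_ _ [_ _ nC _]]; rewrite /cmp lz.
    rewrite anc_id ?leq_addr // => eu; apply: nC; rewrite eu.
    by rewrite (play_anc pzc) ?leq_addr //; exact: hC.
  - have := legal_inv (hl N.+2); rewrite eb lz; case: (ca _) => [A []|]; lia.
have := key _ py; have := key _ px; rewrite e.
by case: (cb (x N.+2)) => [[B|u]|] h1 h2; split.
Qed.

End ClosedSet.

(** * Unraveling Borel sets *)

Lemma clopenG_compl (G : game) (X : (nat -> pos G) -> Prop) :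
  clopenG X -> clopenG (fun x => ~ X x).
Proof.
by move=> h x px; have [n hn] := h x px; exists n => y py e; rewrite (hn y py e).
Qed.

Lemma unravels_compl N (G : game) (X : (nat -> pos G) -> Prop) :
  unravels N X -> unravels N (fun x => ~ X x).
Proof.
move=> [G' [f [phi [h1 h2]]]]; exists G', f, phi; split=> //.
exact: (clopenG_compl h2).
Qed.

Lemma unravels_ext N (G : game) (X Y : (nat -> pos G) -> Prop) :
  (forall x, play x -> X x <-> Y x) -> unravels N X -> unravels N Y.
Proof.
move=> XY [G' [f [phi [h1 h2]]]]; exists G', f, phi; split=> // x px.
have mf := cov_morph h1; have [n hn] := h2 x px; exists n => y py e.
by rewrite -!XY; [exact: hn|exact: morph_play..].
Qed.

Definition openG (G : game) (X : (nat -> pos G) -> Prop) := forall x, play x -> X x ->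
  exists n, forall y, play y -> y n = x n -> X y.

Lemma unravels_open N (G : game) (X : (nat -> pos G) -> Prop) :
  openG X -> unravels N X.
Proof.
move=> oX.
pose C (r : pos G) := exists y, [/\ play y, y (len r) = r & ~ X y].
have Cpar r : C r -> C (par r).
  move=> [y [py e nX]]; exists y; split=> //; rewrite len_par.
  rewrite -{2}e; case: (len r) => [|n]; last by rewrite py.2.
  have l0 : len (par (y 0)) = 0 by rewrite len_par py.1.
  by rewrite (len0_root l0); apply: len0_root; rewrite py.1.
have XC x : play x -> ~ X x <-> (forall n, C (x n)).
  move=> px; split=> [nX n|hC Xx]; first by exists x; rewrite px.1.
  have [n hn] := oX x px Xx; have [y [py e nX]] := hC n; apply: nX.
  by apply: hn => //; rewrite px.1 in e.
apply: (@unravels_ext _ _ (fun x => ~ ~ X x)) => [x _|]; first by rewrite notK.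
apply: unravels_compl.
apply: (@unravels_ext _ _ (fun x => forall n, C (x n))) => [x /XC ->//|].
(* The auxiliary game needs player I to move at the length where commitments begin; doubling [N]
   gives an even bound that is at least [N]. *)
have ev : odd N.*2 = false by rewrite odd_double.
exists (cgame ev C), (@cp _ _ _), (@transfer G N.*2 ev C); split.
  apply: (@cover_le N N.*2); first by rewrite -addnn leq_addr.
  exact: cgame_cover.
exact: cgame_clopen.
Qed.

Lemma hunravels_clopen (G : game) (X : (nat -> pos G) -> Prop) :
  clopenG X -> hunravels X.
Proof.
move=> cX G' f mf N; exists G', id, (fun _ s => s); split; first exact: cover_id.
exact: clopenG_morph.
Qed.

Lemma hunravels_compl (G : game) (X : (nat -> pos G) -> Prop) :
  hunravels X -> hunravels (fun x => ~ X x).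
Proof. by move=> hX G' f mf N; apply: unravels_compl; apply: hX. Qed.

(** On the inverse limit every [X i] has become clopen, so the union is merely open there; one more
    covering unravels it. *)
Lemma unravels_limit (G : game) (X : nat -> (nat -> pos G) -> Prop) (T : nat -> game)
    (f : forall i, pos (T i.+1) -> pos (T i)) phi N
    (cov : forall i, is_cover (N + i) (@f i) (@phi i)) (g : forall i, pos (T i) -> pos G) :
  (forall i t, g i.+1 t = g i (f i t)) ->
  (forall i, clopenG (fun x => X i (g i.+1 \o x))) ->
  unravels N (fun x => exists i, X i (g 0 \o x)).
Proof.
move=> gf cX.
have gt (t : thread f) i : g i (sval t i) = g 0 (sval t 0).
  by elim: i => // i <-; rewrite gf (svalP t i).
have [|G' [h [psi [ch hc]]]] := @unravels_open N (limit_game cov)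
    (fun x => exists i, X i (g 0 \o ((fun t => sval t 0) \o x))).
  move=> x px [i Xi].
  have e (y : nat -> pos (limit_game cov)) :
      g 0 \o ((fun t => sval t 0) \o y) = g i.+1 \o ((fun t => sval t i.+1) \o y).
    by apply/funext => n /=; rewrite gt.
  have [n hn] := clopenG_morph (limit_morph cov i.+1) (cX i) px.
  exists n => y py yx; exists i; rewrite e; apply/(hn y py yx).
  by rewrite e in Xi.
exists G', ((fun t => sval t 0) \o h); eexists; split; last exact: hc.
exact: (cover_comp ch (limit_cover cov)).
Qed.

Section Union.
Variables (G : game) (X : nat -> (nat -> pos G) -> Prop) (hX : forall i, hunravels (X i)).
Variables (G0 : game) (g0 : pos G0 -> pos G) (mg0 : morph g0) (N : nat).

Let state := {T : game & {g : pos T -> pos G | morph g}}.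

(** The set [X i] is unraveled through the composite map of the stages built so far, with the bound
    [N + i] that the inverse limit requires. *)
Lemma tower_next i (st : state) : {G' : game & {f : pos G' -> pos (projT1 st) & {phi |
  is_cover (N + i) f phi /\
  clopenG (fun x => X i (sval (projT2 st) \o (f \o x)))}}}.
Proof.
have := @hX i _ _ (svalP (projT2 st)) (N + i).
by move=> /cid[G' /cid[f /cid[phi h]]]; exists G', f, phi.
Qed.

Definition tower : nat -> state := nat_rect (fun=> state) (existT _ G0 (exist _ g0 mg0))
  (fun i st => let h := tower_next i st in existT _ (projT1 h)
     (exist _ (sval (projT2 st) \o projT1 (projT2 h))
        (morph_comp (cov_morph (svalP (projT2 (projT2 h))).1) (svalP (projT2 st))))).

Lemma unravels_bigcup : unravels N (fun x => exists i, X i (g0 \o x)).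
Proof.
have hn i := svalP (projT2 (projT2 (tower_next i (tower i)))).
apply: (@unravels_limit G X (fun i => projT1 (tower i))
  (fun i => projT1 (projT2 (tower_next i (tower i))))
  (fun i => sval (projT2 (projT2 (tower_next i (tower i))))) N
  (fun i => (hn i).1) (fun i => sval (projT2 (tower i)))).
  by [].
by move=> i; exact: (hn i).2.
Qed.

End Union.

Lemma hunravels_bigcup (G : game) (X : nat -> (nat -> pos G) -> Prop) :
  (forall i, hunravels (X i)) -> hunravels (fun x => exists i, X i x).
Proof. by move=> hX G' f mf N; exact: unravels_bigcup. Qed.

(** * Wadge games *)

Section WordLimit.
Context {E : Type} (a0 : E).
Implicit Types (z : nat -> E) (v : seq E) (w : nat -> seq E).

Lemma mkseq_add z m n : mkseq z (m + n) = mkseq z m ++ mkseq (fun k => z (m + k)) n.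
Proof. by rewrite /mkseq iotaD map_cat add0n -{2}(addn0 m) iotaDl -map_comp. Qed.

Lemma mkseq_takeE z m n : m <= n -> mkseq z m = take m (mkseq z n).
Proof. by move=> h; rewrite /mkseq -map_take take_iota (minn_idPl h). Qed.

Lemma mkseq_prefix z v v' : mkseq z (size (v ++ v')) = v ++ v' -> mkseq z (size v) = v.
Proof.
move=> h; rewrite (@mkseq_takeE z _ (size (v ++ v'))) ?h ?take_size_cat //.
by rewrite size_cat leq_addr.
Qed.

Lemma mkseq_le z z' m n : m <= n -> mkseq z n = mkseq z' n -> mkseq z m = mkseq z' m.
Proof. by move=> h e; rewrite (mkseq_takeE z h) e -mkseq_takeE. Qed.

Lemma mkseq_ext z z' n : (forall k, k < n -> z k = z' k) <-> mkseq z n = mkseq z' n.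
Proof.
split=> h; first by apply/eq_in_map => k; rewrite mem_iota => /andP[_ /h].
by move=> k kn; rewrite -(nth_mkseq a0 z kn) h nth_mkseq.
Qed.

Definition word_limit w : nat -> E := fun l => nth a0 (w l.+1) l.

Lemma word_limitP w : (forall n, exists t, w n.+1 = w n ++ t) -> (forall n, n <= size (w n)) ->
  forall n, mkseq (word_limit w) (size (w n)) = w n.
Proof.
move=> wS sw.
have pre m n : m <= n -> exists t, w n = w m ++ t.
  elim: n => [|n IH]; first by rewrite leqn0 => /eqP ->; exists [::]; rewrite cats0.
  rewrite leq_eqVlt => /orP[/eqP ->|/IH[t e]]; first by exists [::]; rewrite cats0.
  by have [t' ->] := wS n; exists (t ++ t'); rewrite e catA.
move=> n; apply: (@eq_from_nth _ a0); rewrite size_mkseq // => l ln.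
rewrite nth_mkseq // /word_limit; case: (leqP l.+1 n) => h.
  by have [t ->] := pre _ _ h; rewrite nth_cat sw.
by have [t ->] := pre _ _ (ltnW h); rewrite nth_cat ln.
Qed.

End WordLimit.


(** * Borel subsets of the Baire space *)

Definition agree (n : nat) (z z' : nat -> nat) := forall k, k < n -> z k = z' k.

Lemma agree_mkseq n z z' : agree n z z' <-> mkseq z n = mkseq z' n.
Proof. exact: (mkseq_ext 0). Qed.

Lemma agree_le m n z z' : m <= n -> agree n z z' -> agree m z z'.
Proof. by move=> mn h k km; apply: h; lia. Qed.

Lemma agree_sym n z z' : agree n z z' -> agree n z' z.
Proof. by move=> h k kn; rewrite h. Qed.

(** Closure under complements and countable unions of the sets that depend on
    finitely many coordinates: the Borel subsets of the Baire space. *)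
Inductive gborel : ((nat -> nat) -> Prop) -> Prop :=
| gb_fin Q n : (forall z z', agree n z z' -> Q z -> Q z') -> gborel Q
| gb_compl Q : gborel Q -> gborel (fun z => ~ Q z)
| gb_bigcup F : (forall i : nat, gborel (F i)) -> gborel (fun z => exists i, F i z).

Lemma gb_ext Q Q' : (forall z, Q z <-> Q' z) -> gborel Q -> gborel Q'.
Proof. by move=> h; have -> : Q = Q' by apply/funext => z; apply/propext. Qed.

Lemma gb_or Q Q' : gborel Q -> gborel Q' -> gborel (fun z => Q z \/ Q' z).
Proof.
move=> h h'; apply: (@gb_ext (fun z => exists i : nat, (if i is 0 then Q else Q') z)).
  move=> z; split=> [[[|i] ?]|[?|?]]; [by left|by right|by exists 0|by exists 1].
by apply: gb_bigcup => -[|i].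
Qed.

Lemma gb_and Q Q' : gborel Q -> gborel Q' -> gborel (fun z => Q z /\ Q' z).
Proof.
move=> h h'; apply: (@gb_ext (fun z => ~ (~ Q z \/ ~ Q' z))).
  by move=> z; rewrite -not_andE notK.
by apply: gb_compl; apply: gb_or; apply: gb_compl.
Qed.

Lemma gb_imply Q Q' : gborel Q -> gborel Q' -> gborel (fun z => Q z -> Q' z).
Proof.
move=> h h'; apply: (@gb_ext (fun z => ~ Q z \/ Q' z)); first by move=> z; rewrite implyE.
by apply: gb_or => //; apply: gb_compl.
Qed.

Lemma gb_forall F : (forall i : nat, gborel (F i)) -> gborel (fun z => forall i, F i z).
Proof.
move=> h; apply: (@gb_ext (fun z => ~ exists i, ~ F i z)).
  move=> z; split=> [h' i|h' [i]]; last by apply; exact: h'.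
  by apply: contrapT => nF; apply: h'; exists i.
by apply: gb_compl; apply: gb_bigcup => i; apply: gb_compl.
Qed.

Lemma gb_even Q : gborel Q -> gborel (fun z => Q (fun n => z n.*2)).
Proof.
elim=> [{}Q n h|{}Q _ IH|F _ IH]; [|exact: gb_compl IH|exact: gb_bigcup].
apply: (@gb_fin _ n.*2) => z z' a; apply: h => k kn; apply: a; lia.
Qed.

(** Positions are stored with the latest move first, so that [behead] is the predecessor. *)
Definition nat_game : game.
Proof.
refine (@Game (seq nat) behead size [::] erefl _ _ _).
- by move=> [].
- by move=> p; rewrite size_behead.
- by move=> p; exists (0 :: p).
Defined.

Lemma nat_play (z : nat -> nat) : @play nat_game (fun n => rev (mkseq z n)).
Proof.
split=> n /=; first by rewrite size_rev size_mkseq.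
by rewrite mkseqS rev_rcons.
Qed.

Lemma hunravels_gborel Q : gborel Q ->
  @hunravels nat_game (fun x => Q (fun k => head 0 (x k.+1))).
Proof.
elim=> [{}Q n h|{}Q _ IH|F _ IH]; last exact: hunravels_bigcup.
- apply: hunravels_clopen => x px; exists n => y py e.
  have xk k : k < n -> head 0 (x k.+1) = head 0 (y k.+1).
    by move=> kn; rewrite -(play_anc px kn) -e play_anc.
  by split; apply: h => k /xk.
exact: (hunravels_compl IH).
Qed.

Lemma gborel_determined Q : gborel Q ->
  (exists s : seq nat -> nat, forall z,
     (forall n, odd n = false -> z n = s (mkseq z n)) -> Q z) \/
  (exists s : seq nat -> nat, forall z,
     (forall n, odd n = true -> z n = s (mkseq z n)) -> ~ Q z).
Proof.
move=> /hunravels_gborel/determined_hunravels.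
have key b s z : @is_strat nat_game s ->
    (forall n, odd n = b -> z n = head 0 (s (rev (mkseq z n)))) ->
    follows b s (fun n => rev (mkseq z n)) 0.
  move=> hs hz n _ o; rewrite mkseqS rev_rcons hz //.
  have [] := hs (rev (mkseq z n)); rewrite /=.
  by case: (s _) => //= a t -> _.
have zE (z : nat -> nat) : (fun k => head 0 (rev (mkseq z k.+1))) = z.
  by apply/funext => k; rewrite mkseqS rev_rcons.
case=> -[s [hs hw]]; [left|right]; exists (fun t => head 0 (s (rev t))) => z hz.
  by have := hw _ (nat_play z) (key _ _ _ hs hz); rewrite zE.
by have := hw _ (nat_play z) (key _ _ _ hs hz); rewrite zE.
Qed.

(** The entry [c.+1] commits to the value [c], the entry [0] is a pass. *)
Definition commits (s : seq nat) : seq nat :=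
  pmap (fun a => if a is c.+1 then Some c else None) s.

Definition decodes (e y : nat -> nat) := forall j, exists n,
  j < size (commits (mkseq e n)) /\ nth 0 (commits (mkseq e n)) j = y j.

Definition good e := forall j, exists n, j < size (commits (mkseq e n)).

Lemma commits_rcons s a :
  commits (rcons s a) = if a is c.+1 then rcons (commits s) c else commits s.
Proof. by rewrite /commits -!cats1 pmap_cat; case: a => [|c] /=; rewrite ?cats0 ?cats1. Qed.

Lemma commits_prefix e m n : m <= n ->
  exists t, commits (mkseq e n) = commits (mkseq e m) ++ t.
Proof.
move=> h; exists (commits (drop m (mkseq e n))).
by rewrite (mkseq_takeE e h) -[LHS](congr1 commits (cat_take_drop m _)) /commits pmap_cat.
Qed.

Lemma commits_nth e m n j : j < size (commits (mkseq e m)) ->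
  j < size (commits (mkseq e n)) ->
  nth 0 (commits (mkseq e m)) j = nth 0 (commits (mkseq e n)) j.
Proof.
wlog h : m n / m <= n.
  by move=> H hm hn; case/orP: (leq_total m n) => h; [|apply/esym]; apply: H.
by move=> hm _; have [t ->] := commits_prefix e h; rewrite nth_cat hm.
Qed.

Lemma good_decodes e : good e -> exists y, decodes e y.
Proof. by move=> /choice[f hf]; exists (fun j => nth 0 (commits (mkseq e (f j))) j) => j; exists (f j). Qed.

Lemma decodes_good e y : decodes e y -> good e.
Proof. by move=> h j; have [n [h1 _]] := h j; exists n. Qed.

Lemma decodes_nth e y n j : decodes e y -> j < size (commits (mkseq e n)) ->
  nth 0 (commits (mkseq e n)) j = y j.
Proof. by move=> h hj; have [m [hm <-]] := h j; exact: commits_nth. Qed.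

Lemma decodes_fun e y y' : decodes e y -> decodes e y' -> y = y'.
Proof.
move=> h h'; apply/funext => j; have [n [h1 <-]] := h j.
by rewrite (decodes_nth h').
Qed.

Lemma gb_good : gborel (fun z => good (fun n => z n.*2.+1)).
Proof.
apply: gb_forall => j; apply: gb_bigcup => n; apply: (@gb_fin _ n.*2) => z z' a.
suff -> : mkseq (fun n => z n.*2.+1) n = mkseq (fun n => z' n.*2.+1) n by [].
by apply/agree_mkseq => k kn; apply: a; lia.
Qed.

Lemma gb_decodes D : gborel D ->
  gborel (fun z => exists y, decodes (fun n => z n.*2.+1) y /\ D y).
Proof.
elim=> [Q n h|Q _ IH|F _ IH].
- apply: (@gb_ext (fun z => good (fun n => z n.*2.+1) /\ exists m,
     n <= size (commits (mkseq (fun n => z n.*2.+1) m)) /\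
     Q (nth 0 (commits (mkseq (fun n => z n.*2.+1) m))))).
    move=> z; set e := (fun n => z n.*2.+1); split=> [[/good_decodes[y dy]] [m [hm Qm]]|[y [dy Qy]]].
      exists y; split=> //; apply: h Qm => k kn; apply: decodes_nth => //; lia.
    split; first exact: decodes_good dy.
    have [m hm] : exists m, n <= size (commits (mkseq e m)).
      by case: (n) => [|n']; [exists 0|exact: (decodes_good dy)].
    exists m; split=> //; apply: h Qy => k kn; apply/esym/decodes_nth => //; lia.
  apply: gb_and; first exact: gb_good.
  apply: gb_bigcup => m; apply: (@gb_fin _ m.*2) => z z' a.
  suff -> : mkseq (fun n => z n.*2.+1) m = mkseq (fun n => z' n.*2.+1) m by [].
  by apply/agree_mkseq => k kn; apply: a; lia.
- apply: gb_ext (gb_and gb_good (gb_compl IH)) => z.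
  split=> [[/good_decodes[y dy] nQ]|[y [dy nQ]]].
    by exists y; split=> // Qy; apply: nQ; exists y.
  split; first exact: decodes_good dy.
  by move=> [y' [dy' Qy']]; apply: nQ; rewrite (decodes_fun dy dy').
- apply: gb_ext (gb_bigcup IH) => z; split=> [[i [y [dy Fy]]]|[y [dy [i Fy]]]].
    by exists y; split=> //; exists i.
  by exists i, y.
Qed.

Definition contf (g : (nat -> nat) -> nat -> nat) := forall x j, exists n,
  forall x', agree n x x' -> g x' j = g x j.

Section Build.
Variables (b : bool) (s : seq nat -> nat).

(** The play in which the player [b] follows [s] against the moves [o] *)
Fixpoint bpref (o : nat -> nat) n : seq nat :=
  if n is n'.+1 then rcons (bpref o n') (if odd n' == b then s (bpref o n') else o n'./2)
  else [::].

Definition build o n := if odd n == b then s (bpref o n) else o n./2.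

Lemma build_mkseq o n : mkseq (build o) n = bpref o n.
Proof. by elim: n => // n IH; rewrite mkseqS IH. Qed.

Lemma build_follow o n : odd n = b -> build o n = s (mkseq (build o) n).
Proof. by move=> e; rewrite build_mkseq /build e eqxx. Qed.

Lemma build_opp o n : odd n = ~~ b -> build o n = o n./2.
Proof. by rewrite /build => ->; case: b. Qed.

Lemma build_agree o o' n : agree n o o' -> agree n.*2 (build o) (build o').
Proof.
move=> a k; elim/ltn_ind: k => k IH kn; rewrite /build.
have -> : bpref o k = bpref o' k.
  by rewrite -!build_mkseq; apply/agree_mkseq => j jk; apply: IH => //; lia.
by case: eqP => // _; apply: a; lia.
Qed.

End Build.

(** A winning strategy of player II yields [g], one of player I yields [h]; both maps are continuous
    because finitely many values depend on finitely many moves of the opponent. A second player who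
    passes from some point on loses, so in the first case every play decodes. *)
Lemma wadge_game A B D : gborel A -> gborel B -> gborel D ->
  (exists g, contf g /\ forall x, (A x -> D (g x)) /\ (B x -> ~ D (g x))) \/
  (exists h, contf h /\ forall e y, decodes e y ->
     ~ ((A (h e) -> D y) /\ (B (h e) -> ~ D y))).
Proof.
move=> gA gB gD.
pose II z := [/\ good (fun n => z n.*2.+1),
  A (fun n => z n.*2) -> exists y, decodes (fun n => z n.*2.+1) y /\ D y &
  B (fun n => z n.*2) -> ~ exists y, decodes (fun n => z n.*2.+1) y /\ D y].
have gII : gborel (fun z => ~ II z).
  apply: gb_compl; have h1 := gb_imply (gb_even gA) (gb_decodes gD).
  have h2 := gb_imply (gb_even gB) (gb_compl (gb_decodes gD)).
  by apply: gb_ext (gb_and gb_good (gb_and h1 h2)) => z; split=> [[? []]|[]].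
case: (gborel_determined gII) => -[s hs]; [right|left].
  exists (fun e n => build false s e n.*2); split.
    move=> x j; exists j.+1 => x' a; apply/esym/(@build_agree false s _ _ _ a); lia.
  move=> e y dy [hA hB]; set z := build false s e.
  have ez : (fun n => z n.*2.+1) = e.
    by apply/funext => n; rewrite /z build_opp /= ?odd_double // uphalf_double.
  apply: (hs z (fun n => @build_follow false s e n)); rewrite /II ez; split.
  - exact: decodes_good dy.
  - by move=> /hA Dy; exists y.
  - by move=> /hB nD [y' [dy' Dy']]; apply: nD; rewrite (decodes_fun dy dy').
pose z x := build true s x.
have zx x : (fun n => z x n.*2) = x.
  by apply/funext => n; rewrite /z build_opp ?odd_double // doubleK.
have hz x : II (z x).
  by apply: contrapT; apply: hs => n o; exact: build_follow.
have /choice[g hg] : forall x, exists y, decodes (fun n => z x n.*2.+1) y.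
  by move=> x; have [/good_decodes] := hz x.
exists g; split.
  move=> x j; have [n [h1 h2]] := hg x j; exists n => x' a.
  rewrite -h2 -(decodes_nth (n := n) (hg x')).
    congr (nth _ (commits _) _); apply/esym/agree_mkseq => k kn.
    apply: (@build_agree true s _ _ _ a); lia.
  suff <- : mkseq (fun n => z x n.*2.+1) n = mkseq (fun n => z x' n.*2.+1) n by [].
  by apply/agree_mkseq => k kn; apply: (@build_agree true s _ _ _ a); lia.
move=> x; have [_ h1 h2] := hz x; rewrite zx in h1 h2; split=> [/h1|/h2 nD Dg].
  by move=> [y [dy Dy]]; rewrite (decodes_fun (hg x) dy).
by apply: nD; exists (g x).
Qed.

(** The code commits to the next value of [g] as soon as its own finite part determines that value
    for all continuations, and passes until then. Continuity of [g] at the resulting code ensures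
    that the waiting always ends. *)
Lemma decodes_fixpoint g : contf g -> exists y, decodes y (g y).
Proof.
move=> cg.
pose det w j := forall x x', mkseq x (size w) = w -> mkseq x' (size w) = w -> g x j = g x' j.
pose val w j := g (nth 0 w) j.
pose f w := if pselect (det w (size (commits w))) is left _ then (val w (size (commits w))).+1 else 0.
pose w := fix w n := if n is n'.+1 then rcons (w n') (f (w n')) else [::].
pose y n := f (w n).
have wy n : mkseq y n = w n by elim: n => // n IH; rewrite mkseqS IH.
have sw n : size (w n) = n by rewrite -wy size_mkseq.
have valE n j : det (w n) j -> val (w n) j = g y j.
  by move=> h; apply: h; rewrite sw ?wy // -[RHS](mkseq_nth 0) sw.
have step n : det (w n) (size (commits (w n))) ->
    commits (w n.+1) = rcons (commits (w n)) (g y (size (commits (w n)))).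
  by move=> h; rewrite /= /f commits_rcons; case: pselect => // h'; rewrite valE.
have cor n j : j < size (commits (w n)) -> nth 0 (commits (w n)) j = g y j.
  elim: n => // n IH; rewrite [w _]/= commits_rcons /f; case: pselect => //= h.
  rewrite size_rcons nth_rcons ltnS leq_eqVlt valE //.
  by case: ltngtP => // [jn _|-> _]; rewrite ?IH ?eqxx.
exists y => j; suff [n hn] : exists n, j < size (commits (w n)).
  by exists n; rewrite wy; split=> //; exact: cor.
have grow n : exists m, size (commits (w n)) < size (commits (w m)).
  set j0 := size _; have [k hk] := cg y j0.
  have [t et] := commits_prefix y (leq_maxl n k); rewrite !wy in et.
  case: (ltnP j0 (size (commits (w (maxn n k))))) => h; first by exists (maxn n k).
  have ej : size (commits (w (maxn n k))) = j0.
    by apply/eqP; rewrite eqn_leq h et size_cat leq_addr.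
  exists (maxn n k).+1; rewrite step ?ej ?size_rcons ?ej //.
  have det1 x : mkseq x (maxn n k) = w (maxn n k) -> g x j0 = g y j0.
    by rewrite -wy => /agree_mkseq/agree_sym/(agree_le (leq_maxr n k))/hk.
  by move=> x x'; rewrite sw => /det1 -> /det1 ->.
elim: j => [|j [n hn]]; first by have [m hm] := grow 0; exists m.
by have [m hm] := grow n; exists m; lia.
Qed.

(** * The tree *)

Definition iv (d : cardinal_le_omega) : idx d -> nat :=
  match d with Fin n => fun i => nat_of_ord i | Omega => fun i => i end.

Lemma iv_inj d : injective (@iv d).
Proof. by case: d => [n|] //= i j; exact: val_inj. Qed.

Lemma iv_ex d a : two_le d -> a < 2 -> exists i : idx d, iv i = a.
Proof. by case: d => [n|] /= h l; [exists (Ordinal (leq_trans l h))|exists a]. Qed.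

Lemma unbounded_inj (f : nat -> nat) n : injective f -> exists k, n <= f k.
Proof.
move=> fI; apply: contrapT => h.
have : size [seq f k | k <- iota 0 n.+1] <= size (iota 0 n).
  apply: uniq_leq_size; first by rewrite map_inj_uniq ?iota_uniq.
  move=> _ /mapP[k _ ->]; rewrite mem_iota /= add0n ltnNge; apply/negP => nk.
  by apply: h; exists k.
by rewrite size_map !size_iota ltnn.
Qed.

Section Tree.
Context {d : cardinal_le_omega} (hd : two_le d).
Notation I := (idx d).
Notation column := (I -> I).

Definition i0 : I := projT1 (cid (iv_ex hd (isT : 0 < 2))).
Definition i1 : I := projT1 (cid (iv_ex hd (isT : 1 < 2))).

Lemma iv_i0 : iv i0 = 0. Proof. by rewrite /i0; case: cid. Qed.
Lemma iv_i1 : iv i1 = 1. Proof. by rewrite /i1; case: cid. Qed.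

Lemma i0_neq_i1 : i0 <> i1.
Proof. by move=> /(congr1 (@iv d)); rewrite iv_i0 iv_i1. Qed.

Definition of_nat a : I := if pselect (exists i : I, iv i = a) is left h
  then projT1 (cid h) else i0.

Lemma ivK i : of_nat (iv i) = i.
Proof.
rewrite /of_nat; case: pselect => [h|[]]; last by exists i.
by case: cid => j /= /iv_inj.
Qed.

Definition cst (e : I) : column := fun=> e.
Definition idc : column := fun i => i.

Lemma cst_idc e : cst e <> idc.
Proof.
move=> h; apply: i0_neq_i1.
by rewrite -[i0]/(idc i0) -[i1]/(idc i1) -h.
Qed.

(** For infinite [d] there are uncountably many columns; those of the tree are coded by a countable
    alphabet, which makes their words enumerable. *)
Definition letter (o : option nat) : column := if o is Some a then cst (of_nat a) else idc.

(** Nodes with a label, each repeated infinitely often because of the last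
    component *)
Definition decode l : seq (option nat) * nat :=
  if (unpickle l : option (seq (option nat) * nat * nat)) is Some ((w, c), _)
  then (w, c) else ([::], 0).

(** The node at level [l] above which the diagonal column [idc] is allowed, and
    the label that this occurrence of [idc] carries *)
Definition special l : seq column :=
  let w := (decode l).1 in
  if size w <= l then map letter w ++ nseq (l - size w) (cst i0) else nseq l (cst i0).
Definition label l : nat := (decode l).2.

Definition okcol (s : seq column) (c : column) :=
  (exists e, iv e < (size s).+2 /\ c = cst e) \/ (c = idc /\ s = special (size s)).

Definition tree : set (seq column) :=
  [set s | forall l, l < size s -> okcol (take l s) (nth idc s l)].

Lemma tree_rcons s c : tree (rcons s c) <-> tree s /\ okcol s c.
Proof.
split=> [h|[h1 h2] l]; last first.
  rewrite size_rcons ltnS leq_eqVlt => /orP[/eqP ->|l1].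
    by rewrite nth_rcons ltnn eqxx -cats1 take_size_cat.
  by rewrite nth_rcons l1 -cats1 takel_cat ?(ltnW l1) //; exact: h1.
split=> [l l1|]; last first.
  have := h (size s); rewrite size_rcons ltnSn nth_rcons ltnn eqxx -cats1 take_size_cat //.
  exact.
have := h l; rewrite size_rcons nth_rcons l1 ltnW // -cats1 takel_cat ?(ltnW l1) //.
exact.
Qed.

Lemma tree_cat s t : tree (s ++ t) -> tree s.
Proof.
elim/last_ind: t => [|t c IH]; first by rewrite cats0.
by rewrite -rcons_cat => /tree_rcons[/IH].
Qed.

Lemma tree_take n s : tree s -> tree (take n s).
Proof. by rewrite -{1}(cat_take_drop n s) => /tree_cat. Qed.

Lemma tree_csts s w : tree s ->
  (forall k, k < size w -> iv (nth i0 w k) < (size s + k).+2) ->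
  tree (s ++ map cst w).
Proof.
move=> Ts; elim/last_ind: w => [|w e IH] h; first by rewrite cats0.
rewrite map_rcons -rcons_cat; apply/tree_rcons; split.
  apply: IH => k kw; have := h k; rewrite size_rcons nth_rcons kw; apply; lia.
left; exists e; split=> //; rewrite size_cat size_map.
by have := h (size w); rewrite size_rcons nth_rcons ltnn eqxx; apply.
Qed.

Lemma tree_pad s n : tree s -> tree (s ++ nseq n (cst i0)).
Proof.
move=> Ts; have -> : nseq n (cst i0) = map cst (nseq n i0) by rewrite map_nseq.
apply: tree_csts => // k; rewrite size_nseq => kn.
by rewrite nth_nseq kn iv_i0.
Qed.

Lemma tree_word s : tree s -> exists w, s = map letter w.
Proof.
elim/last_ind: s => [|s c IH]; first by exists [::].
move=> /tree_rcons[/IH[w ->]] [[e [_ ->]]|[-> _]].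
  by exists (rcons w (Some (iv e))); rewrite map_rcons /= ivK.
by exists (rcons w None); rewrite map_rcons.
Qed.

Lemma special_dense s c : tree s -> exists l, [/\ size s <= l, label l = c &
  special l = s ++ nseq (l - size s) (cst i0)].
Proof.
move=> /tree_word[w ->]; rewrite size_map.
have [|k hk] := @unbounded_inj (fun k => pickle (w, c, k)) (size w).
  by move=> k k' /(pcan_inj pickleK)[].
exists (pickle (w, c, k)); rewrite /label /special /decode pickleK /=.
by rewrite hk.
Qed.

Definition coord (i : I) (s : seq column) := [seq c i | c <- s].

Lemma coord_rcons i s c : coord i (rcons s c) = rcons (coord i s) (c i).
Proof. exact: map_rcons. Qed.

(** Two constant columns that agree somewhere are equal, and a constant column agrees with the
    identity in a single coordinate. *)
Lemma tree_one_sided s s' i j : tree s -> tree s' -> size s = size s' ->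
  coord i s = coord i s' -> coord j s = coord j s' -> i <> j -> s = s'.
Proof.
move=> + + + + + ij; elim/last_ind: s s' => [|s c IH] s'; first by case: s'.
case/lastP: s' => [|s' c']; first by move=> _ _; rewrite size_rcons.
move=> /tree_rcons[Ts oc] /tree_rcons[Ts' oc']; rewrite !size_rcons => -[es].
rewrite !coord_rcons => /rcons_inj[ei ci] /rcons_inj[ej cj].
have {IH}e := IH s' Ts Ts' es ei ej; subst s'; congr rcons.
case: oc oc' ci cj => [[e [_ ->]]|[-> _]] [[e' [_ ->]]|[-> _]] //; rewrite /cst /idc.
- by move=> ->.
- by move=> -> h; case: ij.
- by move=> <- h; case: ij.
Qed.

(** Neighbours with constant last columns have the same constant. If no last column is the identity,
    the cycle therefore projects injectively to the previous level. Otherwise one vertex ends with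
    the identity and all others with one constant [e]; both edges at that vertex must be in
    coordinate [e], so it and its two neighbours agree there. *)
Lemma tree_acyclic l L (x : nat -> seq column) : 3 <= L -> x L = x 0 ->
  (forall n, n <= L -> tree (x n) /\ size (x n) = l) ->
  (forall m n, m < L -> n < L -> x m = x n -> m = n) ->
  (forall n, n < L -> exists i, coord i (x n) = coord i (x n.+1)) ->
  exists i k m n, [/\ k < m, m < n, n < L,
    coord i (x k) = coord i (x m) & coord i (x m) = coord i (x n)].
Proof.
elim: l x => [|l IH] x L3 xL hx xI xE.
  by have := xI 0 1; rewrite !(size0nil (hx _ _).2) //; try lia; move=> /(_ _ _ erefl); lia.
pose u n := take l (x n); pose c n := nth idc (x n) l.
have xr n : n <= L -> x n = rcons (u n) (c n).
  move=> h; have [_ s] := hx n h.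
  by rewrite /u /c -take_nth ?s // -s take_size.
have Tu n : n <= L -> tree (u n) /\ size (u n) = l.
  move=> h; have [T s] := hx n h; split; first exact: tree_take.
  by rewrite size_take s ltnSn.
have oc n : n <= L -> okcol (u n) (c n).
  by move=> h; have [] := hx n h; rewrite xr // => /tree_rcons[].
have cx i m n : m <= L -> n <= L -> coord i (x m) = coord i (x n) <->
    coord i (u m) = coord i (u n) /\ c m i = c n i.
  move=> hm hn; rewrite !xr // !coord_rcons; split=> [/rcons_inj[]|[-> ->]] //.
have cstc n : n <= L -> c n <> idc -> exists e, c n = cst e.
  by move=> /oc[[e [_ ->]]|[-> _]] // _; exists e.
have cL : c L = c 0 by rewrite /c xL.
have chain a b : a <= b -> b <= L -> (forall n, a <= n <= b -> c n <> idc) -> c a = c b.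
  elim: b => [|b IHb]; first by rewrite leqn0 => /eqP ->.
  rewrite leq_eqVlt => /orP[/eqP ->//|ab] bL hc.
  rewrite IHb //; [|lia|by move=> n hn; apply: hc; lia].
  have [e1 h1] : exists e, c b = cst e by apply: cstc; [lia|apply: hc; lia].
  have [e2 h2] : exists e, c b.+1 = cst e by apply: cstc; [lia|apply: hc; lia].
  have [i /cx[||_]] := xE b bL; try lia.
  by rewrite h1 h2 /cst => ->.
case: (pselect (exists p, p < L /\ c p = idc)) => [[p [pL cp]]|nop].
  (* The identity is allowed above one node per level, so no other vertex of the cycle ends with
     it. *)
  have puniq n : n < L -> c n = idc -> n = p.
    move=> nL cn; apply: xI => //; rewrite !xr ?cp ?cn; try lia.
    congr rcons; have [[e [_ h]]|[_ ->]] := oc n (ltnW nL); first by case: (@cst_idc e); rewrite -h.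
    have [[e [_ h]]|[_ ->]] := oc p (ltnW pL); first by case: (@cst_idc e); rewrite -h.
    by rewrite !(Tu _ _).2 //; lia.
  have nidc n : n <= L -> n <> p -> (n = L -> p <> 0) -> c n <> idc.
    rewrite leq_eqVlt => /orP[/eqP ->|nL] np n0; last by move=> /(puniq _ nL).
    by rewrite cL => /puniq => h; apply: n0 => //; rewrite h //; lia.
  (* The three witnesses must be listed as increasing indices below [L]; when [p] is [0] or [L.-1]
     one of its neighbours wraps around. *)
  case: (posnP p) => p0.
    have [i hi] := xE 0 (ltn_trans (isT : 0 < 2) L3).
    have L1 : L.-1 < L by lia.
    have [j] := xE L.-1 L1; rewrite prednK ?xL; last by lia.
    have e : c 1 = c L.-1 by apply: chain; [lia..|move=> n hn; apply: nidc; lia].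
    move=> hj.
    have [e1 h1] : exists e, c 1 = cst e by apply: cstc; [lia|apply: nidc; lia].
    have ei : e1 = i.
      move: hi => /cx[||_]; try lia.
      by rewrite -p0 cp p0 h1.
    have ej : e1 = j.
      move: (hj) => /cx[||_]; try lia.
      by rewrite -p0 cp -e h1.
    have ij : i = j by rewrite -ei -ej.
    exists i, 0, 1, L.-1; split; [lia..|exact: hi|].
    by rewrite -hi ij hj.
  have [i] := xE p.-1 (ltac:(lia) : p.-1 < L); rewrite prednK // => hi.
  have [j hj] := xE p pL.
  have [e1 h1] : exists e, c p.-1 = cst e by apply: cstc; [lia|apply: nidc; lia].
  have e2 : c p.-1 = c p.+1.
    rewrite -(@chain 0 p.-1) //; [|lia|by move=> n hn; apply: nidc; lia].
    rewrite -cL; apply/esym; apply: chain; [lia..|].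
    by move=> n hn; apply: nidc; lia.
  have ei : e1 = i.
    move: (hi) => /cx[||_]; try lia.
    by rewrite cp h1.
  have ej : e1 = j.
    move: (hj) => /cx[||_]; try lia.
    by rewrite cp -e2 h1.
  have ij : i = j by rewrite -ei -ej.
  rewrite -ij in hj.
  case: (ltnP p.+1 L) => pL1.
    by exists i, p.-1, p, p.+1; split; [lia..|exact: hi|exact: hj].
  have epL : p.+1 = L by lia.
  exists i, 0, p.-1, p; split; [lia..| |exact: hi].
  by rewrite hi -xL -epL hj.
have call n : n <= L -> c 0 = c n.
  move=> nL; apply: chain => // k hk.
  rewrite leq_eqVlt in nL; move=> ck; apply: nop.
  case: (ltnP k L) => kL; first by exists k.
  exists 0; split; [lia|rewrite -cL -ck; congr c; lia].
have [||||i [k [m [n [km mn nL e1 e2]]]]] := IH u L3.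
- by rewrite /u xL.
- exact: Tu.
- move=> m n mL nL e; apply: xI => //; rewrite !xr ?e; try lia.
  by rewrite -!call //; lia.
- by move=> n nL; have [i /cx[||h _]] := xE n nL; [lia..|exists i].
exists i, k, m, n; split=> //; apply/cx; try lia; split=> //.
  by rewrite -!call //; lia.
by rewrite -!call //; lia.
Qed.

Lemma finite_tree_level l : finite_set [set s | tree s /\ size s = l].
Proof.
elim: l => [|l IH].
  by apply: (sub_finite_set _ (finite_set1 [::])) => s [_ /size0nil ->].
pose cols := [set cst (of_nat a) | a in `I_l.+2] `|` [set idc].
have fc : finite_set cols.
  by rewrite finite_setU; split; [apply: finite_image; exact: finite_II|exact: finite_set1].
apply: (sub_finite_set _ (finite_image (fun p => rcons p.1 p.2) (finite_setX IH fc))) => s [].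
case/lastP: s => [|s c]; rewrite ?size_rcons // => /tree_rcons[Ts oc] [ls].
exists (s, c) => //; split=> //=; case: oc => [[e [le ->]]|[-> _]]; last by right.
by left; exists (iv e); rewrite /= ?ivK // -ls.
Qed.

Definition columns l (x : I -> 'I_l -> I) : seq column := [seq (fun i => x i j) | j <- enum 'I_l].

Lemma coord_columns l (x y : I -> 'I_l -> I) i :
  coord i (columns x) = coord i (columns y) <-> x i = y i.
Proof.
rewrite /coord /columns -!map_comp; split=> [h|h]; last first.
  by apply/eq_in_map => j _ /=; rewrite h.
have /eq_in_map hj := h.
by apply/funext => j; apply: (hj j); rewrite -enumT mem_enum.
Qed.

Lemma columns_inj l : injective (@columns l).
Proof. by move=> x y e; apply/funext => i; apply/coord_columns; rewrite e. Qed.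

Lemma size_columns l (x : I -> 'I_l -> I) : size (columns x) = l.
Proof. by rewrite size_map size_enum_ord. Qed.

Lemma tree_suitable : suitable_levels tree.
Proof.
move=> l; split.
- pose g (s : seq column) : I -> 'I_l -> I := fun i j => nth idc s j i.
  apply: (sub_finite_set _ (finite_image g (finite_tree_level l))) => x Tx.
  exists (columns x); first by split=> //; exact: size_columns.
  apply/funext => i; apply/funext => j; rewrite /g (nth_map j) ?size_enum_ord //.
  by rewrite nth_ord_enum.
- move=> x y Tx Ty xy i j xi xj; apply: contrapT => ij; apply: xy; apply: columns_inj.
  by apply: tree_one_sided Tx Ty _ _ _ ij; rewrite ?size_columns //; apply/coord_columns.
- move=> L x [L3 xL xI xE].
  have [|||||i [k [m [n [km mn nL e1 e2]]]]] := @tree_acyclic l L (fun n => columns (x n)).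
  + exact: L3.
  + by rewrite xL.
  + move=> n; rewrite leq_eqVlt size_columns => /orP[/eqP ->|/xE[Tn _ _ _]] //.
    rewrite xL; have [Tn _ _ _] := xE 0 (ltn_trans (isT : 0 < 2) L3).
    by split.
  + by move=> m n mL nL /columns_inj; exact: xI.
  + by move=> n /xE[_ _ _ [i xi]]; exists i; apply/coord_columns.
  by exists i, k, m, n; split=> //; apply/coord_columns.
Qed.

End Tree.

(** * Generic points for a finer Polish topology *)

Section Forcing.
Context {d : cardinal_le_omega} (hd : two_le d).
Notation I := (idx d).
Notation point := (nat -> I).
Local Open Scope ring_scope.
Variables (m0 : nat) (dist : point -> point -> Rdefinitions.R) (xs : nat -> point).
Hypotheses (distC : forall x y, dist x y = dist y x)
  (distD : forall x y z, dist x z <= dist x y + dist y z).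
Hypothesis xs_dense : forall z (e : Rdefinitions.R), 0 < e -> exists j, dist (xs j) z < e.
Hypothesis dist_complete : forall u : nat -> point,
  (forall e : Rdefinitions.R, 0 < e -> exists N, forall m n, (N <= m)%N -> (N <= n)%N ->
     dist (u m) (u n) < e) ->
  exists z, (forall e : Rdefinitions.R, 0 < e -> exists N, forall n, (N <= n)%N -> dist (u n) z < e) /\
    forall j, exists N, forall n, (N <= n)%N -> u n j = z j.
Local Open Scope nat_scope.
Implicit Types (z : point) (v w : seq I) (s : seq nat) (O : seq I -> Prop) (M : point -> Prop).

(** The shape of coordinate [i] of a node of the tree, for [m0 = iv i]: below that level the
    identity column may write a letter exceeding the bound on constants, from there on it respects
    that bound. *)
Definition node v := forall l, m0 <= l -> l < size v -> iv (nth (i0 hd) v l) < l.+2.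
Definition inZ z := forall l, m0 <= l -> iv (z l) < l.+2.
Definition denseN O := forall v, node v -> exists t, node (v ++ t) /\ O (v ++ t).
Definition meets z O := exists n, O (mkseq z n).
Definition meager M := exists O : nat -> seq I -> Prop, (forall n, denseN (O n)) /\
  forall z, inZ z -> M z -> exists n, ~ meets z (O n).
Definition above v z := mkseq z (size v) = v.

Lemma inZ_node z n : inZ z -> node (mkseq z n).
Proof. by move=> h l ml; rewrite size_mkseq => ln; rewrite nth_mkseq //; exact: h. Qed.

Lemma meagerS M M' : (forall z, inZ z -> M z -> M' z) -> meager M' -> meager M.
Proof. by move=> h [Os [h1 h2]]; exists Os; split=> // z Zz /(h _ Zz); exact: h2. Qed.

Lemma meager_bigcup (F : nat -> point -> Prop) : (forall n, meager (F n)) ->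
  meager (fun z => exists n, F n z).
Proof.
move=> /choice[Os hO].
pose P k := if (unpickle k : option (nat * nat)) is Some (a, b) then Os a b else fun=> True.
exists P; split=> [k|z Zz [n Fn]].
  rewrite /P; case: unpickle => [[a b]|]; first exact: (hO a).1.
  by move=> v nv; exists [::]; rewrite cats0.
have [m hm] := (hO n).2 z Zz Fn.
by exists (pickle (n, m)); rewrite /P pickleK.
Qed.

Lemma meager_dense O : denseN O -> meager (fun z => ~ meets z O).
Proof. by move=> dO; exists (fun=> O); split=> // z _ h; exists 0. Qed.

Definition radius n : Rdefinitions.R := (n.+1%:R^-1)%R.

Lemma radius_gt0 n : (0 < radius n)%R.
Proof. by rewrite /radius invr_gt0 ltr0n. Qed.

Lemma radius_small (e : Rdefinitions.R) : (0 < e)%R -> exists n, (radius n < e)%R.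
Proof.
move=> e0; exists (Num.truncn e^-1); rewrite /radius invf_plt ?posrE ?ltr0n //.
exact: Num.Theory.truncnS_gt.
Qed.

Definition cell s z := forall r, r < size s -> (dist (xs (nth 0 s r)) z < radius r)%R.

Lemma cell_rcons s z : cell s z -> exists j, cell (rcons s j) z.
Proof.
move=> cs; have [j hj] := xs_dense z (radius_gt0 (size s)).
exists j => r; rewrite size_rcons ltnS nth_rcons; case: ltngtP => // [rs _|-> _//].
exact: cs.
Qed.

Lemma cell_sub s j z : cell (rcons s j) z -> cell s z.
Proof.
move=> h r rs; have := h r; rewrite size_rcons nth_rcons rs; apply; lia.
Qed.

(** A generic point above [v] is then close to [cell s] for [dist]: this replaces the
    Baire property of the sets that are open for the finer topology. *)
Definition forces v s := node v /\ forall t, node (v ++ t) ->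
  ~ meager (fun z => cell s z /\ above (v ++ t) z).

Lemma forces_ext v t s : forces v s -> node (v ++ t) -> forces (v ++ t) s.
Proof. by move=> [h1 h2] nt; split=> // t'; rewrite -catA; exact: h2. Qed.

Lemma forces_le z m n s : inZ z -> m <= n -> forces (mkseq z m) s -> forces (mkseq z n) s.
Proof.
move=> Zz mn /forces_ext h; have e : mkseq z n = mkseq z m ++ mkseq (fun k => z (m + k)) (n - m).
  by rewrite -mkseq_add subnKC.
by rewrite e; apply: h; rewrite -e; exact: inZ_node.
Qed.

(** The union of the meager traces of cells on basic neighbourhoods. There are countably many
    traces, and outside this union a cell is non-meager around each of its points. *)
Definition bad z := exists s v, meager (fun z => cell s z /\ above v z) /\ (cell s z /\ above v z).

Lemma bad_meager : meager bad.
Proof.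
pose F k z := if (unpickle k : option (seq nat * seq nat)) is Some (s, a) then
   let v := map (of_nat hd) a in
   meager (fun z => cell s z /\ above v z) /\ (cell s z /\ above v z) else False.
apply: (@meagerS _ (fun z => exists k, F k z)).
  move=> z Zz [s [v h]]; exists (pickle (s, map (@iv d) v)); rewrite /F pickleK /=.
  by rewrite -map_comp (eq_map (@ivK d hd)) map_id.
apply: meager_bigcup => k; rewrite /F; case: unpickle => [[s a]|].
  set v := map _ _; case: (pselect (meager (fun z => cell s z /\ above v z))) => h.
    by apply: meagerS h => z _ [].
  by exists (fun _ _ => True); split=> [n v' nv|z _ []//]; exists [::]; rewrite cats0.
by exists (fun _ _ => True); split=> // n v nv; exists [::]; rewrite cats0.
Qed.

Definition decided s v := forces v s \/ meager (fun z => cell s z /\ above v z).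

Lemma decided_dense s : denseN (decided s).
Proof.
move=> v nv; case: (pselect (forces v s)) => [h|h].
  by exists [::]; rewrite cats0; split=> //; left.
have [t [nt mt]] : exists t, node (v ++ t) /\ meager (fun z => cell s z /\ above (v ++ t) z).
  apply: contrapT => h'; apply: h; split=> // t nt mt.
  by apply: h'; exists t.
by exists t; split=> //; right.
Qed.

Definition gen1 z := ~ bad z /\ forall s, meets z (decided s).

Lemma gen1_meager : meager (fun z => ~ gen1 z).
Proof.
pose F k z := if k is k'.+1 then
  if (unpickle k' : option (seq nat)) is Some s then ~ meets z (decided s) else False
  else bad z.
apply: (@meagerS _ (fun z => exists k, F k z)).
  move=> z Zz ng; apply: contrapT => nF; apply: ng; split.
    by move=> bz; apply: nF; exists 0.
  move=> s; apply: contrapT => ns; apply: nF; exists (pickle s).+1.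
  by rewrite /F pickleK.
apply: meager_bigcup => -[|k]; first exact: bad_meager.
rewrite /F; case: unpickle => [s|]; first exact: meager_dense (@decided_dense s).
by exists (fun _ _ => True); split=> // n v nv; exists [::]; rewrite cats0.
Qed.

Lemma gen1_forces z s : gen1 z -> cell s z -> exists n, forces (mkseq z n) s.
Proof.
move=> [nb gd] cs; have [n [h|h]] := gd s; first by exists n.
by case: nb; exists s, (mkseq z n); split=> //; split=> //; rewrite /above size_mkseq.
Qed.

Lemma forces_split v s t : forces v s -> node (v ++ t) ->
  exists t' j, node (v ++ t ++ t') /\ forces (v ++ t ++ t') (rcons s j).
Proof.
move=> [nv fv] nt; have := fv _ nt; set u := v ++ t => nm.
have [z [Zz cs az gz]] : exists z, [/\ inZ z, cell s z, above u z & gen1 z].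
  apply: contrapT => nz; apply: nm; apply: meagerS gen1_meager => z Zz [cs az] gz.
  by apply: nz; exists z.
have [j cj] := cell_rcons cs; have [n fn] := gen1_forces gz cj.
have fm := forces_le Zz (leq_maxr (size u) n) fn.
have e : mkseq z (maxn (size u) n) = u ++ mkseq (fun k => z (size u + k)) (maxn (size u) n - size u).
  by rewrite -{2}az -mkseq_add subnKC // leq_maxl.
exists (mkseq (fun k => z (size u + k)) (maxn (size u) n - size u)), j.
by rewrite catA -/u -e; split=> //; exact: fm.1.
Qed.

(** The second alternative is there for density only: it is incompatible with a prefix that forces
    [s]. *)
Definition splits s v := (exists j, forces v (rcons s j)) \/ forall t, ~ forces (v ++ t) s.

Lemma splits_dense s : denseN (splits s).
Proof.
move=> v nv; case: (pselect (exists t, forces (v ++ t) s)) => [[t ft]|h].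
  have nt : node ((v ++ t) ++ [::]) by rewrite cats0; exact: ft.1.
  have [t' [j]] := forces_split ft nt; rewrite /= -catA => -[h1 h2].
  by exists (t ++ t'); split=> //; left; exists j.
by exists [::]; rewrite cats0; split=> //; right=> t ft; apply: h; exists t.
Qed.

Lemma generic_ex : exists O : nat -> seq I -> Prop, (forall n, denseN (O n)) /\
  forall z, inZ z -> (forall n, meets z (O n)) -> gen1 z /\ forall s, meets z (splits s).
Proof.
pose F k z := if k is k'.+1 then
  if (unpickle k' : option (seq nat)) is Some s then ~ meets z (splits s) else False
  else ~ gen1 z.
have [|O [h1 h2]] := @meager_bigcup F.
  move=> [|k]; first exact: gen1_meager.
  rewrite /F; case: unpickle => [s|]; first exact: meager_dense (@splits_dense s).
  by exists (fun _ _ => True); split=> // n v nv; exists [::]; rewrite cats0.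
exists O; split=> // z Zz mz.
have nF k : ~ F k z by move=> Fk; have [|n] := h2 z Zz; [exists k|apply].
split; first by apply: contrapT; exact: (nF 0).
by move=> s; have := nF (pickle s).+1; rewrite /F pickleK => /contrapT.
Qed.

(** A prefix of [z] forces a small cell around [z]. A generic [z'] with the same prefix forces ever
    smaller subcells along its own prefixes; points taken in them converge to [z'], which is thus
    within the closure of the first cell. The factor 3 adds the distances from [z] to the centre,
    from the centre to an approximating point, and from that point to [z']. *)
Lemma generic_continuous z (e : Rdefinitions.R) : (0 < e)%R -> inZ z -> gen1 z -> exists l,
  forall z', inZ z' -> (forall s, meets z' (splits s)) ->
  mkseq z l = mkseq z' l -> (dist z z' < e)%R.
Proof.
move=> e0 Zz gz; have [r hr] : exists r, (radius r * 3 < e)%R.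
  have [|r hr] := @radius_small (e / 3)%R; first by lra.
  by exists r; lra.
have [s [ss cs]] : exists s, size s = r.+1 /\ cell s z.
  elim: {hr} r => [|r [s [ss cs]]].
    have [|j cj] := @cell_rcons [::] z; first by [].
    by exists [:: j].
  by have [j cj] := cell_rcons cs; exists (rcons s j); rewrite size_rcons ss.
have [l fl] := gen1_forces gz cs.
exists l => z' Zz' mz' ezz; rewrite ezz in fl.
have grow u : (exists n, forces (mkseq z' n) u) -> exists j, exists n, forces (mkseq z' n) (rcons u j).
  move=> [n fn]; have [m [[j hj]|hm]] := mz' u; first by exists j, m.
  case: (hm (mkseq (fun k => z' (m + k)) (maxn m n - m))).
  by rewrite -mkseq_add subnKC ?leq_maxl //; apply: forces_le fn; rewrite ?leq_maxr.
have /choice[f hf] : forall u, exists j, (exists n, forces (mkseq z' n) u) ->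
    exists n, forces (mkseq z' n) (rcons u j).
  move=> u; case: (pselect (exists n, forces (mkseq z' n) u)) => [h|h].
    by have [j hj] := grow u h; exists j.
  by exists 0.
pose t := fix t n := if n is n'.+1 then rcons (t n') (f (t n')) else s.
have ft k : exists n, forces (mkseq z' n) (t k).
  by elim: k => [|k IH]; [exists l|apply: hf].
have st k : size (t k) = r.+1 + k.
  by elim: k => [|k IH]; rewrite ?addn0 //= size_rcons IH addnS.
(* A forced cell is non-meager, hence nonempty, in each neighbourhood of the forcing prefix. *)
have /choice[w hw] : forall k, exists y : point, cell (t k) y /\ mkseq y k = mkseq z' k.
  move=> k; have [n fn] := ft k; have fm := forces_le Zz' (leq_maxl n k) fn.
  apply: contrapT => nw; apply: (fm.2 [::]); first by rewrite cats0; exact: fm.1.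
  exists (fun _ _ => True); split=> [n' v nv|w _ [cw aw]]; first by exists [::]; rewrite cats0.
  exfalso; apply: nw; exists w; split=> //; move: aw.
  rewrite cats0 /above size_mkseq; apply: mkseq_le; exact: leq_maxr.
have cell_t j k : cell (t (j + k)) `<=` cell (t j).
  elim: k => [|k IH]; first by rewrite addn0.
  by rewrite addnS => y /cell_sub; exact: IH.
have near_w q j k : q < r.+1 + j -> j <= k -> (dist (xs (nth 0 (t j) q)) (w k) < radius q)%R.
  move=> qj jk; have := (hw k).1; rewrite -(subnKC jk) => /cell_t; apply.
  by rewrite st.
have [|y [yl yp]] := dist_complete (u := w).
  move=> e' e'0; have [|q hq] := @radius_small (e' / 2)%R; first by lra.
  exists q => m n qm qn.
  have h1 := @near_w q q m (ltac:(lia)) qm; have h2 := @near_w q q n (ltac:(lia)) qn.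
  by have := distD (w m) (xs (nth 0 (t q) q)) (w n); rewrite (distC (w m) (xs _)); lra.
(* Convergence for [dist] implies coordinatewise convergence, and coordinatewise the points [w k]
   tend to [z']. *)
have yz : y = z'.
  apply/funext => j; have [N hN] := yp j.
  have := (hw (maxn N j.+1)).2 => /(@mkseq_ext _ (i0 hd)) /(_ j).
  by rewrite hN ?leq_maxl // leq_maxr => ->.
have [N hN] := yl _ (radius_gt0 r); have {hN} := hN N (leqnn N); rewrite yz => h1.
have h2 := @near_w r 0 N (ltac:(lia)) (leq0n N).
have h3 : (dist (xs (nth 0 s r)) z < radius r)%R by apply: cs; rewrite ss.
have h4 := distD z (xs (nth 0 s r)) (w N); have h5 := distD z (w N) z'.
by move: h2 h4; rewrite /= (distC z (xs _)) => h2 h4; lra.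
Qed.

End Forcing.

(** * Branches with generic coordinates and prescribed commitments *)

Section Transversal.
Context {d : cardinal_le_omega} (hd : two_le d).
Notation I := (idx d).
Notation column := (I -> I).
Notation point := (I -> nat -> I).

(** Away from [tree] this has no meaning; on its body the two coordinates differ
    exactly where the diagonal column occurs. *)
Definition code (a : point) : nat -> nat :=
  fun l => if a (i0 hd) l == a (i1 hd) l then 0 else (label l).+1.

Definition codew (s : seq column) : seq nat :=
  mkseq (fun l => let c := nth (@idc d) s l in
    if c (i0 hd) == c (i1 hd) then 0 else (label l).+1) (size s).

Lemma codew_rcons s c : codew (rcons s c) =
  rcons (codew s) (if c (i0 hd) == c (i1 hd) then 0 else (label (size s)).+1).
Proof.
rewrite /codew size_rcons mkseqS nth_rcons ltnn eqxx; congr rcons.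
by apply/eq_in_map => l; rewrite mem_iota nth_rcons => /andP[_ ->].
Qed.

Lemma commits_csts s w : commits (codew (s ++ map (@cst d) w)) = commits (codew s).
Proof.
elim/last_ind: w => [|w e IH]; first by rewrite cats0.
by rewrite map_rcons -rcons_cat codew_rcons commits_rcons IH /cst eqxx.
Qed.

Lemma commits_pad s n : commits (codew (s ++ nseq n (@cst d (i0 hd)))) = commits (codew s).
Proof.
have -> : nseq n (@cst d (i0 hd)) = map (@cst d) (nseq n (i0 hd)) by rewrite map_nseq.
exact: commits_csts.
Qed.

Lemma commits_idc s :
  commits (codew (rcons s (@idc d))) = rcons (commits (codew s)) (label (size s)).
Proof.
rewrite codew_rcons commits_rcons /idc ifF //.
by apply/eqP; exact: i0_neq_i1.
Qed.

Lemma tree_commit s c : tree hd s -> exists t, [/\ tree hd (s ++ t), 0 < size t &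
  commits (codew (s ++ t)) = rcons (commits (codew s)) c].
Proof.
move=> Ts; have [l [sl lc hl]] := special_dense c Ts.
exists (rcons (nseq (l - size s) (@cst d (i0 hd))) (@idc d)).
have e : size (s ++ nseq (l - size s) (@cst d (i0 hd))) = l.
  by rewrite size_cat size_nseq subnKC.
rewrite size_rcons -rcons_cat; split=> //; last by rewrite commits_idc commits_pad e lc.
apply/tree_rcons; split; first exact: tree_pad.
by right; rewrite e hl.
Qed.

Lemma coord_node i s : tree hd s -> node hd (iv i) (coord i s).
Proof.
move=> Ts l il; rewrite size_map => ls; rewrite (nth_map (@idc d)) //.
have [[e [he ->]]|[-> _]] := Ts l ls; last exact: leq_ltn_trans il _.
by rewrite size_take ls in he.
Qed.

(** Constant columns can write any admissible word in coordinate [i], at no commitment. The [iv i]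
    columns added first reach the level from which [denseN] at [iv i] bounds the letters of that
    word. *)
Lemma tree_dense i s O : tree hd s -> denseN hd (iv i) O -> exists t,
  [/\ tree hd (s ++ t), commits (codew (s ++ t)) = commits (codew s) &
      exists n, n <= size (s ++ t) /\ O (take n (coord i (s ++ t)))].
Proof.
move=> Ts dO; pose s1 := s ++ nseq (iv i) (@cst d (i0 hd)).
have Ts1 : tree hd s1 by exact: tree_pad.
have [w [nw Ow]] := dO _ (coord_node (i := i) Ts1).
have e : coord i (s1 ++ map (@cst d) w) = coord i s1 ++ w.
  by rewrite /coord map_cat -map_comp map_id.
exists (nseq (iv i) (@cst d (i0 hd)) ++ map (@cst d) w); rewrite catA -/s1; split.
- apply: tree_csts => // k kw.
  have := nw (size s1 + k); rewrite nth_cat size_cat !size_map.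
  have -> : (size s1 + k < size s1) = false by lia.
  rewrite addKn ltn_add2l; apply=> //.
  by rewrite /s1 size_cat size_nseq; lia.
- by rewrite commits_csts commits_pad.
- exists (size (s1 ++ map (@cst d) w)); split=> //.
  by rewrite -(size_map (fun c : column => c i)) -/(coord i _) take_size e.
Qed.

Variable O : I -> nat -> seq I -> Prop.
Hypothesis dO : forall i m, denseN hd (iv i) (O i m).

Definition requirement n (s : seq column) :=
  if (unpickle n : option (nat * nat)) is Some (a, m)
  then let i := of_nat hd a in exists k, k <= size s /\ O i m (take k (coord i s))
  else True.

Lemma extension_ex (p : nat * nat * seq column) : exists s', tree hd p.2 ->
  [/\ tree hd s', exists t, s' = p.2 ++ t /\ 0 < size t, requirement p.1.1 s' &
    commits (codew s') =
      if p.1.2 is c.+1 then rcons (commits (codew p.2)) c else commits (codew p.2)].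
Proof.
case: p => -[n y] s /=; case: (pselect (tree hd s)) => [Ts|]; last by exists s.
have [t1 [T1 c1 r1]] : exists t, [/\ tree hd (s ++ t), commits (codew (s ++ t)) = commits (codew s) &
    requirement n (s ++ t)].
  rewrite /requirement; case: unpickle => [[a m]|]; last by exists [::]; rewrite cats0.
  exact: tree_dense.
have r2 t : requirement n ((s ++ t1) ++ t).
  move: r1; rewrite /requirement; case: unpickle => [[a m]|//] [k [hk Ok]].
  exists k; split; first by rewrite size_cat; lia.
  by rewrite /coord map_cat takel_cat // size_map.
case: y => [|c].
  exists ((s ++ t1) ++ nseq 1 (@cst d (i0 hd))) => _; split=> //; first exact: tree_pad.
    by exists (t1 ++ nseq 1 (@cst d (i0 hd))); rewrite catA; split=> //; rewrite size_cat addn1.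
  by rewrite commits_pad.
have [t2 [T2 l2 c2]] := tree_commit c T1.
exists ((s ++ t1) ++ t2) => _; split=> //; last by rewrite c2 c1.
by exists (t1 ++ t2); rewrite catA size_cat; split=> //; lia.
Qed.

Definition extension : nat * nat * seq column -> seq column :=
  projT1 (choice extension_ex).

Fixpoint branch (y : nat -> nat) n : seq column :=
  if n is n'.+1 then extension (n', y n', branch y n') else [::].

Lemma branchP y n : [/\ tree hd (branch y n),
  exists t, branch y n.+1 = branch y n ++ t /\ 0 < size t, requirement n (branch y n.+1) &
  commits (codew (branch y n)) = commits (mkseq y n)].
Proof.
have hE p := projT2 (choice extension_ex) p.
have T k : tree hd (branch y k).
  by elim: k => // k IH; have [] := hE (k, y k, branch y k) IH.
have C k : commits (codew (branch y k)) = commits (mkseq y k).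
  elim: k => // k IH; have [_ _ _ e] := hE (k, y k, branch y k) (T k).
  by rewrite mkseqS commits_rcons -IH; exact: e.
by split=> //; have [] := hE (n, y n, branch y n) (T n).
Qed.

Lemma size_branch y n : n <= size (branch y n).
Proof.
elim: n => // n IH; have [_ [t [-> ht]] _ _] := branchP y n.
by rewrite size_cat; lia.
Qed.

Definition transversal (y : nat -> nat) : point :=
  fun i l => word_limit (@idc d) (branch y) l i.

Lemma transversal_branch y n :
  mkseq (fun l i => transversal y i l) (size (branch y n)) = branch y n.
Proof.
apply: (@word_limitP _ (@idc d) (branch y)) => k; last exact: size_branch.
by have [_ [t [e _]] _ _] := branchP y k; exists t.
Qed.

Lemma transversal_tree y l : tree hd (mkseq (fun j i => transversal y i j) l).
Proof.
rewrite (mkseq_takeE _ (size_branch y l)) transversal_branch.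
by apply: tree_take; have [] := branchP y l.
Qed.

Lemma code_transversal y n :
  commits (mkseq (code (transversal y)) (size (branch y n))) = commits (mkseq y n).
Proof.
have [_ _ _ <-] := branchP y n; congr commits; apply/eq_in_map => l.
rewrite mem_iota /= add0n => ls; rewrite /code -{1 2}(transversal_branch y n).
by rewrite nth_mkseq.
Qed.

Lemma decodes_transversal y z : decodes y z -> decodes (code (transversal y)) z.
Proof.
by move=> h j; have [n hn] := h j; exists (size (branch y n)); rewrite code_transversal.
Qed.

Lemma coord_transversal y i n :
  mkseq (transversal y i) (size (branch y n)) = coord i (branch y n).
Proof. by rewrite -{2}(transversal_branch y n) /coord /mkseq -map_comp. Qed.

Lemma transversal_inZ y i : inZ (iv i) (transversal y i).
Proof.
move=> l il; have [T _ _ _] := branchP y l.+1.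
have sl := size_branch y l.+1.
have := coord_node (i := i) T il; rewrite size_map => /(_ sl).
by rewrite -coord_transversal nth_mkseq.
Qed.

Lemma transversal_generic y i m : meets (transversal y i) (O i m).
Proof.
have [_ _ + _] := branchP y (pickle (iv i, m)).
set b := branch y _.+1; rewrite /requirement pickleK /= ivK /b => -[k [hk]].
rewrite -coord_transversal -mkseq_takeE // => Ok.
by exists k.
Qed.

Lemma branch_agree y y' n : agree n y y' -> branch y n = branch y' n.
Proof.
elim: n => // n IH a /=; rewrite IH ?a //.
by apply: agree_le a.
Qed.

Lemma transversal_agree y y' n i : agree n y y' ->
  mkseq (transversal y i) n = mkseq (transversal y' i) n.
Proof.
move=> a; apply: (@mkseq_le _ _ _ n (size (branch y n))); first exact: size_branch.
by rewrite {2}(branch_agree a) !coord_transversal (branch_agree a).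
Qed.

End Transversal.

(** * The space of branches *)

Lemma continuous_into_prod (X : topologicalType) (I : Type) (K : I -> topologicalType)
    (f : X -> prod_topology K) :
  (forall i, continuous (fun x => f x i : K i)) -> continuous f.
Proof.
move=> h x; apply/cvg_sup => i U [V [[W oW <-] Wfi VU]].
by apply: filterS VU _; apply: (h i x W); apply: open_nbhs_nbhs.
Qed.

Lemma prod_coord_continuous (I : Type) (K : I -> topologicalType) i :
  continuous (fun f : prod_topology K => f i : K i).
Proof. exact: (@proj_continuous {classic I} K i). Qed.

Lemma continuous_into_discrete (X : topologicalType) (E : choiceType)
    (f : X -> discrete_topology E) :
  (forall x, \forall x' \near x, f x' = f x) -> continuous f.
Proof.
move=> h x V nV; have Vf := nbhs_singleton nV.
by apply: filterS (h x) => x' /= ->.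
Qed.

Lemma locally_constant_discrete (X : topologicalType) (E : choiceType)
    (f : X -> discrete_topology E) :
  continuous f -> forall x, \forall x' \near x, f x' = f x.
Proof. by move=> cf x; exact: (cf x _ (discrete_set1 (f x))). Qed.

Definition seq_space (E : choiceType) : topologicalType :=
  prod_topology (fun _ : nat => discrete_topology E).

Lemma near_prefix (E : choiceType) (x : seq_space E) n :
  nbhs x [set y | forall k, k < n -> y k = x k].
Proof.
elim: n => [|n IH]; first by apply: (@filterS _ (nbhs x) _ setT) => //; exact: filterT.
have cn : continuous (fun z : seq_space E => z n).
  exact: prod_coord_continuous.
have := locally_constant_discrete cn x; apply: filterS2 IH => y h1 h2 k.
by rewrite ltnS leq_eqVlt => /orP[/eqP ->|/h1].
Qed.

Lemma prefix_nbhs (E : choiceType) (x : seq_space E) U :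
  nbhs x U -> exists n, forall y, (forall k, k < n -> y k = x k) -> U y.
Proof.
move=> nU.
pose F := filter_from setT (fun n => [set y : seq_space E |
  forall k, k < n -> y k = x k]).
have FF : Filter F.
  apply: filter_from_filter; first by exists 0.
  move=> i j _ _; exists (maxn i j) => // y h; split=> k hk; apply: h; lia.
have Fx : F --> x.
  apply/cvg_sup => i V [W [[A oA <-] Ai WV]].
  exists i.+1 => // y hy; apply: WV; rewrite /= hy //.
by have [n _ hn] := Fx _ nU; exists n => y hy; apply: hn.
Qed.

Lemma continuousP_baire (X : topologicalType) (f : X -> baire) :
  continuous f <-> forall x j, \forall x' \near x, f x' j = f x j.
Proof.
split=> [cf x j|h]; last first.
  by apply: continuous_into_prod => j; apply: continuous_into_discrete => x; exact: h.
have cj : continuous (fun x => f x j : discrete_topology nat).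
  move=> y; apply: (@continuous_comp _ _ _ f (fun z : baire => z j)); first exact: cf.
  exact: prod_coord_continuous.
exact: locally_constant_discrete cj x.
Qed.

Lemma continuous_contf (g : baire -> baire) : continuous g <-> contf g.
Proof.
rewrite continuousP_baire; split=> h x j; last first.
  have [n hn] := h x j; apply: filterS (near_prefix x n) => y hy.
  by apply: hn => k kn; rewrite hy.
have [n hn] := prefix_nbhs (h x j); exists n => x' a; apply: hn => k kn.
by rewrite a.
Qed.

Lemma open_gborel (U : set baire) : open U -> gborel U.
Proof.
move=> oU.
pose F (k : nat) (z : nat -> nat) := if (unpickle k : option (seq nat)) is Some s then
  (forall y : nat -> nat, mkseq y (size s) = s -> U y) /\ mkseq z (size s) = s else False.
apply: (@gb_ext (fun z => exists k, F k z)).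
  move=> z; split=> [[k]|Uz].
    by rewrite /F; case: unpickle => // s [h /h].
  have [n hn] := prefix_nbhs (open_nbhs_nbhs (conj oU Uz)).
  exists (pickle (mkseq z n)); rewrite /F pickleK size_mkseq; split=> // y /agree_mkseq a.
  by apply: hn => k kn; rewrite a.
apply: gb_bigcup => k; rewrite /F; case: unpickle => [s|]; last by apply: (@gb_fin _ 0).
by apply: (@gb_fin _ (size s)) => z z' /agree_mkseq -> [h1 h2].
Qed.

Lemma borel_gborel (A : set baire) (f : baire -> baire) : borel A -> continuous f ->
  gborel (fun z => A (f z)).
Proof.
move=> bA cf; apply: (bA [set B : set baire | gborel (fun z => B (f z))]).
split; last by move=> U oU; apply: open_gborel; move/continuousP: cf; exact.
split=> [|B gB|F gF] /=.
- by apply: (@gb_fin _ 0).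
- by apply: gb_ext (gb_compl gB) => z; split=> [h|[_ h]].
- by apply: gb_ext (gb_bigcup gF) => z; split=> [[i ?]|[i _ ?]]; exists i.
Qed.

(** * Zero-dimensional Polish spaces given by finite approximations *)

Section ApproximatedSpace.
Context {X : topologicalType} {E : Type} (pr : nat -> X -> E).
Hypothesis prS : forall n x y, pr n.+1 x = pr n.+1 y -> pr n x = pr n y.
Hypothesis pr_sep : forall x y, (forall n, pr n x = pr n y) -> x = y.
Hypothesis pr_nbhs : forall x A, nbhs x A <-> exists n, [set y | pr n y = pr n x] `<=` A.
Hypothesis pr_complete : forall u : nat -> X,
  (forall n, exists N, forall m, N <= m -> pr n (u m) = pr n (u N)) ->
  exists x, forall n, exists N, forall m, N <= m -> pr n (u m) = pr n x.
Hypothesis pr_separable : exists e : nat -> X, forall n x, exists k, pr n (e k) = pr n x.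

Lemma pr_le m n x y : m <= n -> pr n x = pr n y -> pr m x = pr m y.
Proof.
elim: n => [|n IH]; first by rewrite leqn0 => /eqP ->.
by rewrite leq_eqVlt => /orP[/eqP ->//|mn /prS]; exact: IH.
Qed.

(** The ultrametric of the first difference. Confining its values to [0] and the radii makes it
    determined by the radii above it, from which symmetry and the triangle inequality follow. *)
Lemma pr_dist_ex x y : exists r : Rdefinitions.R, (0 <= r)%R /\
  (forall n, (r < radius n)%R <-> pr n x = pr n y) /\
  (r = 0%R \/ exists n, r = radius n).
Proof.
case: (pselect (forall n, pr n x = pr n y)) => [h|/existsNP[n0 hn0]].
  by exists 0%R; split=> //; split; [move=> n; split=> // _; exact: radius_gt0|left].
have [|m /asboolP hm mmin] := @ex_minnP (fun n => `[<pr n x <> pr n y>]).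
  by exists n0; apply/asboolP.
exists (radius m); split; first exact/ltW/radius_gt0.
split; last by right; exists m.
move=> n; rewrite /radius ltf_pV2 ?posrE ?ltr0n // ltr_nat ltnS; split=> [nm|e].
  by apply: contrapT => ne; have := mmin n (asboolT ne); lia.
by rewrite ltnNge; apply/negP => mn; apply: hm; exact: pr_le e.
Qed.

Let dist x y : Rdefinitions.R := projT1 (cid (pr_dist_ex x y)).

Lemma pr_distP n x y : (dist x y < radius n)%R <-> pr n x = pr n y.
Proof. by rewrite /dist; case: cid => r /= [_ [h _]]. Qed.

Lemma approximated_zd_polish : zd_polish X.
Proof.
have d0 x y : (0 <= dist x y)%R by rewrite /dist; case: cid => r /= [].
have dr x y : dist x y = 0%R \/ exists n, dist x y = radius n.
  by rewrite /dist; case: cid => r /= [_ []].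
have dle x y r : (forall n, (r < radius n)%R -> pr n x = pr n y) -> (0 <= r)%R ->
    (dist x y <= r)%R.
  move=> h r0; case: (dr x y) => [->//|[n e]]; rewrite leNgt; apply/negP.
  by rewrite {1}e => /h/pr_distP; rewrite -e ltxx.
have dx x : dist x x = 0%R.
  apply/eqP; rewrite eq_le d0 andbT; apply: dle => //.
split.
- have [e he] := pr_separable; exists (range e); first exact: sub_countable (card_image_le e setT) (countableP _).
  move=> U [x Ux] oU; have /pr_nbhs[n hn] := open_nbhs_nbhs (conj oU Ux).
  by have [k hk] := he n x; exists (e k); split; [exact: hn|exists k].
- exists dist; split.
  + split=> // [x y|x y|x y z].
    * split=> [e|->//]; apply: pr_sep => n; apply/pr_distP; rewrite e; exact: radius_gt0.
    * by apply/eqP; rewrite eq_le; apply/andP; split; apply: dle => // n /pr_distP.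
    * apply: dle; last by rewrite addr_ge0.
      move=> n h; transitivity (pr n y); apply/pr_distP; apply: le_lt_trans h.
        by rewrite lerDl.
      by rewrite lerDr.
  + move=> x A; rewrite pr_nbhs; split=> [[n hn]|[e e0 he]].
      exists (radius n); first exact: radius_gt0.
      by move=> y /= /pr_distP h; apply: hn.
    have [n hn] := radius_small e0; exists n => y /= h; apply: he => /=.
    by apply: lt_trans hn; apply/pr_distP.
  + move=> u cu; have [|x hx] := pr_complete (u := u).
      move=> n; have [N hN] := cu _ (radius_gt0 n); exists N => m Nm.
      by apply/pr_distP; apply: hN.
    exists x => A /pr_nbhs[n hn]; have [N hN] := hx n.
    by exists N => // m /= Nm; apply: hn; apply: hN.
- move=> x U /pr_nbhs[n hn]; exists [set y | pr n y = pr n x]; split=> //.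
  split.
    by rewrite openE => y /= hy; apply/pr_nbhs; exists n => z /= ->.
  rewrite -openC openE => y /= hy; apply/pr_nbhs; exists n => z /= ->.
  exact: hy.
Qed.

End ApproximatedSpace.

Section Body.
Context {d : cardinal_le_omega} (hd : two_le d).
Notation I := (idx d).
Notation column := (I -> I).
Notation T := (tree hd).
Notation bodyT := (set_type (body T)).

Definition column_at (a : dspace d) l : column := fun i => a i l.

Lemma body_column (a : dspace d) l : body T a ->
  (exists e, column_at a l = cst e) \/ column_at a l = @idc d.
Proof.
move=> /(_ l.+1); rewrite mkseqS => /tree_rcons[_].
by case=> [[e [_ h]]|[h _]]; [left; exists e|right].
Qed.

(** Two coordinates determine the whole column, so even for infinite [d], where product
    neighbourhoods restrict finitely many coordinates, the prefixes of columns form a basis of the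
    body. *)
Lemma body_column_eq (a b : dspace d) l : body T a -> body T b ->
  a (i0 hd) l = b (i0 hd) l -> a (i1 hd) l = b (i1 hd) l -> column_at a l = column_at b l.
Proof.
move=> ba bb; rewrite -[a _ l]/(column_at a l _) -[b _ l]/(column_at b l _).
rewrite -[a (i1 hd) l]/(column_at a l _) -[b (i1 hd) l]/(column_at b l _).
case: (body_column l ba) => [[e ->]|->]; case: (body_column l bb) => [[e' ->]|->] //.
- by rewrite /cst => ->.
- by rewrite /cst /idc => -> h; case: (i0_neq_i1 h).
- by rewrite /cst /idc => <- h; case: (@i0_neq_i1 d hd).
Qed.

Definition body_prefix n (x : bodyT) : seq column := mkseq (column_at (set_val x)) n.

Lemma set_val_continuous : continuous (set_val : bodyT -> dspace d).
Proof. exact: initial_continuous. Qed.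

Lemma body_nbhs (x : bodyT) A :
  nbhs x A <-> exists n, [set y | body_prefix n y = body_prefix n x] `<=` A.
Proof.
split=> [nA|[n hn]]; last first.
  have c i : continuous (fun y : bodyT => set_val y i : dseq d).
    move=> y; apply: (@continuous_comp _ _ _ (set_val : bodyT -> dspace d) (fun z : dspace d => z i)).
      exact: set_val_continuous.
    exact: prod_coord_continuous.
  have h i : nbhs x [set y : bodyT | forall k, k < n -> set_val y i k = set_val x i k].
    exact: (c i x _ (@near_prefix I (set_val x i) n)).
  apply: filterS (filterI (h (i0 hd)) (h (i1 hd))) => y [h0 h1]; apply: hn.
  apply/eq_in_map => l; rewrite mem_iota => /andP[_ ln].
  by apply: body_column_eq; [exact: set_valP..|exact: h0|exact: h1].
pose F := filter_from setT (fun n => [set y : bodyT | body_prefix n y = body_prefix n x]).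
have FF : Filter F.
  apply: filter_from_filter; first by exists 0.
  move=> i j _ _; exists (maxn i j) => // y h; split; apply: mkseq_le h; lia.
have Fx : (set_val @ F) --> (set_val x : dspace d).
  apply/cvg_sup => i V [W [[B oB <-] Bi WV]].
  have [n hn] := @prefix_nbhs I _ _ (open_nbhs_nbhs (conj oB Bi)).
  exists n => // y /(@mkseq_ext _ (@idc d)) hy; apply: WV; apply: hn => k kn.
  exact: (congr1 (fun c : column => c i) (hy k kn)).
move: nA => [B [[C oC <-] Cx BA]].
have [n _ hn] := Fx C (open_nbhs_nbhs (conj oC Cx)).
by exists n => y hy; apply: BA; exact: hn.
Qed.

Lemma body_ext (x y : bodyT) : (forall n, body_prefix n x = body_prefix n y) -> x = y.
Proof.
move=> h; apply: val_inj; apply/funext => i; apply/funext => l.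
have /(@mkseq_ext _ (@idc d))/(_ l (ltnSn l)) e := h l.+1.
exact: (congr1 (fun c : column => c i) e).
Qed.

Lemma body_zd_polish : zd_polish bodyT.
Proof.
apply: (@approximated_zd_polish _ _ body_prefix).
- by move=> n x y; apply: mkseq_le.
- exact: body_ext.
- exact: body_nbhs.
- move=> u /choice[N hN].
  pose z : dspace d := fun i l => set_val (u (N l.+1)) i l.
  have hz n : mkseq (column_at z) n = body_prefix n (u (N n)).
    apply/(@mkseq_ext _ (@idc d)) => l ln.
    have /(@mkseq_ext _ (@idc d))/(_ l (ltnSn l)) h1 := hN l.+1 _ (leq_maxl (N l.+1) (N n)).
    have /(@mkseq_ext _ (@idc d))/(_ l ln) h2 := hN n _ (leq_maxr (N l.+1) (N n)).
    by rewrite -h2 h1.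
  have bz : body T z.
    by move=> n; rewrite -[mkseq _ _]/(mkseq (column_at z) n) hz; exact: (set_valP (u (N n)) n).
  exists (SigSub (mem_set bz)) => n; exists (N n) => m hm.
  by rewrite hN // [RHS]hz.
- have [x0 _] : exists x : bodyT, True.
    have b0 : body T ((fun _ _ => i0 hd) : dspace d).
      move=> l; have -> : mkseq (fun (j : nat) (i : I) => i0 hd) l = [::] ++ nseq l (cst (i0 hd)).
        apply: (@eq_from_nth _ (@idc d)); rewrite size_mkseq /= ?size_nseq // => k kl.
        by rewrite nth_mkseq // nth_nseq kl.
      exact: tree_pad.
    by exists (SigSub (mem_set b0)).
  pose P (s : seq column) := [set x : bodyT | body_prefix (size s) x = s].
  exists (fun k => if (unpickle k : option (seq (option nat))) is Some w
     then xget x0 (P (map (letter hd) w)) else x0) => n x.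
  have [w hw] := tree_word (set_valP x n).
  exists (pickle w); rewrite pickleK.
  have e : body_prefix n x = map (letter hd) w by exact: hw.
  have Px : P (map (letter hd) w) x by rewrite /P /= -e size_mkseq.
  have := xgetPex x0 (ex_intro _ x Px); rewrite {1}/P /= -e size_mkseq.
  exact.
Qed.

Lemma code_continuous : continuous (code hd : dspace d -> baire).
Proof.
apply/continuousP_baire => a l.
have c i : continuous (fun z : dspace d => z i l : discrete_topology I).
  move=> z; apply: (@continuous_comp _ _ _ (fun z : dspace d => z i : dseq d)
     (fun z : dseq d => z l : discrete_topology I)).
    exact: prod_coord_continuous.
  exact: prod_coord_continuous.
have h i := locally_constant_discrete (c i) a.
by apply: filterS (filterI (h (i0 hd)) (h (i1 hd))) => b [e0 e1] /=; rewrite /code e0 e1.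
Qed.

End Body.

(** * Transversals continuous into finer topologies *)

Section PolishCoordinate.
Context {d : cardinal_le_omega} (hd : two_le d).
Notation I := (idx d).

Lemma generic_topology (m0 : nat) (t : topology (dseq d)) : finer t -> zd_polish (retop t) ->
  exists O : nat -> seq I -> Prop, (forall n, denseN hd m0 (O n)) /\
  forall z : nat -> I, inZ m0 z -> (forall n, meets z (O n)) ->
  forall V : set (retop t), nbhs (z : retop t) V ->
  exists l, forall z' : nat -> I, inZ m0 z' -> (forall n, meets z' (O n)) ->
    mkseq z l = mkseq z' l -> V z'.
Proof.
move=> ft [[D cD dD] [dist [[d0 deq dC dD3] dn dc]] _].
have z0 : dseq d := fun=> i0 hd.
have ball_nbhs (z : retop t) (e : Rdefinitions.R) : (0 < e)%R -> nbhs z [set y | (dist z y < e)%R].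
  by move=> e0; apply/dn; exists e.
have [xs hxs] : exists xs : nat -> retop t, forall x, D x -> exists j, xs j = x.
  move/countable_injP: cD => [f fI].
  exists (fun n => xget z0 [set x | D x /\ f x = n]) => x Dx; exists (f x).
  have [Dy e] : [set y | D y /\ f y = f x] (xget z0 [set y | D y /\ f y = f x]).
    by apply: xgetPex; exists x.
  by apply: fI => //; rewrite inE.
have xd (z : nat -> I) (e : Rdefinitions.R) : (0 < e)%R -> exists j, (dist (xs j) z < e)%R.
  move=> e0; have := ball_nbhs z e e0; rewrite nbhsE => -[U [oU Uz] UB].
  have [|x [Ux /hxs[j xj]]] := dD U _ oU; first by exists z.
  by exists j; rewrite xj dC; exact: UB.
have dc' (u : nat -> nat -> I) : (forall e : Rdefinitions.R, (0 < e)%R -> exists N, forall m n,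
    N <= m -> N <= n -> (dist (u m) (u n) < e)%R) ->
    exists z, (forall e : Rdefinitions.R, (0 < e)%R -> exists N, forall n, N <= n -> (dist (u n) z < e)%R) /\
    forall j, exists N, forall n, N <= n -> u n j = z j.
  move=> /dc[z uz]; exists z; split=> [e e0|j].
    have [N _ hN] := uz _ (ball_nbhs z e e0).
    by exists N => n Nn; rewrite dC; exact: hN.
  have oj : open [set y : dseq d | y j = z j].
    have cj : continuous (fun y : dseq d => y j : discrete_topology I) by exact: prod_coord_continuous.
    move/continuousP: cj => /(_ [set z j]); apply; exact: discrete_open.
  have nj : nbhs (z : retop t) [set y | y j = z j].
    by apply: open_nbhs_nbhs; split=> //; exact: ft.
  by have [N _ hN] := uz _ nj; exists N => n Nn; exact: hN.
have [Os [h1 h2]] := @generic_ex d hd m0 dist xs xd.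
exists Os; split=> // z Zz mz V /dn[e e0 eV].
have [gz _] := h2 z Zz mz.
have [l hl] := generic_continuous dC dD3 xd dc' e0 Zz gz.
exists l => z' Zz' mz' ez; apply: eV => /=; apply: hl => //.
by have [] := h2 z' Zz' mz'.
Qed.

(** The third clause serves the game argument, where the codes decode. The fourth also covers codes
    with finitely many commitments, which occur for Sigma^0_1 and Sigma^0_2. *)
Lemma transversal_ex (t : forall i : I, topology (dseq d)) :
  (forall i, finer (t i) /\ zd_polish (retop (t i))) ->
  exists k : (nat -> nat) -> dspace d,
  [/\ continuous (k : baire -> prod_topology (fun i => retop (t i))),
      forall y, body (tree hd) (k y),
      forall y z, decodes y z -> decodes (code hd (k y)) z &
      forall y n, exists2 m, n <= m &
        commits (mkseq (code hd (k y)) m) = commits (mkseq y n)].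
Proof.
move=> ht.
have /choice[Os hO] := fun i => generic_topology (iv i) (ht i).1 (ht i).2.
have dO i m : denseN hd (iv i) (Os i m) by exact: (hO i).1.
exists (fun y => transversal dO y); split.
- apply: continuous_into_prod => i y V nV.
  have Zy y' := @transversal_inZ d hd Os dO y' i.
  have gy y' m := @transversal_generic d hd Os dO y' i m.
  have [l hl] := (hO i).2 _ (Zy y) (gy y) V nV.
  apply: filterS (@near_prefix nat y l) => y' hy; apply: hl => //.
  by apply: transversal_agree => k kl; rewrite hy.
- by move=> y l; exact: transversal_tree.
- by move=> y z; exact: decodes_transversal.
- by move=> y n; exists (size (branch dO y n)); [exact: size_branch|exact: code_transversal].
Qed.

End PolishCoordinate.

(** * Wadge classes *)

Definition inseparable_pair (d : cardinal_le_omega) (T : set (seq (idx d -> idx d)))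
    (G : pointclass) : Prop :=
  exists S0 S1 : set (dspace d),
  [/\ class_on G (body T) S0, class_on G (body T) S1, S0 `&` S1 = set0 &
      ~ separable_by (pot (X := fun _ : idx d => dseq d) (Delta G)) S0 S1].

Section WadgeClasses.
Context {d : cardinal_le_omega} (hd : two_le d).
Notation T := (tree hd).
Implicit Types (A B D : set baire) (G L : pointclass).

Definition coded (A : set baire) (h : baire -> baire) : set (dspace d) :=
  [set a | body T a /\ A (h (code hd a))].

Lemma coded_class G A0 A h f : (forall (X : topologicalType) (B : set X),
    G X B <-> zd_polish X /\ exists g : X -> baire, continuous g /\ B = g @^-1` A0) ->
  continuous f -> A = f @^-1` A0 -> continuous h -> class_on G (body T) (coded A h).
Proof.
move=> hG cf -> ch; split; first by move=> a [].
apply/hG; split; first exact: body_zd_polish.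
exists (fun x => f (h (code hd (set_val x)))); split.
  move=> x; apply: (@continuous_comp _ _ _ (fun x : set_type (body T) => h (code hd (set_val x))) f).
    apply: (@continuous_comp _ _ _ (fun x : set_type (body T) => code hd (set_val x) : baire) h).
      apply: (@continuous_comp _ _ _ (set_val : set_type (body T) -> dspace d) (code hd : _ -> baire)).
        exact: set_val_continuous.
      exact: code_continuous.
    exact: ch.
  exact: cf.
by apply/seteqP; split=> [x []//|x h0]; split=> //; exact: set_valP.
Qed.

Lemma coded_not_separable L A B D h :
  (forall (X : topologicalType) (P : set X), L X P ->
     exists f : X -> baire, continuous f /\ P = f @^-1` D) ->
  (forall e y, decodes e y -> ~ ((A (h e) -> D y) /\ (B (h e) -> ~ D y))) ->
  ~ separable_by (pot (X := fun _ : idx d => dseq d) L) (coded A h) (coded B h).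
Proof.
move=> hL hh [P [[_ [t [ht /hL[f [cf eP]]]]] AP PB]].
have [k [ck bk dk _]] := transversal_ex hd ht.
have /continuous_contf/decodes_fixpoint[y dy] : continuous (f \o k : baire -> baire).
  by move=> y; apply: continuous_comp; [exact: ck|exact: cf].
apply: (hh _ _ (dk _ _ dy)); split=> [Ah|Bh].
  have : P (k y) by apply: AP; split=> //; exact: bk.
  by rewrite eP.
move=> Dy; have : (P `&` coded B h) (k y).
  by split; [rewrite eP|split=> //; exact: bk].
by rewrite PB.
Qed.

Lemma wadge_not_pot G : wadge_class G -> ~ self_dual G -> exists S : set (dspace d),
  class_on G (body T) S /\
  ~ separable_by (pot (X := fun _ : idx d => dseq d) (dual G)) S (body T `\` S).
Proof.
move=> [A0 [bA hG]] nsd.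
have gA : gborel A0 by apply: (@borel_gborel A0 id) => // x.
case: (wadge_game gA (gb_compl gA) (gb_compl gA)) => [[g [cg hg]]|[h [ch hh]]].
  (* A win of the second player reduces [A0] to its complement. *)
  exfalso; apply: nsd.
  have {}cg : continuous (g : baire -> baire) by apply/continuous_contf.
  have e x : A0 (g x) <-> ~ A0 x.
    have [h1 h2] := hg x; split=> [Ag /h1//|/h2]; exact: contrapT.
  have sub (X : topologicalType) (A : set X) : G X A -> G X (~` A).
    move=> /hG[zX [f [cf ->]]]; apply/hG; split=> //; exists (g \o f); split.
      by move=> x; apply: continuous_comp; [exact: cf|exact: cg].
    by apply/seteqP; split=> x /=; rewrite e.
  by move=> X A; split=> [/sub//|/sub]; rewrite setCK.
exists (coded A0 h); split.
  apply: coded_class hG _ _ _ => [|//|]; last exact/continuous_contf.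
  by move=> x.
have -> : body T `\` coded A0 h = coded (~` A0) h.
  apply/seteqP; split=> [a [ba na]|a [ba na]]; split=> //.
    by move=> Aa; apply: na.
  by move=> [].
apply: (coded_not_separable (D := ~` A0)) hh => X P /hG[_ [f [cf eP]]].
by exists f; split=> //; rewrite -[P]setCK eP.
Qed.

Lemma wadge_pair_not_pot G A B : wadge_class G -> wadge_class (Delta G) ->
  G baire A -> G baire B -> A `&` B = set0 -> ~ separable_by (@Delta G baire) A B ->
  inseparable_pair T G.
Proof.
move=> [A0 [bA hG]] [A1 [bA1 hD]] GA GB AB nsep.
have [zb [fA [cA eA]]] : zd_polish baire /\ _ := (hG _ _).1 GA.
have [_ [fB [cB eB]]] : zd_polish baire /\ _ := (hG _ _).1 GB.
have gA : gborel A by rewrite eA; exact: borel_gborel.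
have gB : gborel B by rewrite eB; exact: borel_gborel.
have gD : gborel A1 by apply: (@borel_gborel A1 id) => // x.
case: (wadge_game gA gB gD) => [[g [cg hg]]|[h [ch hh]]].
  exfalso; apply: nsep; exists ((g : baire -> baire) @^-1` A1); split.
  - apply/hD; split=> //; exists g; split=> //; exact/continuous_contf.
  - by move=> x /(hg x).1.
  - by apply/seteqP; split=> // x [h1 /(hg x).2].
have {}ch : continuous (h : baire -> baire) by apply/continuous_contf.
exists (coded A h), (coded B h); split.
- exact: coded_class hG cA eA ch.
- exact: coded_class hG cB eB ch.
- apply/seteqP; split=> // a [[_ Aa] [_ Ba]].
  by have : (A `&` B) (h (code hd a)) by []; rewrite AB.
by apply: (coded_not_separable (D := A1)) hh => X P /hD[_ [f [cf eP]]]; exists f.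
Qed.

End WadgeClasses.

(** * The classes Sigma^0_xi *)

Section Sigma0Classes.
Context {W : Type} (lt : W -> W -> Prop).

Definition minimal w := forall v, ~ lt v w.

Lemma Sigma0_inv (X : topologicalType) w (A : set X) : Sigma0 lt w A ->
  (minimal w /\ open A) \/ exists (v : nat -> W) (F : nat -> set X),
    [/\ forall n, lt (v n) w, forall n, Sigma0 lt (v n) (~` F n) & A = \bigcup_n F n].
Proof. by case=> [{}w U h1 h2|{}w v F h1 h2]; [left|right; exists v, F]. Qed.

Lemma Sigma0_minimal (X : topologicalType) w (A : set X) :
  minimal w -> Sigma0 lt w A -> open A.
Proof. by move=> mw /Sigma0_inv[[]//|[v [F [/(_ 0)/mw]]]]. Qed.

Lemma Sigma0_preimage (X Y : topologicalType) (f : X -> Y) w (A : set Y) :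
  continuous f -> Sigma0 lt w A -> Sigma0 lt w (f @^-1` A).
Proof.
move=> cf; elim=> [{}w U mw oU|{}w v F lv _ IH].
  by apply: Sigma0_open => //; move/continuousP: cf; exact.
by rewrite preimage_bigcup; apply: (Sigma0_bigcup lv).
Qed.

Hypothesis wo : well_order lt.

Lemma minimal_below w v : lt v w -> exists2 u, minimal u & lt u w.
Proof.
case: wo => wf tr _; elim/(well_founded_ind wf): v => v IH vw.
case: (pselect (exists u, lt u v)) => [[u uv]|nu]; first by apply: (IH u) => //; exact: tr vw.
by exists v => // u uv; apply: nu; exists u.
Qed.

Lemma Sigma0_bigcup_closed (X : topologicalType) w v (F : nat -> set X) : lt v w ->
  (forall n, open (~` F n)) -> Sigma0 lt w (\bigcup_n F n).
Proof.
move=> /minimal_below[u mu uw] oF; apply: (@Sigma0_bigcup _ _ _ w (fun=> u)) => // n.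
exact: Sigma0_open.
Qed.

Lemma open_prefix (Q : set baire) :
  (forall e, Q e -> exists n, forall e', agree n e e' -> Q e') -> open Q.
Proof.
move=> h; rewrite openE => e /h[n hn]; apply: filterS (@near_prefix nat e n) => e' he.
by apply: hn => k kn; rewrite he.
Qed.

Lemma open_agree (U : set baire) e : open U -> U e ->
  exists n, forall e', agree n e e' -> U e'.
Proof.
move=> oU Ue; have [n hn] := @prefix_nbhs nat _ _ (open_nbhs_nbhs (conj oU Ue)).
by exists n => e' a; apply: hn => k kn; rewrite a.
Qed.

(** Only the least level needs an argument: there the open set is rewritten as a countable union of
    closed sets. *)
Lemma Sigma0_mono w v (A : set baire) : lt v w -> Sigma0 lt v A -> Sigma0 lt w A.
Proof.
move=> vw /Sigma0_inv[[mv oA]|[u [F [uv hF ->]]]]; last first.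
  by case: wo => _ tr _; apply: (@Sigma0_bigcup _ _ _ _ u) => // n; exact: tr vw.
have -> : A = \bigcup_n [set e : baire | forall e', agree n e e' -> A e'].
  apply/seteqP; split=> [e /(open_agree oA)[n hn]|e [n _ h]]; first by exists n.
  exact: h.
apply: (Sigma0_bigcup_closed vw) => n; apply: open_prefix => e /= h.
exists n => e' a h'; apply: h => e2 a2; apply: h' => k kn.
by rewrite -a // a2.
Qed.

Lemma Sigma0_setU (X : topologicalType) w (A B : set X) :
  Sigma0 lt w A -> Sigma0 lt w B -> Sigma0 lt w (A `|` B).
Proof.
move=> /Sigma0_inv[[mw oA]|[v [F [vw hF ->]]]] /Sigma0_inv[[mw' oB]|[v' [F' [vw' hF' ->]]]].
- by apply: Sigma0_open => //; exact: openU.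
- by case: (mw _ (vw' 0)).
- by case: (mw' _ (vw 0)).
have -> : (\bigcup_n F n) `|` (\bigcup_n F' n) =
    \bigcup_n (if odd n then F n./2 else F' n./2).
  apply/seteqP; split=> [e [[n _ Fn]|[n _ Fn]]|e [n _]].
  - by exists n.*2.+1 => //=; rewrite odd_double /= uphalf_double.
  - by exists n.*2 => //=; rewrite odd_double doubleK.
  - by case: odd => Fn; [left|right]; exists n./2.
apply: (@Sigma0_bigcup _ _ _ _ (fun n => if odd n then v n./2 else v' n./2)) => n;
  by case: odd.
Qed.

Section NotSeparable.
Context {d : cardinal_le_omega} (hd : two_le d).
Notation T := (tree hd).
Variables (G : pointclass) (w : W).
Hypothesis eG : class_eq G (Sigma0_class lt w).

(** The code of the transversal of [y] makes the commitments of [y] at later times. Sets preserved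
    by such delays contain it whenever they contain [y], so a potential separating set pulls back to
    a separating set in the Baire space. *)
Lemma Sigma0_not_pot (C0 C1 : set baire) :
  Sigma0 lt w C0 -> Sigma0 lt w C1 -> C0 `&` C1 = set0 ->
  (forall e y, (forall n, exists2 m, n <= m & commits (mkseq e m) = commits (mkseq y n)) ->
     (C0 y -> C0 e) /\ (C1 y -> C1 e)) ->
  (forall P : set baire, Sigma0 lt w P -> Sigma0 lt w (~` P) ->
     C0 `<=` P -> P `&` C1 = set0 -> False) ->
  inseparable_pair T G.
Proof.
move=> s0 s1 C01 inv nsep.
have cls C : Sigma0 lt w C -> class_on G (body T) (coded hd C id).
  move=> sC; split=> [a []//|]; apply/eG; split; first exact: body_zd_polish.
  have -> : set_val @^-1` coded hd C id =
      (fun x : set_type (body T) => code hd (set_val x) : baire) @^-1` C.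
    by apply/seteqP; split=> [x []//|x h0]; split=> //; exact: set_valP.
  apply: Sigma0_preimage => // x.
  apply: (@continuous_comp _ _ _ (set_val : set_type (body T) -> dspace d) (code hd : _ -> baire)).
    exact: set_val_continuous.
  exact: code_continuous.
exists (coded hd C0 id), (coded hd C1 id); split; [exact: cls..| |].
  apply/seteqP; split=> // a [[_ h0] [_ h1]].
  by have : (C0 `&` C1) (code hd a) by []; rewrite C01.
move=> [P [[_ [t [ht [/eG[_ sP] /eG[_ sPC]]]]] AP PB]].
have [k [ck bk _ hk]] := transversal_ex hd ht.
apply: (nsep (k @^-1` P)).
- exact: (Sigma0_preimage ck).
- exact: (Sigma0_preimage ck sPC).
- by move=> y C0y; apply: AP; split; [exact: bk|exact: (inv _ _ (hk y)).1].
apply/seteqP; split=> // y [Py C1y].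
have : (P `&` coded hd C1 id) (k y).
  by split=> //; split; [exact: bk|exact: (inv _ _ (hk y)).2].
by rewrite PB.
Qed.

(** The code that always passes is a limit of both sets, so no clopen set separates them. *)
Lemma Sigma0_one_not_pot : minimal w -> inseparable_pair T G.
Proof.
move=> mw.
pose C c : set baire := [set e | exists n, ohead (commits (mkseq e n)) = Some c].
have oC c : Sigma0 lt w (C c).
  apply: Sigma0_open => //; apply: open_prefix => e [n hn]; exists n => e' /agree_mkseq a.
  by exists n; rewrite -a.
have hC c e y : (forall n, exists2 m, n <= m & commits (mkseq e m) = commits (mkseq y n)) ->
    C c y -> C c e.
  by move=> h [n hn]; have [m _ e1] := h n; exists m; rewrite e1.
have inC c n : C c ((fun k => if k == n then c.+1 else 0) : baire).
  exists n.+1; rewrite mkseqS commits_rcons eqxx.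
  have -> : commits (mkseq (fun k => if k == n then c.+1 else 0) n) = [::].
    have : forall m, m <= n -> commits (mkseq (fun k => if k == n then c.+1 else 0) m) = [::].
      elim=> // m IH mn; rewrite mkseqS commits_rcons IH ?(ltnW mn) //.
      by rewrite (ltn_eqF mn).
    exact.
  by [].
have agz c n : agree n (fun=> 0) (fun k => if k == n then c.+1 else 0).
  by move=> k kn; rewrite (ltn_eqF kn).
apply: (@Sigma0_not_pot (C 0) (C 1)) => //.
- have up e k K c : k <= K -> ohead (commits (mkseq e k)) = Some c ->
      ohead (commits (mkseq e K)) = Some c.
    by move=> /(commits_prefix e)[t ->]; case: (commits _).
  apply/seteqP; split=> // e [[m /(up _ _ _ _ (leq_maxl m _)) hm] [n hn]].
  by have := up _ _ _ _ (leq_maxr m n) hn; rewrite hm.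
- by move=> e y h; split; apply: hC.
move=> P /(Sigma0_minimal mw) oP /(Sigma0_minimal mw) oPC C0P PC1.
case: (pselect (P (fun=> 0))) => [P0|nP0].
  have [n hn] := open_agree oP P0.
  have : (P `&` C 1) (fun k => if k == n then 2 else 0).
    by split; [apply: hn; exact: agz|exact: inC].
  by rewrite PC1.
have [n hn] := open_agree oPC nP0.
by apply: (hn _ (agz 0 n)); apply: C0P; exact: inC.
Qed.

Lemma Sigma0_two_not_pot v0 : lt v0 w -> (forall v, lt v w -> minimal v) ->
  inseparable_pair T G.
Proof.
move=> v0w hw.
pose F b n : set baire := [set e | (forall m, n <= m ->
  commits (mkseq e m) = commits (mkseq e n)) /\ odd (size (commits (mkseq e n))) = b].
pose C b := \bigcup_n F b n.
have sC b : Sigma0 lt w (C b).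
  apply: (Sigma0_bigcup_closed v0w) => n; apply: open_prefix => e nF.
  case: (pselect (odd (size (commits (mkseq e n))) = b)) => hb; last first.
    by exists n => e' /agree_mkseq a [_]; rewrite -a.
  have [m [nm hm]] : exists m, n <= m /\ commits (mkseq e m) <> commits (mkseq e n).
    apply: contrapT => h; apply: nF; split=> // m nm; apply: contrapT => hm.
    by apply: h; exists m.
  exists m => e' /[dup] /agree_mkseq am /(agree_le nm)/agree_mkseq an [h _].
  by apply: hm; rewrite am an; exact: h.
have hC b e y : (forall n, exists2 m, n <= m & commits (mkseq e m) = commits (mkseq y n)) ->
    C b y -> C b e.
  move=> h [n _ [st par_]]; have [m nm em] := h n; exists m => //; split; last by rewrite em.
  move=> m' mm'; have [m2 h2 e2] := h (maxn n m').
  rewrite (st _ (leq_maxl n m')) -em in e2.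
  have [t1 h1] := commits_prefix e mm'.
  have [|t2 h3] := @commits_prefix e m' m2; first by lia.
  move: (congr1 size e2); rewrite h3 h1 !size_cat => hs.
  by have /size0nil -> : size t1 = 0; [lia|rewrite cats0].
have inC b (s : seq nat) : exists y : nat -> nat, mkseq y (size s) = s /\ C b y.
  have ext (r : seq nat) : odd (size (commits r)) = b -> C b (nth 0 r : nat -> nat).
    move=> hr; have er : mkseq (nth 0 r) (size r) = r by exact: mkseq_nth.
    exists (size r) => //; split; last by rewrite er.
    move=> m rm; rewrite -(subnKC rm) mkseq_add er /commits pmap_cat -[RHS]cats0; congr cat.
    by elim: (m - size r) => // k IH; rewrite -/(commits _) mkseqS commits_rcons nth_default ?leq_addr.
  case: (eqVneq (odd (size (commits s))) b) => hb.
    by exists (nth 0 s); split; [exact: mkseq_nth|exact: ext].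
  (* The extra entry [1] commits to the value [0] and so changes the parity; the default [0] of
     [nth] continues with passes. *)
  exists (nth 0 (rcons s 1)); split.
    rewrite -[RHS](mkseq_nth 0); apply/agree_mkseq => k ks; by rewrite nth_rcons ks.
  apply: ext; rewrite commits_rcons size_rcons /=.
  by move: hb; case: odd; case: (b).
apply: (@Sigma0_not_pot (C false) (C true)) => //.
- apply/seteqP; split=> // e [[m _ [hm om]] [n _ [hn on_]]].
  move: om on_; rewrite -(hm _ (leq_maxl m n)) -(hn _ (leq_maxr m n)).
  by move=> ->.
- by move=> e y h; split; apply: hC.
move=> P sP sPC C0P PC1.
have closedF (Q : set baire) : Sigma0 lt w Q ->
    exists H : nat -> set baire, (forall n, open (~` H n)) /\ Q = \bigcup_n H n.
  move=> /Sigma0_inv[[mw _]|[v [H [vw sH ->]]]]; first by case: (mw _ v0w).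
  by exists H; split=> // n; apply: Sigma0_minimal (sH n); exact: hw.
have [H [oH eP]] := closedF _ sP; have [H' [oH' ePC]] := closedF _ sPC.
have avoid (K : set baire) s y : open (~` K) -> mkseq y (size s) = s -> ~ K y ->
    exists t, forall z, mkseq z (size (s ++ t)) = s ++ t -> ~ K z.
  move=> oK ys nK; have [m hm] := open_agree oK nK.
  exists (mkseq (fun k => y (size s + k)) m) => z.
  have -> : s ++ mkseq (fun k => y (size s + k)) m = mkseq y (size s + m).
    by rewrite mkseq_add ys.
  rewrite size_mkseq => /agree_mkseq/agree_sym a.
  by apply: hm; apply: agree_le a; exact: leq_addl.
(* A Baire category argument: [C true] and [C false] are dense, each closed [H n] misses the former
   and each closed [H' n] the latter, so every word has an extension avoiding both. *)
have /choice[f hf] : forall p : nat * seq nat, exists t, forall z : nat -> nat,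
    mkseq z (size (p.2 ++ t)) = p.2 ++ t -> ~ H p.1 z /\ ~ H' p.1 z.
  move=> [n s] /=; have [y [ys Cy]] := inC true s.
  have [|t1 ht1] := @avoid (H n) s y (oH n) ys.
    move=> Hy; have : (P `&` C true) y by split=> //; rewrite eP; exists n.
    by rewrite PC1.
  have [y' [ys' Cy']] := inC false (s ++ t1).
  have [|t2 ht2] := @avoid (H' n) (s ++ t1) y' (oH' n) ys'.
    move=> Hy; have : (~` P) y' by rewrite ePC; exists n.
    by apply; exact: C0P.
  exists (t1 ++ t2) => z; rewrite catA => hz; split; last exact: ht2.
  exact/ht1/(mkseq_prefix hz).
(* The final [0] makes the words grow even if the extensions are empty. *)
pose u := fix u n := if n is n'.+1 then (u n' ++ f (n', u n')) ++ [:: 0] else [::].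
have us n : n <= size (u n).
  elim: n => // n IH; rewrite [u _]/= !size_cat addn1; lia.
have lim := @word_limitP _ 0 u _ us; set y := word_limit 0 u in lim.
have {}lim n : mkseq y (size (u n)) = u n.
  by apply: lim => k; exists (f (k, u k) ++ [:: 0]); rewrite /= catA.
have ny n : ~ H n y /\ ~ H' n y.
  by apply: (hf (n, u n)); exact: mkseq_prefix (lim n.+1).
case: (pselect (P y)) => [|Py]; first by rewrite eP => -[n _ Hn]; case: (ny n).
have : (~` P) y by [].
by rewrite ePC => -[n _ Hn]; case: (ny n).
Qed.

(** Only codes that decode matter, and on these complements and unions commute with decoding. For
    open [U] the condition is that some finite stage of commitments already forces the decoded point
    into [U]. *)
Lemma Sigma0_decodes v (A : set baire) : Sigma0 lt v A -> exists A' : set baire,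
  Sigma0 lt v A' /\ forall e y, decodes e y -> A' e <-> A y.
Proof.
elim=> [{}v U mv oU|{}v u F uv _ IH].
  exists [set e | exists n, forall y : nat -> nat,
    (forall j, j < size (commits (mkseq e n)) -> y j = nth 0 (commits (mkseq e n)) j) -> U y].
  split.
    apply: Sigma0_open => //; apply: open_prefix => e [n hn]; exists n => e' /agree_mkseq a.
    by exists n; rewrite -a.
  move=> e y dy; split=> [[n]|Uy].
    by apply=> j hj; rewrite (decodes_nth dy).
  have [n hn] := open_agree oU Uy.
  have [m hm] : exists m, n <= size (commits (mkseq e m)).
    by case: (n) => [|n']; [exists 0|exact: (decodes_good dy)].
  exists m => z hz; apply: hn => k kn; rewrite hz ?(decodes_nth dy) //; lia.
have /choice[E hE] := IH.
exists (\bigcup_n ~` E n); split.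
  by apply: (Sigma0_bigcup uv) => n; rewrite setCK; exact: (hE n).1.
move=> e y dy; split=> -[n _ Fn]; exists n => //.
  by apply: contrapT => nF; apply: Fn; apply/((hE n).2 e y dy).
by move=> /((hE n).2 e y dy).
Qed.

Lemma Sigma0_three_not_pot u v A B : lt u v -> lt v w ->
  @G baire A -> @G baire B -> A `&` B = set0 -> ~ separable_by (@Delta G baire) A B ->
  inseparable_pair T G.
Proof.
move=> uv vw /eG[zb sA] /eG[_ sB] AB nsep.
pose C (Q : set baire) : set baire := [set e | exists y, decodes e y /\ Q y].
have sgood : Sigma0 lt v (~` (good : set baire)).
  have -> : ~` (good : set baire) =
      \bigcup_j [set e : baire | forall n, size (commits (mkseq e n)) <= j].
    apply/seteqP; split=> [e /existsNP[j hj]|e [j _ h] /(_ j)[n]]; last by rewrite ltnNge h.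
    by exists j => // n; rewrite leqNgt; apply/negP => hn; apply: hj; exists n.
  apply: (Sigma0_bigcup_closed uv) => j; apply: open_prefix => e /existsNP[n hn].
  by exists n => e' /agree_mkseq a h; apply: hn; rewrite a.
have sC Q : Sigma0 lt w Q -> Sigma0 lt w (C Q).
  move=> /Sigma0_decodes[Q' [sQ' hQ']].
  have eC : C Q = Q' `&` (good : set baire).
    apply/seteqP; split=> [e [y [dy Qy]]|e [Qe /good_decodes[y dy]]].
      by split; [apply/(hQ' _ _ dy)|exact: decodes_good dy].
    by exists y; split=> //; apply/(hQ' _ _ dy).
  have [[mw _]|[x [F [xw sF eQ]]]] := Sigma0_inv sQ'; first by case: (mw _ vw).
  rewrite eC eQ setI_bigcupl.
  have [_ _ tot] := wo.
  (* The complement of [good] has level [v], so the larger of [v] and [x n] bounds both parts and is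
     still below [w]. *)
  have /choice[z hz] : forall n, exists z, lt z w /\ Sigma0 lt z (~` (F n `&` (good : set baire))).
    move=> n; rewrite setCI; case: (tot (x n) v) => [xv|xv|vx].
    - exists v; split=> //; apply: Sigma0_setU => //; exact: Sigma0_mono xv _.
    - by exists v; split=> //; apply: Sigma0_setU => //; rewrite -xv.
    - exists (x n); split=> //; apply: Sigma0_setU => //; exact: Sigma0_mono vx _.
  by apply: (@Sigma0_bigcup _ _ _ w z) => n; case: (hz n).
apply: (@Sigma0_not_pot (C A) (C B)); [exact: sC..| | |].
- apply/seteqP; split=> // e [[y [dy Ay]] [y' [dy' By]]].
  by have : (A `&` B) y; [split=> //; rewrite (decodes_fun dy dy')|rewrite AB].
- have hd_ e y z : (forall n, exists2 m, n <= m & commits (mkseq e m) = commits (mkseq y n)) ->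
      decodes y z -> decodes e z.
    by move=> h dy j; have [n hn] := dy j; have [m _ em] := h n; exists m; rewrite em.
  by move=> e y h; split=> -[z [dz Qz]]; exists z; split=> //; exact: hd_ dz.
move=> P sP sPC AP PB; apply: nsep.
(* The code of [y] without passes: it carries a separation of the coded sets back to [A] and [B]. *)
pose s (y : baire) : baire := fun n => (y n).+1.
have cs : continuous s.
  by apply/continuous_contf => x j; exists j.+1 => x' a; rewrite /s a.
have ds y : decodes (s y) y.
  have e n : commits (mkseq (s y) n) = mkseq y n.
    by elim: n => // n IH; rewrite !mkseqS commits_rcons IH.
  by move=> j; exists j.+1; rewrite e size_mkseq nth_mkseq.
exists (s @^-1` P); split.
- by split; apply/eG; split=> //; [exact: (Sigma0_preimage cs)|exact: (Sigma0_preimage cs sPC)].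
- by move=> y Ay; apply: AP; exists y.
- apply/seteqP; split=> // y [Py By]; have : (P `&` C B) (s y) by split=> //; exists y.
  by rewrite PB.
Qed.

End NotSeparable.
End Sigma0Classes.

Theorem theorem1p7 (d : cardinal_le_omega) (hd : two_le d) :
  exists T : set (seq (idx d -> idx d)),
  [/\ is_tree T, suitable_levels T &
  forall G : pointclass, wadge_class G -> ~ self_dual G ->
    (exists S : set (dspace d),
       class_on G (body T) S /\
       ~ separable_by (pot (X := fun _ : idx d => dseq d) (dual G))
           S (body T `\` S)) /\
    (~ separation_property G ->
     is_Sigma0_class G \/ wadge_class (Delta G) ->
     exists S0 S1 : set (dspace d),
       [/\ class_on G (body T) S0, class_on G (body T) S1,
           S0 `&` S1 = set0 &
           ~ separable_by (pot (X := fun _ : idx d => dseq d) (Delta G))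
               S0 S1])].
Proof.
exists (tree hd); split; [exact: tree_cat|exact: tree_suitable|].
move=> G wG nsd; split; first exact: wadge_not_pot.
move=> nsep.
have [A [B [GA GB AB nAB]]] : exists A B, [/\ G baire A, G baire B, A `&` B = set0 &
    ~ separable_by (@Delta G baire) A B].
  apply: contrapT => h; apply: nsep => A B GA GB AB.
  by apply: contrapT => nAB; apply: h; exists A, B.
case=> [[W [lt [w [_ wo eG]]]]|wD]; last exact: wadge_pair_not_pot GA GB AB nAB.
case: (pselect (exists v, lt v w)) => [[v vw]|nv]; last first.
  by apply: (Sigma0_one_not_pot hd eG) => v vw; apply: nv; exists v.
case: (pselect (exists v u, lt u v /\ lt v w)) => [[v' [u [uv v'w]]]|nu].
  exact: (Sigma0_three_not_pot wo hd eG uv v'w GA GB AB nAB).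
apply: (Sigma0_two_not_pot wo hd eG vw) => v' v'w u uv.
by apply: nu; exists v', u.
Qed.
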